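(* Let $T$ be a self-adjoint operator in a complex Hilbert space $\mathcal H$ and let $A$ be a $T$-bounded linear operator in $\mathcal H$ with $T$-bound $<1$. Let $a,b\ge 0$, $b<1$, be such that $$\|Ax\|^2\le a^2\|x\|^2+b^2\|Tx\|^2,\qquad x\in\mathcal D(T).$$ (i) Then $$\sigma(T+A)\cap\Big\{z\in\mathbb C:\ |\operatorname{Im} z|^2>\frac{a^2+b^2|\operatorname{Re} z|^2}{1-b^2}\Big\}=\emptyset .$$ (ii) Suppose $T$ has a spectral gap $(\alpha_T,\beta_T)\subset\mathbb R$, i.e. $\sigma(T)\cap(\alpha_T,\beta_T)=\emptyset$ with $\alpha_T,\beta_T\in\sigma(T)$, and that $$\sqrt{a^2+b^2\alpha_T^2}+\sqrt{a^2+b^2\beta_T^2}<\beta_T-\alpha_T .\qquad ( * )$$ Set $$\alpha_{T+A}:=\alpha_T+\sqrt{a^2+b^2\alpha_T^2},\qquad \beta_{T+A}:=\beta_T-\sqrt{a^2+b^2\beta_T^2}.$$ Then $$\sigma(T+sA)\cap\{z\in\mathbb C:\ \alpha_{T+A}<\operatorname{Re} z<\beta_{T+A}\}=\emptyset,\qquad s\in[0,1].$$ If, in addition, $A$ is symmetric, then $$\sigma(T+A)\cap K_{\sqrt{a^2+b^2\alpha_T^2}}(\alpha_T)\ne\emptyset,\qquad \sigma(T+A)\cap K_{\sqrt{a^2+b^2\beta_T^2}}(\beta_T)\ne\emptyset,$$ where $K_r(c):=\{z\in\mathbb C:|z-c|\le r\}$. (iii) Suppose $T$ has an essential spectral gap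 $(\alpha_T,\beta_T)\subset\mathbb R$, i.e. $\sigma_{\rm ess}(T)\cap(\alpha_T,\beta_T)=\emptyset$ with $\alpha_T,\beta_T\in\sigma_{\rm ess}(T)$, and that $( * )$ holds; let $\alpha_{T+A},\beta_{T+A}$ be given by the same formulas as in (ii). Then the set $$\sigma(T+A)\cap\{z\in\mathbb C:\ \alpha_{T+A}<\operatorname{Re} z<\beta_{T+A}\}$$ consists of at most countably many isolated eigenvalues of $T+A$ of finite algebraic multiplicity, which may accumulate at most at the points $\alpha_{T+A}$, $\beta_{T+A}$.
   Context: $\mathcal D(\cdot)$ denotes the domain. A linear operator $A$ (not necessarily symmetric, closed or bounded) is $T$-bounded if $\mathcal D(T)\subset\mathcal D(A)$ and there are $a,b\ge0$ with $\|Ax\|^2\le a^2\|x\|^2+b^2\|Tx\|^2$ for all $x\in\mathcal D(T)$; the infimum of all $b\ge 0$ for which such an $a\ge 0$ exists is the $T$-bound of $A$. The operators $T+sA$ have domain $\mathcal D(T)$. For a closed operator $S$, $\sigma(S)$ is its spectrum and $\sigma_{\rm ess}(S):=\{\lambda\in\mathbb C: S-\lambda\text{ is not Fredholm}\}$, where an operator is Fredholm if its kernel is finite dimensional and its range has finite codimension. *)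

(* Defs.v *)
From HB Require Import structures.
From mathcomp Require Import all_boot all_order all_algebra.
From mathcomp Require Import complex.
From mathcomp Require Import all_classical all_reals all_analysis.

Set Implicit Arguments.
Unset Strict Implicit.
Unset Printing Implicit Defensive.

Import Order.TTheory GRing.Theory Num.Theory.
Import numFieldNormedType.Exports.

Local Open Scope classical_set_scope.
Local Open Scope ring_scope.
Local Open Scope complex_scope.

(* A linear operator in H is a linear map on a linear subspace opdom of H;
   the values of opfun outside opdom are irrelevant.
   No closedness, boundedness or density is assumed. *)
Record linop (K : nzRingType) (H : lmodType K) := LinOp {
  opdom : set H;
  opfun :> H -> H;
  opdom0 : opdom 0;
  opdomP : forall (c : K) (x y : H),
    opdom x -> opdom y -> opdom (c *: x + y);
  opfunP : forall (c : K) (x y : H),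
    opdom x -> opdom y -> opfun (c *: x + y) = c *: opfun x + opfun y }.

Section Operations.
Variables (K : comNzRingType) (H : lmodType K).
Implicit Types S A : linop H.

Lemma opD_dom0 S A : (opdom S `&` opdom A) 0.
Proof. by split; exact: opdom0. Qed.

Lemma opD_domP S A (c : K) (x y : H) :
  (opdom S `&` opdom A) x -> (opdom S `&` opdom A) y ->
  (opdom S `&` opdom A) (c *: x + y).
Proof. by move=> [Sx Ax] [Sy Ay]; split; exact: opdomP. Qed.

Lemma opD_funP S A (c : K) (x y : H) :
  (opdom S `&` opdom A) x -> (opdom S `&` opdom A) y ->
  S (c *: x + y) + A (c *: x + y) = c *: (S x + A x) + (S y + A y).
Proof.
by move=> [Sx Ax] [Sy Ay]; rewrite !opfunP// scalerDr addrACA.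
Qed.

(* The domain is that of S when opdom S `<=` opdom A. *)
Definition opD S A : linop H :=
  LinOp (opD_dom0 S A) (@opD_domP S A) (@opD_funP S A).

Lemma opZ_funP (s : K) A (c : K) (x y : H) : opdom A x -> opdom A y ->
  s *: A (c *: x + y) = c *: (s *: A x) + s *: A y.
Proof.
by move=> Ax Ay; rewrite opfunP// scalerDr !scalerA mulrC.
Qed.

Definition opZ (s : K) A : linop H :=
  LinOp (opdom0 A) (@opdomP _ _ A) (@opZ_funP s A).

Definition opshift S (z : K) (x : H) : H := S x - z *: x.

Definition opker S (z : K) : set H :=
  [set x | opdom S x /\ opshift S z x = 0].

Definition opran S (z : K) : set H := opshift S z @` opdom S.

Definition lspan n (e : 'I_n -> H) : set H :=
  [set x | exists c : 'I_n -> K, x = \sum_(i < n) c i *: e i].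

(* For a linear subspace V of H over a field. *)
Definition fin_dim (V : set H) : Prop :=
  exists n (e : 'I_n -> H), V `<=` lspan e.

Definition fin_codim (V : set H) : Prop :=
  exists n (e : 'I_n -> H),
    forall x, exists2 v, V v & lspan e (x - v).

Definition fredholm S (z : K) : Prop :=
  fin_dim (opker S z) /\ fin_codim (opran S z).

Definition ess_spectrum S : set K := [set z | ~ fredholm S z].

Definition point_spectrum S : set K :=
  [set z | exists x, [/\ x != 0, opdom S x & S x = z *: x]].

End Operations.

Section Spectrum.
Variables (R : realType) (H : completeNormedModType R[i]).
Implicit Types S T A : linop H.

(* z is in the resolvent set when S - z is a bijection of the domain onto H
   with bounded inverse; for closed S the last clause is automatic. *)
Definition resolvent_set S : set R[i] :=
  [set z | set_bij (opdom S) setT (opshift S z) /\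
    exists M : R, forall x, opdom S x -> `|x| <= M%:C * `|opshift S z x| ].

Definition spectrum S : set R[i] := ~` resolvent_set S.

(* (S - z)^-1 x, meaningful for z in the resolvent set. *)
Definition resolvent S (z : R[i]) (x : H) : H :=
  get [set v | opdom S v /\ opshift S z v = x].

Definition rel_bounded_by T A (a b : R) : Prop :=
  forall x, opdom T x ->
    `|A x| ^+ 2 <= (a ^+ 2)%:C * `|x| ^+ 2 + (b ^+ 2)%:C * `|T x| ^+ 2.

Definition rel_bounded T A : Prop :=
  opdom T `<=` opdom A /\
  exists a b : R, [/\ 0 <= a, 0 <= b & rel_bounded_by T A a b].

Definition rel_bound T A : R :=
  inf [set b : R | 0 <= b /\ exists2 a : R, 0 <= a & rel_bounded_by T A a b].

(* Integral over the positively oriented circle of centre c and radius r. *)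
Definition circle_point (c : R[i]) (r t : R) : R[i] :=
  c + r%:C * (cos t +i* sin t).

Definition circle_integral (f : R[i] -> R[i]) (c : R[i]) (r : R) : R[i] :=
  let g t := f (circle_point c r t) * (0 +i* r) * (cos t +i* sin t) in
  (\int[lebesgue_measure]_(t in `[0, 2 * pi]) complex.Re (g t)) +i*
  (\int[lebesgue_measure]_(t in `[0, 2 * pi]) complex.Im (g t)).

End Spectrum.

Section InnerProduct.
Variables (R : realType) (H : completeNormedModType R[i]).
Variable ip : {dot H for (@Num.conj R[i])}.
Implicit Types S T A : linop H.

Definition opgraph S : set (H * H) :=
  [set p | opdom S p.1 /\ S p.1 = p.2].

(* The graph of the adjoint when S is densely defined. *)
Definition adjoint_graph S : set (H * H) :=
  [set p | forall x, opdom S x -> ip (S x) p.1 = ip x p.2].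

Definition self_adjoint T : Prop :=
  dense (opdom T) /\ opgraph T = adjoint_graph T.

Definition symmetric_op A : Prop :=
  forall x y, opdom A x -> opdom A y -> ip (A x) y = ip x (A y).

(* P = - (2 pi i)^-1 \oint (S - z)^-1 dz, weakly, along a circle enclosing no
   point of the spectrum other than possibly l. *)
Definition riesz_projection S (l : R[i]) (P : H -> H) : Prop :=
  exists r : R, [/\ 0 < r,
    forall z, z != l -> `|z - l| <= r%:C -> resolvent_set S z &
    forall x y, ip (P x) y =
      - (0 +i* (2 * pi))^-1 *
        circle_integral (fun z => ip (resolvent S z x) y) l r].

(* The algebraic multiplicity of an isolated point of the spectrum is the
   rank of its Riesz projection. *)
Definition fin_alg_mult S (l : R[i]) : Prop :=
  exists2 P : H -> H, riesz_projection S l P & fin_dim (range P).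

End InnerProduct.

(* Main.v *)
Require Import Defs.
From HB Require Import structures.
From mathcomp Require Import all_boot all_order all_algebra.
From mathcomp Require Import complex ring lra.
From mathcomp Require Import all_classical all_reals all_analysis.

Set Implicit Arguments.
Unset Strict Implicit.
Unset Printing Implicit Defensive.

Import Order.TTheory GRing.Theory Num.Theory.
Import numFieldNormedType.Exports.

Local Open Scope classical_set_scope.
Local Open Scope ring_scope.
Local Open Scope complex_scope.

(* For self-adjoint T with a gap ]al, be[ in its spectrum, a quadratic
   polynomial with positive leading coefficient that is nonnegative off the gap
   has its roots in the gap, so completing the square and the estimate
   dist(c, sigma(T)) |u| <= |(T - c) u| turn it into an inequality between
   |Tu|^2, Re <Tu, u> and |u|^2.  Applied to |t - z|^2 - a^2 - b^2 t^2 - k(1 + t^2)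
   this gives |Au| <= q |(T - z) u| with q < 1, and a Neumann series puts z in
   the resolvent set of T + A: this is (i) (empty gap) and the first half of (ii).
   The second half holds because the distance from alpha to the spectrum of the
   symmetric operator T + A is at most the infimum of |(T + A - alpha) u| / |u|.

   For (iii), T has finitely many eigenvalues, of finite multiplicity, in a
   compact part [al, be] of the gap.  Moving them to al and letting A vanish on
   their eigenvectors gives S0 with T + A = S0 + finite rank, and z is in the
   resolvent set of S0 as in (ii).  The spectrum of T + A is then locally the
   zero set of an analytic determinant, which either vanishes near z or has an
   isolated zero; the first case propagates along the vertical line through z
   and is excluded by (i).  Finally Cramer's rule writes the resolvent as an
   analytic function divided by a power of (z - z0), whose residue has finite
   rank. *)

(** Neither the spectral theorem nor complex function theory is used: the distance estimate has a
    variational proof, and analyticity means geometrically bounded difference quotients at one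
    point. For the finiteness in (iii), a range of finite codimension bounds |v| by |(T - t) v| and
    finitely many |<v, e>|; compactness makes this uniform on [al, be], and Bessel's inequality then
    limits the length of an orthonormal family of eigenvectors. The eigenvalues are moved to al
    because the new operator T' has the gap ]al, be[ and, with P the projection onto the
    eigenvectors, T (1 - P) = (1 - P) T'; so |A (1 - P) x|^2 <= a^2 |x|^2 + b^2 |T' x|^2 with the
    same a and b. The operator S0 depends on z, but it serves the whole vertical half-line from z
    away from the real axis, where |Im| only grows. The estimates hold on the closed strip except at
    its two real corners, which is why only these can be accumulation points. *)

(** * Real-valued norms and inner products *)

(** Norms on a module over [R[i]] take values in [R[i]]; the real part carries the same information
    and admits real arithmetic. *)
Definition nm (R : realType) (V : normedZmodType R[i]) (x : V) : R :=
  complex.Re `|x|.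

Section RealNorm.
Context {R : realType}.
Implicit Types (V : normedZmodType R[i]) (H : normedModType R[i]).

Lemma nmE V (x : V) : `|x| = (nm x)%:C.
Proof. by rewrite /nm RRe_real// normr_real. Qed.

Lemma nm_ge0 V (x : V) : 0 <= nm x.
Proof. by rewrite -ler0c -nmE. Qed.

Lemma nm0 V : nm (0 : V) = 0.
Proof. by rewrite /nm normr0. Qed.

Lemma nm_eq0 V (x : V) : (nm x == 0) = (x == 0).
Proof. by rewrite -[RHS]normr_eq0 nmE eq_complex/= eqxx andbT. Qed.

Lemma nm_gt0 V (x : V) : (0 < nm x) = (x != 0).
Proof. by rewrite lt_neqAle nm_ge0 andbT eq_sym nm_eq0. Qed.

Lemma nm_le0 V (x : V) : nm x <= 0 -> x = 0.
Proof. by move=> h; apply/eqP; rewrite -nm_eq0 eq_le h nm_ge0. Qed.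

Lemma nmN V (x : V) : nm (- x) = nm x.
Proof. by rewrite /nm normrN. Qed.

Lemma nmD V (x y : V) : nm (x + y) <= nm x + nm y.
Proof. by rewrite -lecR [X in _ <= X]rmorphD/= -!nmE ler_normD. Qed.

Lemma nmB V (x y : V) : nm (x - y) <= nm x + nm y.
Proof. by rewrite -(nmN y) nmD. Qed.

Lemma nm_sym V (x y : V) : nm (x - y) = nm (y - x).
Proof. by rewrite -nmN opprB. Qed.

Lemma nm_tri V (z x y : V) : nm (x - y) <= nm (x - z) + nm (z - y).
Proof. by rewrite -{1}(subrK z x) -addrA nmD. Qed.

Lemma nm_le_sub V (x y : V) : nm x <= nm (x - y) + nm y.
Proof. by rewrite -{1}(subrK y x) nmD. Qed.

Lemma nm_sum V (I : Type) (s : seq I) (P : pred I) (F : I -> V) :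
  nm (\sum_(i <- s | P i) F i) <= \sum_(i <- s | P i) nm (F i).
Proof.
elim/big_ind2 : _ => //; first by rewrite nm0.
by move=> x1 x2 y1 y2 h1 h2; apply: (le_trans (nmD _ _)); exact: lerD.
Qed.

Lemma nmZ H (c : R[i]) (x : H) : nm (c *: x) = nm c * nm x.
Proof. by apply: complexI; rewrite rmorphM/= -!nmE normrZ. Qed.

Lemma nmM (c d : R[i]) : nm (c * d) = nm c * nm d.
Proof. by apply: complexI; rewrite rmorphM/= -!nmE normrM. Qed.

Lemma nmX (c : R[i]) n : nm (c ^+ n) = nm c ^+ n.
Proof. by apply: complexI; rewrite rmorphXn/= -!nmE normrX. Qed.

Lemma nmV (c : R[i]) : nm c^-1 = (nm c)^-1.
Proof. by apply: complexI; rewrite fmorphV/= -!nmE normfV. Qed.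

Lemma nmRe (t : R) : nm t%:C = `|t|.
Proof. by rewrite /nm normc_def/= expr0n/= addr0 sqrtr_sqr. Qed.

Lemma nm_sqr (z : R[i]) : nm z ^+ 2 = complex.Re z ^+ 2 + complex.Im z ^+ 2.
Proof. by rewrite /nm normc_def/= sqr_sqrtr// addr_ge0 ?sqr_ge0. Qed.

Lemma nm_conj (z : R[i]) : nm z^*%C = nm z.
Proof. by rewrite /nm normcJ. Qed.

Lemma Re_le_nm (z : R[i]) : `|complex.Re z| <= nm z.
Proof. by rewrite -lecR -nmE normc_ge_Re. Qed.

Lemma Im_le_nm (z : R[i]) : `|complex.Im z| <= nm z.
Proof.
rewrite -(@ler_pXn2r _ 2)// ?nnegrE ?nm_ge0//.
by rewrite nm_sqr real_normK ?num_real// lerDr sqr_ge0.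
Qed.

End RealNorm.

Section Hilbert.
Variables (R : realType) (H : completeNormedModType R[i]).
Variable ip : {dot H for (@Num.conj R[i])}.
Hypothesis ip_norm : forall x : H, ip x x = `|x| ^+ 2.

Implicit Types x y z l : H.
Lemma ipDl x y z : ip (x + y) z = ip x z + ip y z.
Proof. exact: linearDl. Qed.
Lemma ipDr x y z : ip x (y + z) = ip x y + ip x z.
Proof. exact: linearDr. Qed.
Lemma ipNl x y : ip (- x) y = - ip x y.
Proof. exact: linearNl. Qed.
Lemma ipBl x y z : ip (x - y) z = ip x z - ip y z.
Proof. exact: linearBl. Qed.
Lemma ipBr x y z : ip x (y - z) = ip x y - ip x z.
Proof. exact: linearBr. Qed.
Lemma ipZl c x y : ip (c *: x) y = c * ip x y.
Proof. exact: linearZl_LR. Qed.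
Lemma ipZr c x y : ip x (c *: y) = c^*%C * ip x y.
Proof. exact: linearZr_LR. Qed.
Lemma ip0l x : ip 0 x = 0.
Proof. exact: linear0l. Qed.
Lemma ip0r x : ip x 0 = 0.
Proof. exact: linear0r. Qed.
Lemma ipC x y : ip x y = (ip y x)^*%C.
Proof. by rewrite (hermC ip x y) expr0 mul1r. Qed.
Lemma ip_suml (I : Type) (s : seq I) (P : pred I) (F : I -> H) y :
  ip (\sum_(i <- s | P i) F i) y = \sum_(i <- s | P i) ip (F i) y.
Proof. exact: linear_sumlz. Qed.
Lemma ip_sumr (I : Type) (s : seq I) (P : pred I) (F : I -> H) y :
  ip y (\sum_(i <- s | P i) F i) = \sum_(i <- s | P i) ip y (F i).
Proof. exact: linear_sumr. Qed.

Lemma ipxx x : ip x x = (nm x ^+ 2)%:C.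
Proof. by rewrite ip_norm nmE rmorphXn. Qed.

(** Cauchy--Schwarz, by expanding the square of | |y|^2 x - <x, y> y |, a multiple of the usual
    orthogonal component that avoids division. *)
Lemma ip_le x y : nm (ip x y) <= nm x * nm y.
Proof.
have [->|y0] := eqVneq y 0; first by rewrite ip0r !nm0 mulr0.
have ny : 0 < nm y by rewrite nm_gt0.
rewrite -(@ler_pM2r _ (nm y)) //.
rewrite -(@ler_pXn2r _ 2)// ?nnegrE ?mulr_ge0 ?nm_ge0//.
set c := ip x y.
have := nm_ge0 (((nm y) ^+ 2)%:C *: x - c *: y).
rewrite -[0 <= _](@ler_pXn2r _ 2)// ?nnegrE ?nm_ge0// expr0n/=.
rewrite -lecR -ipxx !(ipBl, ipBr, ipZl, ipZr) !ipxx -/c (ipC y x) -/c conjc_real.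
set a := nm y ^+ 2; set b := nm x ^+ 2.
have -> : a%:C * (a%:C * b%:C) - a%:C * (c^* * c) -
   (c * (a%:C * c^*) - c * (c^* * a%:C)) = a%:C * ((a * b)%:C - c * c^*).
  by move: (nm y ^+ 2 : R) (nm x ^+ 2 : R) @a @b => a b /=; rewrite rmorphM/=; ring.
rewrite -sqr_normc nmE -rmorphXn/= -rmorphB/= -rmorphM/= lecR.
rewrite pmulr_rge0 ?exprn_gt0// subr_ge0 => h.
rewrite [leLHS]exprMn [leRHS]exprMn exprMn -/a -/b ler_pM2r ?exprn_gt0//.
by rewrite mulrC.
Qed.

Definition re_ip x y : R := complex.Re (ip x y).

Lemma ripC x y : re_ip x y = re_ip y x.
Proof. by rewrite /re_ip (ipC x y); case: (ip y x). Qed.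
Lemma ripDl x y z : re_ip (x + y) z = re_ip x z + re_ip y z.
Proof. by rewrite /re_ip ipDl; case: (ip x z); case: (ip y z). Qed.
Lemma ripNl x y : re_ip (- x) y = - re_ip x y.
Proof. by rewrite /re_ip ipNl; case: (ip x y). Qed.
Lemma ripDr x y z : re_ip x (y + z) = re_ip x y + re_ip x z.
Proof. by rewrite !(ripC x) ripDl. Qed.
Lemma ripNr x y : re_ip x (- y) = - re_ip x y.
Proof. by rewrite !(ripC x) ripNl. Qed.
Lemma ripZl (t : R) x y : re_ip (t%:C *: x) y = t * re_ip x y.
Proof. by rewrite /re_ip ipZl; case: (ip x y) => u v /=; rewrite mul0r subr0. Qed.
Lemma ripZr (t : R) x y : re_ip x (t%:C *: y) = t * re_ip x y.
Proof. by rewrite !(ripC x) ripZl. Qed.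
Lemma ripxx x : re_ip x x = nm x ^+ 2.
Proof. by rewrite /re_ip ipxx. Qed.
Lemma rip_le x y : `|re_ip x y| <= nm x * nm y.
Proof. exact: le_trans (Re_le_nm _) (ip_le _ _). Qed.

Lemma nmD_sqr x y : nm (x + y) ^+ 2 = nm x ^+ 2 + 2 * re_ip x y + nm y ^+ 2.
Proof. by rewrite -!ripxx ripDl !ripDr (ripC y x); ring. Qed.

Lemma nmB_sqr x y : nm (x - y) ^+ 2 = nm x ^+ 2 - 2 * re_ip x y + nm y ^+ 2.
Proof. by rewrite nmD_sqr nmN ripNr; ring. Qed.

Lemma parallelogram x y :
  nm (x + y) ^+ 2 + nm (x - y) ^+ 2 = 2 * nm x ^+ 2 + 2 * nm y ^+ 2.
Proof. by rewrite nmD_sqr nmB_sqr; ring. Qed.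

(** Convergence in terms of [nm] and a real tolerance, so that explicit error bounds can be used
    directly. *)
Definition clim (u : nat -> H) (l : H) :=
  forall e : R, 0 < e -> exists N, forall n, (N <= n)%N -> nm (u n - l) <= e.

Lemma clim_cauchy (u : nat -> H) :
  (forall e : R, 0 < e -> exists N, forall m n, (N <= m)%N -> (N <= n)%N ->
     nm (u m - u n) <= e) -> exists l, clim u l.
Proof.
move=> cu.
have : cauchy (u @ \oo).
  apply: cauchy_exP => e; rewrite ltcE/= => /andP[/eqP ei e0].
  have eE : e = (complex.Re e)%:C by rewrite [LHS]complexE ei mulr0 addr0.
  have [N hN] := cu (complex.Re e / 2) (divr_gt0 e0 (ltr0Sn _ 1)).
  exists (u N); exists N => // n /= Nn.
  rewrite -ball_normE/= nmE eE ltcR (le_lt_trans (hN _ _ _ Nn))//.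
  by rewrite ltr_pdivrMr// ltr_pMr// ltr1n.
move/cauchy_cvgP => cvu.
exists (lim (u @ \oo)) => e e0.
move/cvgrPdist_le : cvu => /(_ e%:C).
rewrite ltcR => /(_ e0)[N _ hN]; exists N => n Nn.
by have := hN n Nn; rewrite nmE lecR nm_sym.
Qed.

End Hilbert.

(** * Linear operators and resolvents *)

Section Operators.
Variables (R : realType) (H : completeNormedModType R[i]).
Implicit Types (S T A : linop H) (x y u v w l : H) (z : R[i]).

Lemma opdomZ S c x : opdom S x -> opdom S (c *: x).
Proof. by move=> Sx; rewrite -[_ *: _]addr0; apply: opdomP => //; exact: opdom0. Qed.

Lemma opdomD S x y : opdom S x -> opdom S y -> opdom S (x + y).
Proof. by move=> Sx Sy; rewrite -[x]scale1r; exact: opdomP. Qed.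

Lemma opdomB S x y : opdom S x -> opdom S y -> opdom S (x - y).
Proof. by move=> Sx Sy; rewrite -[- y]scaleN1r addrC; exact: opdomP. Qed.

Lemma opdom_sum S (I : Type) (s : seq I) (P : pred I) (F : I -> H) :
  (forall i, opdom S (F i)) -> opdom S (\sum_(i <- s | P i) F i).
Proof.
by move=> h; elim/big_ind : _ => //; [exact: opdom0 | exact: opdomD].
Qed.

Lemma opfunD S x y : opdom S x -> opdom S y -> S (x + y) = S x + S y.
Proof. by move=> Sx Sy; rewrite -{1}[x]scale1r opfunP// scale1r. Qed.

Lemma opfun0 S : S 0 = 0.
Proof.
have := opfunD (opdom0 S) (opdom0 S).
by rewrite addr0 => /eqP; rewrite -subr_eq subrr eq_sym => /eqP.
Qed.

Lemma opfunZ S c x : opdom S x -> S (c *: x) = c *: S x.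
Proof. by move=> Sx; rewrite -[c *: x]addr0 opfunP//; [rewrite opfun0 addr0|exact: opdom0]. Qed.

Lemma opfunB S x y : opdom S x -> opdom S y -> S (x - y) = S x - S y.
Proof.
move=> Sx Sy; rewrite -[- y]scaleN1r opfunD//; last exact: opdomZ.
by rewrite opfunZ// scaleN1r.
Qed.

Lemma opfun_sum S (I : Type) (s : seq I) (P : pred I) (F : I -> H) :
  (forall i, opdom S (F i)) ->
  S (\sum_(i <- s | P i) F i) = \sum_(i <- s | P i) S (F i).
Proof.
move=> h; suff [_ <-] : opdom S (\sum_(i <- s | P i) F i) /\
    \sum_(i <- s | P i) S (F i) = S (\sum_(i <- s | P i) F i) by [].
elim/big_rec2 : _ => [|i _ x _ [Sx ->]]; first by rewrite opfun0; split=> //; exact: opdom0.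
by rewrite opfunD//; split=> //; exact: opdomD.
Qed.

Lemma opshiftD S z x y : opdom S x -> opdom S y ->
  opshift S z (x + y) = opshift S z x + opshift S z y.
Proof. by move=> Sx Sy; rewrite /opshift opfunD// scalerDr opprD addrACA. Qed.

Lemma opshiftB S z x y : opdom S x -> opdom S y ->
  opshift S z (x - y) = opshift S z x - opshift S z y.
Proof.
by move=> Sx Sy; rewrite /opshift opfunB// scalerBr !opprD opprK addrACA.
Qed.

Lemma opshiftZ S z c x : opdom S x -> opshift S z (c *: x) = c *: opshift S z x.
Proof.
by move=> Sx; rewrite /opshift opfunZ// scalerBr !scalerA mulrC.
Qed.

Lemma opshift0 S z : opshift S z 0 = 0.
Proof. by rewrite /opshift opfun0 scaler0 subr0. Qed.

Lemma resolvent_setP S z : resolvent_set S z <->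
  (forall y, exists2 x, opdom S x & opshift S z x = y) /\
  exists2 M : R, 0 < M & forall x, opdom S x -> nm x <= M * nm (opshift S z x).
Proof.
split=> [[[_ _ surj] [M hM]]|[surj [M M0 hM]]].
  split=> [y|]; first by have [x Sx <-] := surj y I; exists x.
  exists (`|M| + 1); first by rewrite ltr_pwDr.
  move=> x /hM; rewrite !nmE -rmorphM/= lecR => /le_trans; apply.
  by rewrite ler_wpM2r ?nm_ge0// (le_trans (ler_norm M))// lerDl.
split; last by exists M => x /hM; rewrite !nmE -rmorphM/= lecR.
split=> //.
- move=> x y; rewrite !inE => Sx Sy e; apply/eqP; rewrite -subr_eq0; apply/eqP.
  apply: nm_le0; apply: (le_trans (hM _ (opdomB Sx Sy))).
  by rewrite opshiftB// e subrr nm0 mulr0.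
- by move=> y _; have [x Sx <-] := surj y; exists x.
Qed.

Lemma resolventP S z x : resolvent_set S z ->
  opdom S (resolvent S z x) /\ opshift S z (resolvent S z x) = x.
Proof.
move=> /resolvent_setP[surj _]; have [u Su e] := surj x.
exact: (@getPex _ [set v | opdom S v /\ opshift S z v = x] (ex_intro _ u (conj Su e))).
Qed.

Lemma resolvent_inj S z u v : resolvent_set S z -> opdom S u -> opdom S v ->
  opshift S z u = opshift S z v -> u = v.
Proof.
move=> /resolvent_setP[_ [M M0 hM]] Su Sv e; apply/eqP; rewrite -subr_eq0.
apply/eqP; apply: nm_le0; apply: (le_trans (hM _ (opdomB Su Sv))).
by rewrite opshiftB// e subrr nm0 mulr0.
Qed.

Lemma resolvent_unique S z u x : resolvent_set S z -> opdom S u ->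
  opshift S z u = x -> resolvent S z x = u.
Proof.
move=> rz Su e; have [d e'] := resolventP x rz.
by apply: (resolvent_inj rz) => //; rewrite e'.
Qed.

Lemma expr_small (q e : R) : 0 <= q -> q < 1 -> 0 < e ->
  exists N, forall n, (N <= n)%N -> q ^+ n <= e.
Proof.
move=> q0 q1 e0.
have : `|q| < 1 by rewrite ger0_norm.
move/cvg_expr/cvgrPdist_le => /(_ e e0)[N _ hN]; exists N => n Nn.
by have := hN n Nn; rewrite /= sub0r normrN ger0_norm// exprn_ge0.
Qed.

Lemma geometric_step (u : nat -> H) (C q : R) : 0 <= q -> q < 1 ->
  (forall n, nm (u n.+1 - u n) <= C * q ^+ n) ->
  forall n k, nm (u (n + k)%N - u n) <= C * q ^+ n / (1 - q).
Proof.
move=> q0 q1 hu n k; have q1' : 0 < 1 - q by rewrite subr_gt0.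
have C0 : 0 <= C by rewrite (le_trans (nm_ge0 (u 1%N - u 0%N)))// -[leRHS]mulr1; exact: hu.
(* The factor 1 - q^k, the exact partial geometric sum, makes the bound inductive in k. *)
suff : nm (u (n + k)%N - u n) <= C * q ^+ n / (1 - q) * (1 - q ^+ k).
  move=> /le_trans; apply; rewrite ler_piMr//; last by rewrite gerBl exprn_ge0.
  by rewrite divr_ge0// ?mulr_ge0// ?exprn_ge0// ltW.
elim: k => [|k ih]; first by rewrite addn0 !subrr nm0 mulr0.
rewrite addnS (le_trans (nm_tri (u (n + k)%N) _ _))//.
apply: (le_trans (lerD (hu _) ih)).
rewrite exprD exprS le_eqVlt; apply/orP; left; apply/eqP; field.
by rewrite gt_eqF.
Qed.

Lemma geometric_clim (u : nat -> H) (C q : R) : 0 <= q -> q < 1 ->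
  (forall n, nm (u n.+1 - u n) <= C * q ^+ n) ->
  exists2 l, clim u l & forall n, nm (u n - l) <= C * q ^+ n / (1 - q).
Proof.
move=> q0 q1 hu; have q1' : 0 < 1 - q by rewrite subr_gt0.
have st := geometric_step q0 q1 hu.
have C0 : 0 <= C by rewrite (le_trans (nm_ge0 (u 1%N - u 0%N)))// -[leRHS]mulr1; exact: hu.
have [l ul] : exists l, clim u l.
  apply: clim_cauchy => e e0.
  have [N hN] := @expr_small q (e * (1 - q) / (2 * (C + 1))) q0 q1
    ltac:(by rewrite divr_gt0// mulr_gt0// ltr_pwDr).
  have key n : (N <= n)%N -> nm (u n - u N) <= e / 2.
    move=> Nn; have := st N (n - N)%N; rewrite subnKC// => /le_trans; apply.
    rewrite ler_pdivrMr//; apply: (le_trans (ler_wpM2l C0 (hN N (leqnn N)))).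
    rewrite mulrA ler_pdivrMr ?mulr_gt0// ?ltr_pwDr//.
    by rewrite mulrCA mulrAC -!mulrA; have : 0 <= e * (1 - q) := ltW (mulr_gt0 e0 q1'); nra.
  exists N => m n /key hm /key; rewrite nm_sym => hn.
  by rewrite (le_trans (nm_tri (u N) _ _))// [e]splitr lerD.
exists l => // n; apply/ler_addgt0Pl => e e0.
have [N hN] := ul e e0.
rewrite nm_sym (le_trans (nm_tri (u (n + N)%N) _ _))// lerD//.
by rewrite nm_sym hN// leq_addl.
Qed.

(* Neumann series, run as an iteration so that no operator inverse is formed. *)
Lemma resolvent_perturb S S' z z' (q : R) :
  (forall x, opdom S' x <-> opdom S x) -> q < 1 ->
  (forall u, opdom S u ->
     nm (opshift S' z' u - opshift S z u) <= q * nm (opshift S z u)) ->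
  resolvent_set S z -> resolvent_set S' z'.
Proof.
move=> dom q1 hq rz.
wlog q0 : q q1 hq / 0 <= q.
  move=> h; apply: (h (Num.max q 0)); rewrite ?gt_max ?q1 ?ltr01 ?le_max ?lexx ?orbT//.
  move=> u Su; apply: (le_trans (hq u Su)).
  by rewrite ler_wpM2r ?nm_ge0// le_max lexx.
have q1' : 0 < 1 - q by rewrite subr_gt0.
have [surj [M M0 hM]] := (resolvent_setP S z).1 rz.
apply/resolvent_setP; split; last first.
  exists (M / (1 - q)); first by rewrite divr_gt0.
  move=> x /dom Sx; apply: (le_trans (hM x Sx)).
  rewrite -mulrA ler_pM2l// ler_pdivlMl// mulrBl mul1r lerBlDr.
  rewrite (le_trans (nm_le_sub _ (opshift S' z' x)))// addrC lerD2l nm_sym.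
  exact: hq.
move=> y.
pose r v := resolvent S z v.
have rd v : opdom S (r v) by have [] := resolventP v rz.
have rE v : opshift S z (r v) = v by have [] := resolventP v rz.
have step v w : nm ((v - w) - (opshift S' z' (r v) - opshift S' z' (r w)))
    <= q * nm (v - w).
  have := hq _ (opdomB (rd v) (rd w)); rewrite nm_sym.
  by rewrite !opshiftB ?rE//; apply/dom.
(* By [step], F is a contraction with constant q; its fixed point l satisfies (S' - z') (r l) =
   y. *)
pose F v := v + (y - opshift S' z' (r v)).
pose a n := iter n F 0.
have aS n : a n.+1 - a n = y - opshift S' z' (r (a n)).
  by rewrite /a iterS -/(a n) /F addrC addKr.
have hF n : nm (a n.+1 - a n) <= nm (a 1%N - a 0%N) * q ^+ n.
  elim: n => [|n ih]; first by rewrite expr0 mulr1.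
  have -> : a n.+2 - a n.+1 = (a n.+1 - a n) -
      (opshift S' z' (r (a n.+1)) - opshift S' z' (r (a n))).
    by rewrite !aS; move: (opshift _ _ _) (opshift _ _ _) => p p'; rewrite opprB addrA subrK.
  by rewrite (le_trans (step _ _))// exprS mulrCA ler_wpM2l.
have [l al _] := geometric_clim q0 q1 hF.
exists (r l); first by apply/dom.
apply/eqP; rewrite -subr_eq0; apply/eqP; apply: nm_le0; rewrite nm_sym.
apply/ler_addgt0Pl => e e0; rewrite addr0.
have [N hN] := al (e / 4) (divr_gt0 e0 (ltr0Sn _ 3)).
have -> : y - opshift S' z' (r l) =
   (a N.+1 - l) - ((a N - l) - (opshift S' z' (r (a N)) - opshift S' z' (r l))).
  rewrite /a iterS -/(a N) /F.
  move: (a N) (opshift _ _ _) (opshift _ _ _) => c p p'.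
  by rewrite [X in _ = X - _]addrAC [X in _ = X - _]addrC addrKA opprK addrA subrK.
rewrite (le_trans (nmB _ _))// [e]splitr lerD//.
  by rewrite (le_trans (hN _ (leqnSn _)))// ler_pM2l// lef_pV2 ?posrE// ler_nat.
rewrite (le_trans (step _ _))// (le_trans (ler_piMl (nm_ge0 _) (ltW q1)))//.
by rewrite (le_trans (hN _ (leqnn _)))// ler_pM2l// lef_pV2 ?posrE// ler_nat.
Qed.

Lemma resolvent_open S z : resolvent_set S z ->
  exists2 e : R, 0 < e & forall z', nm (z' - z) <= e -> resolvent_set S z'.
Proof.
move=> rz; have [_ [M M0 hM]] := (resolvent_setP S z).1 rz.
exists (2 * M)^-1; first by rewrite invr_gt0 mulr_gt0.
move=> z' h; apply: (@resolvent_perturb S S z z' 2^-1) => //.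
  by rewrite invf_lt1// ltr1n.
move=> u Su; rewrite /opshift [S u - z' *: u]addrC addrKA opprK addrC -scalerBl.
rewrite nmZ nm_sym (le_trans (ler_wpM2r (nm_ge0 _) h))//.
by rewrite invfM -mulrA ler_pM2l// ler_pdivrMl//; exact: hM.
Qed.

End Operators.

(** * Self-adjoint operators *)

Section SelfAdjoint.
Variables (R : realType) (H : completeNormedModType R[i]).
Variable ip : {dot H for (@Num.conj R[i])}.
Hypothesis ip_norm : forall x : H, ip x x = `|x| ^+ 2.
Implicit Types (S T A : linop H) (x y u v w l : H) (z : R[i]).
Local Notation rip := (re_ip ip).

Lemma clim_add (s : nat -> H) (s' : nat -> H) l l' :
  clim s l -> clim s' l' -> clim (fun n => s n + s' n) (l + l').
Proof.
move=> h h' e e0; have [N hN] := h _ (divr_gt0 e0 (ltr0Sn _ 1)).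
have [N' hN'] := h' _ (divr_gt0 e0 (ltr0Sn _ 1)).
exists (maxn N N') => n; rewrite geq_max => /andP[Nn N'n].
by rewrite opprD addrACA (le_trans (nmD _ _))// [e]splitr lerD ?hN ?hN'.
Qed.

Lemma clim_scale (s : nat -> H) l (c : R[i]) :
  clim s l -> clim (fun n => c *: s n) (c *: l).
Proof.
move=> h e e0; have c1 : 0 < nm c + 1 by rewrite ltr_pwDr// nm_ge0.
have [N hN] := h (e / (nm c + 1)) (divr_gt0 e0 c1).
exists N => n Nn; rewrite -scalerBr nmZ.
apply: (le_trans (ler_wpM2l (nm_ge0 c) (hN n Nn))).
by rewrite mulrCA ler_piMr ?ltW// ltr_pdivrMr// mul1r ltrDl.
Qed.

Definition closed_op S := forall (s : nat -> H) l w,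
  (forall n, opdom S (s n)) -> clim s l -> clim (fun n => S (s n)) w ->
  opdom S l /\ S l = w.

Lemma sa_graph T : self_adjoint ip T -> forall u w,
  (forall x, opdom T x -> ip (T x) u = ip x w) -> opdom T u /\ T u = w.
Proof.
by move=> [_ e] u w h; have : adjoint_graph ip T (u, w) by []; rewrite -e.
Qed.

Lemma sa_sym T : self_adjoint ip T -> symmetric_op ip T.
Proof.
move=> [_ e] x y Tx Ty.
have : opgraph T (y, T y) by [].
by rewrite e => /(_ x Tx).
Qed.

(** The graph is the adjoint graph, cut out by the equations <T x, u> = <x, w>, and each of these
    survives limits in u and w by Cauchy--Schwarz. *)
Lemma sa_closed T : self_adjoint ip T -> closed_op T.
Proof.
move=> Tsa s l w Ts sl sw; apply: (sa_graph Tsa) => x Tx.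
apply/eqP; rewrite -subr_eq0; apply/eqP; apply: nm_le0.
have -> : ip (T x) l - ip x w = (ip l (T x) - ip w x)^*%C.
  by rewrite (ipC ip (T x)) (ipC ip x) rmorphB.
rewrite nm_conj.
apply/ler_addgt0Pl => e e0; rewrite addr0.
have x1 : 0 < nm x + nm (T x) + 1 by rewrite ltr_pwDr// addr_ge0 ?nm_ge0.
set d := e / (nm x + nm (T x) + 1).
have d0 : 0 < d by rewrite divr_gt0.
have [N hN] := sl _ d0; have [N' hN'] := sw _ d0.
set n := maxn N N'.
have -> : ip l (T x) - ip w x =
    ip (T (s n) - w) x - ip (s n - l) (T x).
  by rewrite !(ipBl ip) (sa_sym Tsa (Ts n) Tx); ring.
rewrite (le_trans (nmB _ _))//.
rewrite (le_trans (lerD (ip_le ip_norm _ _) (ip_le ip_norm _ _)))//.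
rewrite (le_trans (lerD (ler_wpM2r (nm_ge0 _) (hN' n (leq_maxr _ _)))
  (ler_wpM2r (nm_ge0 _) (hN n (leq_maxl _ _)))))//.
rewrite -mulrDr /d -mulrA ler_piMr ?ltW// mulrC ltr_pdivrMr// mul1r.
by rewrite ltrDl.
Qed.

(* The minimiser of |(T - z) u - y| exists by the parallelogram law, and its
   residual is orthogonal to the range, hence an eigenvector of T for z^*. *)
Lemma sa_resolvent T z (m : R) : self_adjoint ip T -> 0 < m ->
  (forall u, opdom T u -> m * nm u <= nm (opshift T z u)) ->
  (forall u, opdom T u -> m * nm u <= nm (opshift T z^*%C u)) ->
  resolvent_set T z.
Proof.
move=> Tsa m0 hz hzc; apply/resolvent_setP; split; last first.
  exists m^-1; first by rewrite invr_gt0.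
  by move=> u Tu; rewrite ler_pdivlMl// hz.
move=> y.
pose E := [set r : R | exists2 u, opdom T u & r = nm (opshift T z u - y) ^+ 2].
have hE : has_inf E.
  split; first by exists (nm (opshift T z 0 - y) ^+ 2); exists 0 => //; exact: opdom0.
  by exists 0 => r [u _ ->]; exact: sqr_ge0.
pose d := inf E.
have dE u : opdom T u -> d <= nm (opshift T z u - y) ^+ 2.
  by move=> Tu; apply: ge_inf; [exact: hE.2|exists u].
have : forall n : nat, exists u, opdom T u /\ nm (opshift T z u - y) ^+ 2 < d + n.+1%:R^-1.
  move=> n; have [|r [u Tu ->] h] := @inf_adherent _ E n.+1%:R^-1 _ hE.
    by rewrite invr_gt0.
  by exists u.
move=> /choice[s hs].
have Ts n : opdom T (s n) by have [] := hs n.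
(* The midpoint of two near-minimisers still has squared residual at least d, so the parallelogram
   law bounds the difference of the residuals by their excess over d. *)
have par m' n : nm (opshift T z (s m') - opshift T z (s n)) ^+ 2 <=
    2 * m'.+1%:R^-1 + 2 * n.+1%:R^-1.
  have [_ h1] := hs m'; have [_ h2] := hs n.
  have := parallelogram ip_norm (opshift T z (s m') - y) (opshift T z (s n) - y).
  have := dE ((2^-1 : R)%:C *: (s m' + s n)) (opdomZ _ (opdomD (Ts _) (Ts _))).
  have -> : (opshift T z (s m') - y) - (opshift T z (s n) - y) =
    opshift T z (s m') - opshift T z (s n).
    by move: (opshift _ _ _) (opshift _ _ _) => p p'; rewrite opprB addrA subrK.
  have -> : (opshift T z (s m') - y) + (opshift T z (s n) - y) =
     (2 : R)%:C *: (opshift T z ((2^-1 : R)%:C *: (s m' + s n)) - y).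
    rewrite opshiftZ; last exact: opdomD.
    rewrite opshiftD// scalerBr scalerA -rmorphM/= mulfV ?pnatr_eq0// scale1r.
    move: (opshift _ _ _) (opshift _ _ _) => p p'.
    by rewrite rmorphD/= scalerDl scale1r addrACA opprD.
  rewrite nmZ nmRe ger0_norm// exprMn.
  move: (nm _ ^+ 2) h1 h2 => t; move: (nm _ ^+ 2) (nm _ ^+ 2) (nm _ ^+ 2) => t1 t2 t3.
  by move: (m'.+1%:R^-1) (n.+1%:R^-1) => i j; lra.
have small (e : R) : 0 < e -> exists N, forall n, (N <= n)%N -> n.+1%:R^-1 <= e.
  move=> e0; exists (Num.truncn e^-1) => n Nn.
  rewrite -[leRHS]invrK lef_pV2 ?posrE ?invr_gt0//.
  by rewrite (le_trans (ltW (truncnS_gt _)))// ler_nat.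
have cau (e : R) : 0 < e -> exists N, forall m' n, (N <= m')%N -> (N <= n)%N ->
     nm (opshift T z (s m') - opshift T z (s n)) <= e.
  move=> e0; have [N hN] := small (e ^+ 2 / 4) (divr_gt0 (exprn_gt0 _ e0) (ltr0Sn _ 3)).
  exists N => m' n /hN h1 /hN h2.
  rewrite -(@ler_pXn2r _ 2)// ?nnegrE ?nm_ge0 ?(ltW e0)//.
  apply: (le_trans (par _ _)).
  by move: (m'.+1%:R^-1) (n.+1%:R^-1) h1 h2 => i j; lra.
have [l sl] : exists l, clim s l.
  apply: clim_cauchy => e e0; have [N hN] := cau (m * e) (mulr_gt0 m0 e0).
  exists N => m' n Nm Nn; rewrite -(ler_pM2l m0).
  by rewrite (le_trans (hz _ (opdomB (Ts _) (Ts _))))// opshiftB// hN.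
have [w sw] := clim_cauchy cau.
have [Tl Tlw] : opdom T l /\ T l = w + z *: l.
  apply: (sa_closed Tsa Ts sl) => e e0.
  have [N hN] := clim_add sw (clim_scale z sl) e0.
  by exists N => n Nn; have := hN n Nn; rewrite /opshift subrK.
have lw : opshift T z l = w by rewrite /opshift Tlw addrK.
exists l => //; apply/eqP; rewrite -subr_eq0; apply/eqP.
set p := _ - y.
have pd : nm p ^+ 2 <= d.
  have p1 : 0 < 2 * nm p + 1 by rewrite ltr_pwDr// mulr_ge0// nm_ge0.
  apply/ler_addgt0Pl => e e0.
  have [N hN] := sw (Num.min 1 (e / (2 * (2 * nm p + 1)))) ltac:(by rewrite lt_min ltr01 divr_gt0// mulr_gt0).
  have [N' hN'] := small (e / 2) (divr_gt0 e0 (ltr0Sn _ 1)).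
  set n := maxn N N'.
  have /= := hN n (leq_maxl _ _); rewrite le_min => /andP[k1 k2].
  have := hN' n (leq_maxr _ _); have [_] := hs n.
  have -> : opshift T z (s n) - y = p + (opshift T z (s n) - w).
    by rewrite /p lw; move: (opshift _ _ _) => q; rewrite [RHS]addrC addrA subrK.
  rewrite (nmD_sqr ip_norm).
  have := rip_le ip_norm p (opshift T z (s n) - w); rewrite ler_norml => /andP[r1 _].
  move: k2; rewrite ler_pdivlMr ?mulr_gt0//.
  move: r1 k1; have := nm_ge0 p; have := nm_ge0 (opshift T z (s n) - w).
  move: (nm (_ - w)) (nm p) (rip _ _) (n.+1%:R^-1) => a b r i.
  nra.
have orth v : opdom T v -> rip p (opshift T z v) = 0.
  move=> Tv; set g := opshift T z v.
  have key (t : R) : 0 <= 2 * t * rip p g + t ^+ 2 * nm g ^+ 2.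
    have := dE (l + t%:C *: v) (opdomD Tl (opdomZ _ Tv)).
    rewrite opshiftD// ?opshiftZ//; last exact: opdomZ.
    rewrite addrAC -/p -/g (nmD_sqr ip_norm) ripZr nmZ nmRe exprMn real_normK ?num_real//.
    by move: pd; lra.
  have [g0|g0] := eqVneq (nm g) 0.
    by rewrite (nm_le0 (x := g)) ?g0// /re_ip (ip0r ip).
  have g2 : 0 < nm g ^+ 2 by rewrite exprn_gt0// lt_neqAle eq_sym g0 nm_ge0.
  (* This t minimises the quadratic in [key], and the minimum is - <p, g>^2 / |g|^2. *)
  have := key (- (rip p g / nm g ^+ 2)).
  rewrite (_ : _ + _ = - (rip p g ^+ 2 / nm g ^+ 2)); last by field.
  rewrite oppr_ge0 pmulr_lle0 ?invr_gt0// => h.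
  by apply/eqP; rewrite -sqrf_eq0 eq_le h sqr_ge0.
have orthc v : opdom T v -> ip (opshift T z v) p = 0.
  move=> Tv; have h1 := orth v Tv.
  (* [orth] controls real parts only; testing with i v as well gives the imaginary part. *)
  have := orth _ (opdomZ 'i%C Tv); rewrite opshiftZ//.
  move: h1; rewrite !(ripC ip p) /re_ip (ipZl ip).
  case: (ip _ p) => a b /= -> /eqP; rewrite mul0r mul1r sub0r oppr_eq0 => /eqP ->.
  by [].
have [Tp Tpe] : opdom T p /\ T p = z^*%C *: p.
  apply: (sa_graph Tsa) => x Tx; have := orthc x Tx.
  by rewrite /opshift (ipBl ip) (ipZl ip) (ipZr ip) conjcK => /eqP; rewrite subr_eq0 => /eqP.
apply: nm_le0; rewrite -(pmulr_rle0 _ m0).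
by rewrite (le_trans (hzc p Tp))// /opshift Tpe subrr nm0.
Qed.

(** Symmetry makes <T u, u> real, so the cross term sees only Re z. *)
Lemma shift_sqr_real T z u : symmetric_op ip T -> opdom T u ->
  nm (opshift T z u) ^+ 2 =
  nm (T u) ^+ 2 - 2 * complex.Re z * rip (T u) u + nm z ^+ 2 * nm u ^+ 2.
Proof.
move=> sym Tu; rewrite /opshift (nmB_sqr ip_norm) nmZ exprMn.
have : complex.Im (ip (T u) u) = 0.
  have := ipC ip (T u) u; rewrite -(sym u u Tu Tu).
  by case: (ip _ _) => a b [] /= h; apply/eqP; move: h; lra.
rewrite /re_ip (ipZr ip); case: (ip _ _) => a b /= ->; case: z => x y /=.
by ring.
Qed.

(* With B = S - c and m the best lower bound of B, a near-minimiser u of |Bu|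
   gives v = B^-1 u with (B - m)(B + m) v small, so B - m or B + m has no
   bounded inverse. *)
Lemma symmetric_dist S (c r : R) : symmetric_op ip S ->
  (forall t : R, `|t - c| < r -> resolvent_set S t%:C) ->
  forall u, opdom S u -> r * nm u <= nm (opshift S c%:C u).
Proof.
move=> sym hr u Su.
have [r0|r0] := leP r 0; first by rewrite (le_trans (mulr_le0_ge0 r0 (nm_ge0 u)))// nm_ge0.
have rc : resolvent_set S c%:C by apply: hr; rewrite subrr normr0.
rewrite leNgt; apply/negP => hu.
have u0 : 0 < nm u.
  rewrite lt_neqAle nm_ge0 andbT eq_sym; apply/eqP => e.
  by move: hu; rewrite e mulr0 ltNge nm_ge0.
pose E := [set m : R | forall v, opdom S v -> m * nm v <= nm (opshift S c%:C v)].
have Eub : ubound E (nm (opshift S c%:C u) / nm u).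
  by move=> m hm; rewrite ler_pdivlMr// hm.
have [m0 m00 Em0] : exists2 m, 0 < m & E m.
  have [_ [M M0 hM]] := (resolvent_setP S c%:C).1 rc.
  exists M^-1; first by rewrite invr_gt0.
  by move=> v Sv; rewrite ler_pdivrMl// hM.
have hE : has_sup E by split; [exists m0|exists (nm (opshift S c%:C u) / nm u)].
set m := sup E.
have mpos : 0 < m by apply: (lt_le_trans m00); exact: ub_le_sup hE.2 _ Em0.
have mr : m < r.
  by apply: (le_lt_trans (ge_sup hE.1 Eub)); rewrite ltr_pdivrMr.
have Em v : opdom S v -> m * nm v <= nm (opshift S c%:C v).
  move=> Sv; have [v0|v0] := eqVneq (nm v) 0; first by rewrite v0 mulr0 nm_ge0.
  have vp : 0 < nm v by rewrite lt_neqAle eq_sym v0 nm_ge0.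
  rewrite -ler_pdivlMr//; apply: (ge_sup hE.1) => m' hm'.
  by rewrite ler_pdivlMr// hm'.
(* As m < r, both c + m and c - m are in the resolvent set; the product k of their lower bounds will
   bound |(B - m)(B + m) w| from below by k |w|. *)
have bd (t : R) : `|t| = m -> exists2 k, 0 < k &
    forall v, opdom S v -> k * nm v <= nm (opshift S (c + t)%:C v).
  move=> tm; have := hr (c + t); rewrite [c + t - c]addrC addKr tm.
  move=> /(_ mr) /resolvent_setP[_ [M M0 hM]].
  exists M^-1; first by rewrite invr_gt0.
  by move=> v Sv; rewrite ler_pdivrMl// hM.
have [k1 k10 hk1] := bd m (gtr0_norm mpos).
have [k2 k20 hk2] := bd (- m) ltac:(by rewrite normrN gtr0_norm).
pose k := k1 * k2; have k0 : 0 < k by rewrite mulr_gt0.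
(* The left side is the upper bound for |(B - m)(B + m) w|^2 / |w|^2 reached at the end if m + e
   fails to be a lower bound of B. *)
have [e e0 he] : exists2 e, 0 < e & (2 * m * e + e ^+ 2) * (m + e) ^+ 2 < k ^+ 2.
  pose D := (2 * m + 1) * (m + 1) ^+ 2.
  have D0 : 0 < D by rewrite mulr_gt0 ?exprn_gt0// ?addr_gt0// mulr_gt0.
  have D2 : 0 < 2 * D by apply: mulr_gt0.
  exists (Num.min 1 (k ^+ 2 / (2 * D))).
    by rewrite lt_min ltr01 divr_gt0// exprn_gt0.
  set e := Num.min _ _.
  have e1 : e <= 1 by rewrite ge_min lexx.
  have e0 : 0 < e by rewrite lt_min ltr01 divr_gt0// exprn_gt0.
  have : e <= k ^+ 2 / (2 * D) by rewrite ge_min lexx orbT.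
  rewrite ler_pdivlMr// => h.
  have h1 : (m + e) ^+ 2 <= (m + 1) ^+ 2.
    by rewrite ler_pXn2r ?lerD2l// ?nnegrE ?addr_ge0 ?ltW.
  have h2 : 2 * m * e + e ^+ 2 <= e * (2 * m + 1) by nra.
  have : (2 * m * e + e ^+ 2) * (m + e) ^+ 2 <= e * D.
    have h3 : 0 <= 2 * m * e + e ^+ 2 by nra.
    by rewrite /D [leRHS]mulrA ler_pM ?sqr_ge0 ?h1 ?h2 ?h3.
  have : 0 < k ^+ 2 by rewrite exprn_gt0.
  by move: h; lra.
have nE : ~ E (m + e).
  by move=> h; have := ub_le_sup hE.2 h; rewrite -/m; lra.
apply: nE => v Sv; rewrite leNgt; apply/negP => hv.
have [Sw wE] := resolventP v rc; set w := resolvent S c%:C v in Sw wE.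
have v0 : 0 < nm v.
  rewrite lt_neqAle nm_ge0 andbT eq_sym; apply/eqP => e'.
  by move: hv; rewrite e' mulr0 ltNge nm_ge0.
set Bv := opshift S c%:C v in hv.
have BvwE : rip Bv w = nm v ^+ 2.
  suff -> : rip Bv w = rip v (opshift S c%:C w) by rewrite wE (ripxx ip_norm).
  by rewrite /Bv /re_ip /opshift (ipBl ip) (ipZl ip) (ipBr ip) (ipZr ip) conjc_real (sym _ _ Sv Sw).
(* Since B w = v, the vector (B - m)(B + m) w is B v - m^2 w, and <B v, w> = <v, B w> = |v|^2 by
   symmetry. *)
have BvE : nm (opshift S (c + m)%:C (opshift S (c - m)%:C w)) ^+ 2 =
   nm Bv ^+ 2 - 2 * m ^+ 2 * nm v ^+ 2 + m ^+ 4 * nm w ^+ 2.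
  have -> : opshift S (c - m)%:C w = v + m%:C *: w.
    rewrite -wE /opshift rmorphB/= scalerBl opprB.
    by rewrite [_ *: w - _]addrC addrA.
  have -> : opshift S (c + m)%:C (v + m%:C *: w) = Bv - (m ^+ 2)%:C *: w.
    rewrite opshiftD//; last exact: opdomZ.
    rewrite opshiftZ//.
    have sh x : opshift S (c + m)%:C x = opshift S c%:C x - m%:C *: x.
      by rewrite /opshift rmorphD/= scalerDl opprD addrA.
    by rewrite !sh wE scalerBr scalerA -rmorphM/= -expr2 addrA subrK.
  rewrite (nmB_sqr ip_norm) ripZr nmZ nmRe ger0_norm ?sqr_ge0//.
  rewrite BvwE.
  by ring.
have Sx : opdom S (opshift S (c - m)%:C w).
  have -> : opshift S (c - m)%:C w = v + m%:C *: w.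
    rewrite -wE /opshift rmorphB/= scalerBl opprB.
    by rewrite [_ *: w - _]addrC addrA.
  by apply: opdomD => //; exact: opdomZ.
have lo : k * nm w <= nm (opshift S (c + m)%:C (opshift S (c - m)%:C w)).
  rewrite (le_trans _ (hk1 _ Sx))// /k -mulrA ler_pM2l//.
  exact: hk2.
have wm : m * nm w <= nm v by rewrite -wE Em.
have wv : nm v ^+ 2 <= nm Bv * nm w.
  rewrite -BvwE.
  exact: le_trans (ler_norm _) (rip_le ip_norm _ _).
have wv' : nm v <= (m + e) * nm w.
  rewrite -(ler_pM2l v0) -expr2 (le_trans wv)// mulrA ler_wpM2r ?nm_ge0//.
  by rewrite mulrC ltW// mulrC.
have w0 : 0 < nm w.
  by rewrite -(pmulr_rgt0 _ (addr_gt0 mpos e0)) (lt_le_trans v0).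
(* |B v| <= (m + e) |v| and m |w| <= |v| collapse the three terms to ((m + e)^2 - m^2) |v|^2. *)
have h1 : (k * nm w) ^+ 2 <= (2 * m * e + e ^+ 2) * nm v ^+ 2.
  apply: (@le_trans _ _ (nm Bv ^+ 2 - 2 * m ^+ 2 * nm v ^+ 2 + m ^+ 4 * nm w ^+ 2)).
    by rewrite -BvE ler_pXn2r// nnegrE ?nm_ge0// mulr_ge0 ?nm_ge0 ?ltW.
  have b2 : nm Bv ^+ 2 <= (m + e) ^+ 2 * nm v ^+ 2.
    rewrite -exprMn ler_pXn2r// ?nnegrE ?nm_ge0 ?mulr_ge0 ?nm_ge0 ?addr_ge0 ?ltW//.
  have w2 : m ^+ 2 * nm w ^+ 2 <= nm v ^+ 2.
    by rewrite -exprMn ler_pXn2r// ?nnegrE ?nm_ge0 ?mulr_ge0 ?nm_ge0 ?ltW.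
  have : m ^+ 2 * (m ^+ 2 * nm w ^+ 2) <= m ^+ 2 * nm v ^+ 2.
    by rewrite ler_wpM2l ?sqr_ge0.
  rewrite (_ : m ^+ 4 = m ^+ 2 * m ^+ 2); last by ring.
  by move: b2; rewrite !sqrrD; lra.
have h2 : (2 * m * e + e ^+ 2) * nm v ^+ 2 <=
    (2 * m * e + e ^+ 2) * (m + e) ^+ 2 * nm w ^+ 2.
  rewrite -[leRHS]mulrA ler_wpM2l//; last first.
    by rewrite -exprMn ler_pXn2r// ?nnegrE ?nm_ge0 ?mulr_ge0 ?nm_ge0 ?addr_ge0 ?ltW.
  by rewrite addr_ge0 ?sqr_ge0// !mulr_ge0// ltW.
have := le_trans h1 h2; rewrite exprMn ler_pM2r ?exprn_gt0//.
by rewrite leNgt he.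
Qed.

End SelfAdjoint.

(** * Relatively bounded perturbations *)

Section RelativeBound.
Variables (R : realType) (H : completeNormedModType R[i]).
Variable ip : {dot H for (@Num.conj R[i])}.
Hypothesis ip_norm : forall x : H, ip x x = `|x| ^+ 2.
Implicit Types (S T A : linop H) (x y u v w l : H) (z : R[i]).
Local Notation rip := (re_ip ip).

(* Away from the gap ]al, be[ the parabola |t - z|^2 - a^2 - b^2 t^2 - k(1 + t^2)
   is nonnegative, so its roots lie in the gap and completing the square reduces
   the claim to symmetric_dist. *)
Lemma gap_bound T z (a b k al be : R) : self_adjoint ip T -> b ^+ 2 + k < 1 ->
  (forall t : R, al < t -> t < be -> resolvent_set T t%:C) ->
  (forall t : R, t <= al \/ be <= t ->
    a ^+ 2 + b ^+ 2 * t ^+ 2 + k * (1 + t ^+ 2) <=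
      (t - complex.Re z) ^+ 2 + complex.Im z ^+ 2) ->
  forall u, opdom T u ->
  a ^+ 2 * nm u ^+ 2 + b ^+ 2 * nm (T u) ^+ 2 + k * (nm u ^+ 2 + nm (T u) ^+ 2)
    <= nm (opshift T z u) ^+ 2.
Proof.
move=> Tsa bk gap cond u Tu.
rewrite (shift_sqr_real ip_norm _ (sa_sym Tsa) Tu) nm_sqr.
move: cond; move: (complex.Re z) (complex.Im z) => x y cond.
pose p := 1 - b ^+ 2 - k.
have p0 : 0 < p by rewrite /p; lra.
(* The parabola is p ((t - c)^2 - s); when s > 0 its roots are c - sqrt s and c + sqrt s, and [lo]
   and [hi] place them in [al, be]. *)
pose c := x / p.
pose s := c ^+ 2 - (x ^+ 2 + y ^+ 2 - a ^+ 2 - k) / p.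
have cp : p * c = x by rewrite /c; field; rewrite gt_eqF.
have sp : p * s = p * c ^+ 2 - (x ^+ 2 + y ^+ 2 - a ^+ 2 - k).
  by rewrite /s; field; rewrite gt_eqF.
have nonneg (t : R) : t <= al \/ be <= t -> s <= (t - c) ^+ 2.
  move=> /cond h; rewrite -(ler_pM2l p0) sp.
  have -> : p * (t - c) ^+ 2 = p * t ^+ 2 - 2 * (p * c) * t + p * c ^+ 2 by ring.
  rewrite cp; move: h; rewrite /p; lra.
suff h : s * nm u ^+ 2 <= nm (opshift T c%:C u) ^+ 2.
  move: h; rewrite (shift_sqr_real ip_norm _ (sa_sym Tsa) Tu) nm_sqr/= expr0n/= addr0.
  rewrite -(ler_pM2l p0) mulrA sp.
  rewrite [X in _ <= X](_ : _ = p * nm (T u) ^+ 2 - 2 * (p * c) * rip (T u) u +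
     p * c ^+ 2 * nm u ^+ 2); last by ring.
  rewrite cp /p; lra.
have [s0|s0] := leP s 0.
  by rewrite (le_trans _ (sqr_ge0 _))// mulr_le0_ge0// sqr_ge0.
have r0 : 0 < Num.sqrt s by rewrite sqrtr_gt0.
have r2 : Num.sqrt s ^+ 2 = s by rewrite sqr_sqrtr// ltW.
set r := Num.sqrt s in r0 r2.
have lo : al <= c - r.
  rewrite leNgt; apply/negP => h.
  have [cal|alc] := leP c al; first by have := nonneg c (or_introl cal); nra.
  by have := nonneg al (or_introl (lexx _)); rewrite -r2; nra.
have hi : c + r <= be.
  rewrite leNgt; apply/negP => h.
  have [bec|cbe] := leP be c; first by have := nonneg c (or_intror bec); nra.
  by have := nonneg be (or_intror (lexx _)); rewrite -r2; nra.
have : r * nm u <= nm (opshift T c%:C u).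
  apply: (symmetric_dist ip_norm (sa_sym Tsa)) => // t.
  by rewrite ltr_norml => /andP[t1 t2]; apply: gap; lra.
by rewrite -r2 -exprMn ler_pXn2r// nnegrE ?nm_ge0// mulr_ge0 ?nm_ge0// ltW.
Qed.

Lemma rel_boundedE T A (a b : R) : rel_bounded_by T A a b <->
  forall x, opdom T x ->
    nm (A x) ^+ 2 <= a ^+ 2 * nm x ^+ 2 + b ^+ 2 * nm (T x) ^+ 2.
Proof.
by split=> h x /h; rewrite !nmE -!rmorphXn/= -!rmorphM/= -rmorphD/= lecR.
Qed.

(** S is kept abstract, with only a bound on S - T, because in the essential case the pair is S0 and
    the modified T, whose difference is A only off the moved eigenvectors. *)
Lemma gap_resolvent T z (a b k al be : R) : self_adjoint ip T ->
  0 < k -> b ^+ 2 + k < 1 ->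
  (forall t : R, al < t -> t < be -> resolvent_set T t%:C) ->
  (forall t : R, t <= al \/ be <= t ->
    a ^+ 2 + b ^+ 2 * t ^+ 2 + k * (1 + t ^+ 2) <=
      (t - complex.Re z) ^+ 2 + complex.Im z ^+ 2) ->
  forall S, (forall x, opdom S x <-> opdom T x) ->
  (forall x, opdom T x ->
    nm (S x - T x) ^+ 2 <= a ^+ 2 * nm x ^+ 2 + b ^+ 2 * nm (T x) ^+ 2) ->
  resolvent_set S z.
Proof.
move=> Tsa k0 bk gap cond S dS hS.
have gb := gap_bound Tsa bk gap cond.
(* The condition on z involves Im z only through its square, so it also holds at the conjugate, as
   [sa_resolvent] demands. *)
have gbc : forall u, opdom T u ->
  a ^+ 2 * nm u ^+ 2 + b ^+ 2 * nm (T u) ^+ 2 + k * (nm u ^+ 2 + nm (T u) ^+ 2)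
    <= nm (opshift T z^*%C u) ^+ 2.
  apply: (gap_bound Tsa bk gap) => t ht.
  by have := cond t ht; case: (z) => x y /=; rewrite sqrrN.
have low z' : (forall u, opdom T u ->
  a ^+ 2 * nm u ^+ 2 + b ^+ 2 * nm (T u) ^+ 2 + k * (nm u ^+ 2 + nm (T u) ^+ 2)
    <= nm (opshift T z' u) ^+ 2) ->
  forall u, opdom T u -> Num.sqrt k * nm u <= nm (opshift T z' u).
  move=> h u Tu.
  rewrite -(@ler_pXn2r _ 2)// ?nnegrE ?nm_ge0 ?mulr_ge0 ?nm_ge0 ?sqrtr_ge0//.
  rewrite exprMn sqr_sqrtr ?(ltW k0)//; apply: le_trans (h u Tu).
  rewrite mulrDr; have := mulr_ge0 (sqr_ge0 a) (sqr_ge0 (nm u)).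
  have := mulr_ge0 (sqr_ge0 b) (sqr_ge0 (nm (T u))).
  by have := mulr_ge0 (ltW k0) (sqr_ge0 (nm (T u))); lra.
have k0' : 0 < Num.sqrt k by rewrite sqrtr_gt0.
have zT : resolvent_set T z by apply: (sa_resolvent ip_norm Tsa k0'); exact: low.
(* Since |(T - z) u|^2 <= C (|u|^2 + |T u|^2), the margin k is worth k / C of |(T - z) u|^2; hence
   q^2 = 1 - k / C. *)
pose C := 2 + 2 * nm z ^+ 2.
have C0 : 0 < C by rewrite /C ltr_pwDl// mulr_ge0// sqr_ge0.
apply: (@resolvent_perturb _ _ T S z z (Num.sqrt (1 - k / C))) => //.
  rewrite -[ltRHS]sqrtr1 ltr_sqrt// gtrBl divr_gt0//.
move=> u Tu.
have -> : opshift S z u - opshift T z u = S u - T u.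
  by rewrite /opshift opprB addrA subrK.
have zu : nm (opshift T z u) ^+ 2 <= C * (nm u ^+ 2 + nm (T u) ^+ 2).
  have : nm (opshift T z u) <= nm (T u) + nm z * nm u by rewrite -nmZ nmB.
  move: (nm_ge0 (opshift T z u)) (nm_ge0 (T u)) (nm_ge0 z) (nm_ge0 u).
  rewrite /C; move: (nm (opshift T z u)) (nm (T u)) (nm z) (nm u) => p q r s p0 q0 r0 s0 h.
  have h1 : p ^+ 2 <= (q + r * s) ^+ 2 by rewrite ler_pXn2r ?nnegrE ?addr_ge0 ?mulr_ge0.
  have h2 := sqr_ge0 (q - r * s).
  have h3 := mulr_ge0 (sqr_ge0 r) (sqr_ge0 q).
  move: h1 h2 h3; rewrite sqrrD sqrrB exprMn; nra.
rewrite -(@ler_pXn2r _ 2)// ?nnegrE ?nm_ge0 ?mulr_ge0 ?nm_ge0 ?sqrtr_ge0//.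
rewrite exprMn.
have kC : k / C * nm (opshift T z u) ^+ 2 <= k * (nm u ^+ 2 + nm (T u) ^+ 2).
  by rewrite -mulrA ler_pM2l// ler_pdivrMl.
have := gb u Tu; have := hS u Tu.
have : 0 <= 1 - k / C.
  rewrite subr_ge0 ler_pdivrMr// mul1r /C.
  by have := sqr_ge0 b; have := sqr_ge0 (nm z); lra.
move=> /sqr_sqrtr ->.
by move: kC; rewrite mulrBl mul1r; lra.
Qed.

End RelativeBound.

(** * Symmetric Fredholm operators *)

Section Fredholm.
Variables (R : realType) (H : completeNormedModType R[i]).
Variable ip : {dot H for (@Num.conj R[i])}.
Hypothesis ip_norm : forall x : H, ip x x = `|x| ^+ 2.
Implicit Types (S T A : linop H) (x y u v w : H) (z : R[i]).

(* Gliding hump in the form given by Sokal: of x + h and x - h, one has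
   |<v, .>| at least |<v, h>|. *)
Lemma uniform_bounded (V : set H) :
  (forall y, exists C : R, forall v, V v -> nm (ip v y) <= C) ->
  exists C : R, forall v, V v -> nm v <= C.
Proof.
move=> pw; apply: contrapT => nb.
have : forall n : nat, exists v, V v /\ n%:R * 3 ^+ n < nm v.
  move=> n; apply: contrapT => h; apply: nb; exists (n%:R * 3 ^+ n) => v Vv.
  by rewrite leNgt; apply/negP => h'; apply: h; exists v.
move=> /choice[f hf].
have f0 n : 0 < nm (f n).
  by have [_] := hf n; apply: le_lt_trans; rewrite mulr_ge0// exprn_ge0.
pose h n : H := ((3^-1 : R) ^+ n / nm (f n))%:C *: f n.
have hn n : nm (h n) = 3^-1 ^+ n.
  rewrite nmZ nmRe ger0_norm ?divr_ge0 ?exprn_ge0 ?nm_ge0//.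
  by rewrite divfK// gt_eqF.
have hip n : nm (ip (f n) (h n)) = 3^-1 ^+ n * nm (f n).
  rewrite (ipZr ip) conjc_real (ipxx ip_norm) -rmorphM/= nmRe ger0_norm.
    by rewrite expr2 mulrA divfK// gt_eqF.
  by rewrite mulr_ge0 ?sqr_ge0// divr_ge0 ?exprn_ge0 ?nm_ge0.
pose step n x := if 3^-1 ^+ n * nm (f n) <= nm (ip (f n) (x + h n)) then x + h n
  else x - h n.
pose X := fix X n := if n is m.+1 then step m (X m) else 0.
have Xstep n : nm (X n.+1 - X n) <= 1 * 3^-1 ^+ n.
  rewrite mul1r -hn /= /step; case: ifP => _; rewrite addrC addKr// nmN//.
have Xip n : 3^-1 ^+ n * nm (f n) <= nm (ip (f n) (X n.+1)).
  rewrite /= /step; case: ifPn => //; rewrite -ltNge => lt.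
  have := nmB (ip (f n) (X n + h n)) (ip (f n) (X n - h n)).
  rewrite -(ipBr ip) opprB addrC addrA subrK -mulr2n -scaler_nat (ipZr ip) nmM nm_conj.
  have -> : nm (2%:R : R[i]) = 2 by rewrite -[2%:R](rmorph_nat (real_complex R)) nmRe ger0_norm.
  by rewrite hip; move: lt; lra.
have [l Xl hl] := @geometric_clim _ _ X 1 3^-1 ltac:(lra) ltac:(lra) Xstep.
have [C hC] := pw l.
have Cn n : n%:R <= 2 * C.
  have [Vf fn] := hf n.
  have h1 := hC _ Vf; have h2 := Xip n.
  (* The tail after X (n + 1) has length at most 3^-n / 2, so at least half of the 3^-n |f n|
     secured at step n survives in the limit. *)
  have h3 : nm (ip (f n) (X n.+1)) <= nm (ip (f n) l) + nm (f n) * (3^-1 ^+ n * 2^-1).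
    rewrite addrC (le_trans (nm_le_sub _ (ip (f n) l)))// lerD2r -(ipBr ip).
    rewrite (le_trans (ip_le ip_norm _ _))// ler_pM2l// (le_trans (hl _))//.
    rewrite ler_pdivrMr ?exprS; last lra.
    have : 0 <= (3^-1 : R) ^+ n by rewrite exprn_ge0.
    by move: (_ ^+ n) => q; lra.
  have h4 : n%:R <= 3^-1 ^+ n * nm (f n).
    by rewrite exprVn ler_pdivlMl ?exprn_gt0// mulrC ltW.
  rewrite mulrA [nm (f n) * _]mulrC in h3.
  by move: h1 h2 h3 h4; move: (3^-1 ^+ n * nm (f n)) => q; lra.
have := Cn (Num.truncn (2 * C)).+1; rewrite leNgt => /negP; apply; exact: truncnS_gt.
Qed.

(** A quantitative form of semi-Fredholmness: a lower bound for S - z modulo finitely many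
    functionals. The same list l serves for all nearby z. *)
Definition bounded_mod S (l : seq H) (C : R) z :=
  forall v, opdom S v ->
    nm v <= C * (nm (opshift S z v) + \sum_(e <- l) nm (ip v e)).

Lemma sum_nm_ge0 (l : seq H) v : 0 <= \sum_(e <- l) nm (ip v e).
Proof. by apply: sumr_ge0 => *; exact: nm_ge0. Qed.

(** Each y is (S - c) x plus a combination of the e i, so by symmetry <v, y> is controlled by (S -
    c) v and the <v, e i>. On the set where these add up to at most 1 the vectors are weakly
    bounded, hence bounded. *)
Lemma fin_codim_bounded_mod S (c : R) : symmetric_op ip S ->
  fin_codim (opran S c%:C) ->
  exists (l : seq H) (C : R), 0 < C /\ bounded_mod S l C c%:C.
Proof.
move=> sym [n [e he]].
pose l := [seq e i | i <- enum 'I_n].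
pose p v := nm (opshift S c%:C v) + \sum_(e <- l) nm (ip v e).
have p0 v : 0 <= p v by rewrite addr_ge0 ?nm_ge0 ?sum_nm_ge0.
have [C hC] : exists C : R, forall v, [set v | opdom S v /\ p v <= 1] v -> nm v <= C.
  apply: uniform_bounded => y.
  have [_ [x Sx <-] [d hd]] := he y.
  exists (nm x + \sum_(i < n) nm (d i)) => v [Sv pv].
  have -> : ip v y = ip (opshift S c%:C v) x + \sum_i (d i)^*%C * ip v (e i).
    have -> : ip (opshift S c%:C v) x = ip v (opshift S c%:C x).
      by rewrite /opshift (ipBl ip) (ipZl ip) (ipBr ip) (ipZr ip) conjc_real (sym _ _ Sv Sx).
    rewrite -{1}(subrK (opshift S c%:C x) y) hd addrC (ipDr ip) (ip_sumr ip).
    by congr (_ + _); apply: eq_bigr => i _; rewrite (ipZr ip).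
  have le1 : nm (opshift S c%:C v) <= 1.
    by rewrite (le_trans _ pv)// lerDl sum_nm_ge0.
  have le2 i : nm (ip v (e i)) <= 1.
    rewrite (le_trans _ pv)// /p big_map big_enum/= (bigD1 i)//= addrCA lerDl.
    by rewrite addr_ge0 ?nm_ge0// sumr_ge0// => *; exact: nm_ge0.
  rewrite (le_trans (nmD _ _))// lerD//.
    by rewrite (le_trans (ip_le ip_norm _ _))// ler_piMl ?nm_ge0.
  rewrite (le_trans (nm_sum _ _ _))// ler_sum// => i _.
  by rewrite nmM nm_conj ler_piMr ?nm_ge0.
exists l, (`|C| + 1); split=> [|v Sv]; first by rewrite ltr_pwDr.
rewrite -/(p v); apply/ler_addgt0Pl => eps eps0.
(* The eps term keeps the normalising factor positive even when p v = 0. *)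
pose t := p v + eps / (`|C| + 1).
have C1 : 0 < `|C| + 1 by rewrite ltr_pwDr.
have t0 : 0 < t by rewrite ltr_pwDr// divr_gt0.
have pZ : p (t^-1%:C *: v) = t^-1 * p v.
  rewrite /p opshiftZ// nmZ nmRe gtr0_norm ?invr_gt0// mulrDr; congr (_ + _).
  rewrite big_distrr/=; apply: eq_bigr => i _.
  by rewrite (ipZl ip) nmM nmRe gtr0_norm ?invr_gt0.
have := hC (t^-1%:C *: v) (conj (opdomZ _ Sv) _).
rewrite pZ nmZ nmRe gtr0_norm ?invr_gt0// ler_pdivrMl// mulr1 => /(_ _).
rewrite lerDl divr_ge0 ?(ltW eps0) ?(ltW C1)// => /(_ isT).
rewrite ler_pdivrMl// => /le_trans; apply.
have -> : eps + (`|C| + 1) * p v = t * (`|C| + 1).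
  by rewrite /t; field; rewrite gt_eqF.
by rewrite ler_pM2l// (le_trans (ler_norm C))// lerDl.
Qed.

(** Compactness as an induction on subintervals: the supremum of the reachable points is reachable
    and cannot lie below b. It yields uniform constants on a segment and, with an implication for Q,
    continuation along one. *)
Lemma cousin (Q : R -> R -> Prop) (a b : R) : a <= b ->
  (forall x : R, a <= x <= b -> exists2 e, 0 < e &
     forall c d, x - e < c -> c <= d -> d < x + e -> a <= c -> d <= b -> Q c d) ->
  (forall c d e : R, c <= d -> d <= e -> Q c d -> Q d e -> Q c e) ->
  Q a b.
Proof.
move=> ab loc tr.
pose E := [set x : R | a <= x <= b /\ Q a x].
have Ea : E a.
  split; first by rewrite lexx.
  have [|e e0] := loc a; first by rewrite lexx.
  by apply=> //; lra.
have hE : has_sup E by split; [exists a|exists b => x [/andP[]]].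
set s := sup E.
have sa : a <= s by exact: ub_le_sup hE.2 _ Ea.
have sb : s <= b by apply: (ge_sup hE.1) => x [/andP[]].
have [|e e0 he] := loc s; first by rewrite sa.
have [x [/andP[ax xb] Qx] xs] := sup_adherent e0 hE.
have xs' : x <= s by apply: (ub_le_sup hE.2); rewrite /E/= ax xb.
pose d := Num.min b (s + e / 2).
have xd : x <= d by rewrite le_min xb/=; lra.
have db : d <= b by rewrite ge_min lexx.
have dse : d < s + e by rewrite gt_min; apply/orP; right; lra.
have Qd : Q a d by apply: (tr _ x) => //; apply: he.
have : d <= s by apply: (ub_le_sup hE.2); split=> //; rewrite db (le_trans ax).
rewrite ge_min => /orP[bs|]; last by move=> h; exfalso; lra.
have -> : b = d; last exact: Qd.
apply/le_anti; rewrite db andbT le_min lexx/=.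
by rewrite (le_trans bs)// lerDl; lra.
Qed.

(** Near a point the same functionals serve with C doubled; adjacent intervals are joined by
    concatenating the lists and adding the constants. *)
Lemma bounded_mod_segment S (c d : R) : c <= d ->
  (forall t, c <= t <= d -> exists (l : seq H) (C : R), 0 < C /\ bounded_mod S l C t%:C) ->
  exists (l : seq H) (C : R), 0 < C /\
    forall t, c <= t <= d -> bounded_mod S l C t%:C.
Proof.
move=> cd loc.
apply: (cousin (Q := fun c d => exists (l : seq H) (C : R), 0 < C /\
    forall t, c <= t <= d -> bounded_mod S l C t%:C) cd).
- move=> x /loc[l [C [C0 hl]]].
  exists (2 * C)^-1; first by rewrite invr_gt0 mulr_gt0.
  move=> p q xp pq qx _ _; exists l, (2 * C); split; first by rewrite mulr_gt0.
  move=> t /andP[pt tq] v Sv; have := hl v Sv.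
  have : nm (opshift S x%:C v) <= nm (opshift S t%:C v) + (2 * C)^-1 * nm v.
    have -> : opshift S x%:C v = opshift S t%:C v + (t - x)%:C *: v.
      by rewrite /opshift rmorphB/= scalerBl addrA subrK.
    rewrite (le_trans (nmD _ _))// lerD2l nmZ nmRe ler_wpM2r ?nm_ge0//.
    by rewrite ler_norml; lra.
  move: (nm _) (nm (opshift S t%:C v)) (nm v) (\sum_(_ <- _) _) => A B D E h1 h2.
  have h3 : C * A <= C * B + 2^-1 * D.
    rewrite (le_trans (ler_wpM2l (ltW C0) h1))// mulrDr lerD2l.
    by rewrite mulrA invfM mulrCA mulfV ?gt_eqF// mulr1.
  by move: h2; rewrite !mulrDr; lra.
- move=> p q r pq qr [l1 [C1 [C10 h1]]] [l2 [C2 [C20 h2]]].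
  exists (l1 ++ l2), (C1 + C2); split; first by rewrite addr_gt0.
  move=> t /andP[pt tr] v Sv; rewrite big_cat/=.
  have s1 := sum_nm_ge0 l1 v; have s2 := sum_nm_ge0 l2 v.
  have s3 := nm_ge0 (opshift S t%:C v).
  have [tq|qt] := leP t q.
    have := h1 t; rewrite pt tq => /(_ isT v Sv) /le_trans; apply.
    by rewrite ler_pM ?addr_ge0 ?(ltW C10)//; lra.
  have := h2 t; rewrite (ltW qt) tr => /(_ isT v Sv) /le_trans; apply.
  by rewrite ler_pM ?addr_ge0 ?(ltW C20)//; lra.
Qed.

(* Codimension one is removed at a time: the image of the smaller domain is
   closed, so the image of one more vector stays at positive distance. *)
Lemma bounded_mod_injective (l : seq H) S z (C : R) : 0 < C -> closed_op S ->
  (forall v, opdom S v -> opshift S z v = 0 -> v = 0) ->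
  bounded_mod S l C z ->
  exists2 C', 0 < C' & forall v, opdom S v -> nm v <= C' * nm (opshift S z v).
Proof.
elim: l S C => [|e l ih] S C C0 clS inj hS.
  by exists C => // v Sv; have := hS v Sv; rewrite big_nil addr0.
(* On the kernel of <., e> the functional e drops out of the list; the restriction stays closed, so
   the induction applies to it. *)
pose D0 := [set v | opdom S v /\ ip v e = 0].
have D00 : D0 0 by split; [exact: opdom0|rewrite (ip0l ip)].
have D0P c x y : D0 x -> D0 y -> D0 (c *: x + y).
  move=> [Sx xe] [Sy ye]; split; first exact: opdomP.
  by rewrite (ipDl ip) (ipZl ip) xe ye mulr0 addr0.
have D0f c x y : D0 x -> D0 y -> S (c *: x + y) = c *: S x + S y.
  by move=> [Sx _] [Sy _]; exact: opfunP.
pose S0 : linop H := LinOp D00 D0P D0f.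
have clS0 : closed_op S0.
  move=> s p w hs sp sw.
  have [Sp Spw] := clS s p w (fun n => (hs n).1) sp sw.
  split=> //; split=> //; apply: nm_le0; apply/ler_addgt0Pl => d d0; rewrite addr0.
  have e1 : 0 < nm e + 1 by rewrite ltr_pwDr// nm_ge0.
  have [N hN] := sp (d / (nm e + 1)) (divr_gt0 d0 e1).
  have -> : ip p e = - ip (s N - p) e by rewrite (ipBl ip) (hs N).2 sub0r opprK.
  rewrite nmN (le_trans (ip_le ip_norm _ _))//.
  apply: (le_trans (ler_wpM2r (nm_ge0 e) (hN N (leqnn N)))).
  by rewrite mulrAC ler_pdivrMr// ler_wpM2l// ?lerDl// ltW.
have [C1 C10 h1] : exists2 C', 0 < C' &
    forall v, D0 v -> nm v <= C' * nm (opshift S z v).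
  apply: (ih S0 C C0 clS0) => [v [Sv _]|v [Sv ve]]; first exact: inj.
  by have := hS v Sv; rewrite big_cons ve nm0 add0r.
have [[w0 [Sw0 w0e]]|no] := pselect (exists w, opdom S w /\ ip w e != 0); last first.
  exists C1 => // v Sv; apply: h1; split=> //; apply/eqP; apply: contrapT => /negP h.
  by apply: no; exists v.
pose w := (ip w0 e)^-1 *: w0.
have Sw : opdom S w by exact: opdomZ.
have we : ip w e = 1 by rewrite (ipZl ip) mulVf.
(* At distance zero, vectors s n of D0 would have images tending to that of w. The bound on D0 makes
   s n converge, closedness puts the limit in D0, and injectivity identifies it with w, although <w,
   e> = 1. *)
have [dl dl0 hdl] : exists2 dl : R, 0 < dl &
    forall v, D0 v -> dl <= nm (opshift S z w - opshift S z v).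
  apply: contrapT => no.
  have : forall n : nat, exists v, D0 v /\
      nm (opshift S z v - opshift S z w) <= 1 * 2^-1 ^+ n.
    move=> n; apply: contrapT => h; apply: no; exists (2^-1 ^+ n) => [|v Dv].
      by rewrite exprn_gt0.
    rewrite leNgt; apply/negP => h'; apply: h; exists v; split=> //.
    by rewrite nm_sym mul1r ltW.
  move=> /choice[s hs].
  have lim_shift : clim (fun n => opshift S z (s n)) (opshift S z w).
    move=> eps eps0; have [N hN] := @expr_small R 2^-1 eps ltac:(lra) ltac:(lra) eps0.
    by exists N => n /hN; apply: le_trans; have := (hs n).2; rewrite mul1r.
  have [p sp] : exists p, clim s p.
    apply: clim_cauchy => eps eps0.
    have [N hN] := lim_shift (eps / (2 * C1)) (divr_gt0 eps0 (mulr_gt0 (ltr0Sn _ 1) C10)).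
    exists N => m n Nm Nn.
    have [[Sm me] _] := hs m; have [[Sn ne] _] := hs n.
    have Dmn : D0 (s m - s n).
      by split; [exact: opdomB|rewrite (ipBl ip) me ne subrr].
    rewrite (le_trans (h1 _ Dmn))// opshiftB// -ler_pdivlMl//.
    rewrite (le_trans (nm_tri (opshift S z w) _ _))//.
    rewrite [X in _ + X]nm_sym (le_trans (lerD (hN m Nm) (hN n Nn)))//.
    rewrite le_eqVlt; apply/orP; left; apply/eqP; field.
    by rewrite gt_eqF.
  have [[Sp pe] Spw] : D0 p /\ S p = opshift S z w + z *: p.
    apply: (clS0 s) => // [n|eps eps0]; first exact: (hs n).1.
    have [N hN] := clim_add lim_shift (clim_scale z sp) eps0.
    by exists N => n Nn; have := hN n Nn; rewrite {1}/opshift subrK.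
  have : w - p = 0.
    apply: inj; first exact: opdomB.
    by rewrite opshiftB// [opshift S z p]/opshift Spw addrK subrr.
  move=> /eqP; rewrite subr_eq0 => /eqP wp.
  by move: we; rewrite wp pe => /eqP; rewrite eq_sym oner_eq0.
pose B := C1 + (C1 * nm (opshift S z w) + nm w) / dl.
have B0 : 0 < B.
  by rewrite ltr_pwDl// divr_ge0 ?(ltW dl0)// addr_ge0 ?mulr_ge0 ?nm_ge0// ltW.
exists B => // v Sv.
pose t := ip v e; pose v0 := v - t *: w.
have D0v : D0 v0.
  split; first by apply: opdomB => //; exact: opdomZ.
  by rewrite (ipBl ip) (ipZl ip) we mulr1 subrr.
have vE : v = v0 + t *: w by rewrite subrK.
have shv : opshift S z v = opshift S z v0 + t *: opshift S z w.
  by rewrite {1}vE opshiftD ?opshiftZ//; [exact: D0v.1|exact: opdomZ].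
(* The distance bound is applied to - v0 / t, whose image differs from that of w by the image of v /
   t. *)
have tb : nm t * dl <= nm (opshift S z v).
  have [t0|t0] := eqVneq t 0; first by rewrite t0 nm0 mul0r nm_ge0.
  have Dv' : D0 (- t^-1 *: v0).
    by rewrite -[_ *: _]addr0; apply: (D0P _ v0 0).
  have := hdl _ Dv'; rewrite -(ler_pM2l (x := nm t)) ?nm_gt0// => /le_trans; apply.
  rewrite -nmZ shv [opshift S z (_ *: v0)]opshiftZ; last exact: D0v.1.
  by rewrite scalerBr scalerA mulrN mulfV// scaleN1r opprK addrC.
rewrite {1}vE (le_trans (nmD _ _))// nmZ.
have h2 := h1 _ D0v.
have h3 : nm (opshift S z v0) <= nm (opshift S z v) + nm t * nm (opshift S z w).
  rewrite -nmZ (_ : opshift S z v0 = opshift S z v - t *: opshift S z w) ?nmB//.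
  by rewrite shv addrK.
have h4 : nm t <= nm (opshift S z v) / dl by rewrite ler_pdivlMr.
rewrite (le_trans (lerD (le_trans h2 (ler_wpM2l (ltW C10) h3)) (lexx _)))//.
rewrite /B mulrDl mulrDr -addrA lerD2l mulrCA -mulrDr [leRHS]mulrAC -mulrA mulrC.
by rewrite ler_wpM2l// addr_ge0 ?mulr_ge0 ?nm_ge0// ltW.
Qed.

End Fredholm.

(** * Removing the eigenvalues in an essential gap *)

Section Modification.
Variables (R : realType) (H : completeNormedModType R[i]).
Variable ip : {dot H for (@Num.conj R[i])}.
Hypothesis ip_norm : forall x : H, ip x x = `|x| ^+ 2.
Implicit Types (S T A : linop H) (x y u v w : H) (z : R[i]).

(** Families are functions on [nat] read below n, so that one can be lengthened without a change of
    type. *)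
Definition orthonormal_fam (n : nat) (f : nat -> H) :=
  forall i j, (i < n)%N -> (j < n)%N -> ip (f i) (f j) = (i == j)%:R.

Definition proj (n : nat) (f : nat -> H) v := \sum_(i < n) ip v (f i) *: f i.

Section Projection.
Variables (n : nat) (f : nat -> H).
Hypothesis fo : orthonormal_fam n f.

Lemma ip_sum_fam (c : nat -> R[i]) j : (j < n)%N ->
  ip (\sum_(i < n) c i *: f i) (f j) = c j.
Proof.
move=> jn; rewrite (ip_suml ip) (bigD1 (Ordinal jn))//= (ipZl ip) fo// eqxx mulr1.
rewrite big1 ?addr0// => i ij; rewrite (ipZl ip) fo//.
by rewrite (_ : (nat_of_ord i == j) = false) ?mulr0//; apply/negP => /eqP e;
   move/negP: ij; apply; apply/eqP/val_inj.
Qed.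

Lemma nm_fam i : (i < n)%N -> nm (f i) = 1.
Proof.
move=> lt; have := ipxx ip_norm (f i); rewrite fo// eqxx => -[/esym/eqP].
by rewrite sqrf_eq1 => /orP[/eqP//|/eqP h]; have := nm_ge0 (f i); rewrite h; lra.
Qed.

Lemma ip_proj v j : (j < n)%N -> ip (proj n f v) (f j) = ip v (f j).
Proof. exact: (ip_sum_fam (fun i => ip v (f i))). Qed.

Lemma ip_sub_proj v j : (j < n)%N -> ip (v - proj n f v) (f j) = 0.
Proof. by move=> jn; rewrite (ipBl ip) ip_proj// subrr. Qed.

Lemma nm_proj_sqr v : nm (proj n f v) ^+ 2 = \sum_(i < n) nm (ip v (f i)) ^+ 2.
Proof.
apply: complexI; rewrite -(ipxx ip_norm) rmorph_sum/=.
transitivity (\sum_(i < n) ip (proj n f v) (ip v (f i) *: f i)).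
  by rewrite -(ip_sumr ip).
apply: eq_bigr => i _; rewrite (ipZr ip) ip_proj// mulrC -sqr_normc.
by rewrite nmE rmorphXn.
Qed.

Lemma pythagoras_proj v :
  nm v ^+ 2 = nm (v - proj n f v) ^+ 2 + nm (proj n f v) ^+ 2.
Proof.
rewrite -{1}(subrK (proj n f v) v) (nmD_sqr ip_norm (v - proj n f v)).
rewrite (_ : re_ip _ _ _ = 0) ?mulr0 ?addr0// /re_ip.
suff -> : ip (v - proj n f v) (proj n f v) = 0 by [].
rewrite (_ : ip _ _ = \sum_(i < n) ip (v - proj n f v) (ip v (f i) *: f i)).
  by rewrite big1// => i _; rewrite (ipZr ip) ip_sub_proj// mulr0.
by rewrite -(ip_sumr ip).
Qed.

Lemma nm_sub_proj v : nm (v - proj n f v) ^+ 2 <= nm v ^+ 2.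
Proof. by rewrite (pythagoras_proj v) lerDl sqr_ge0. Qed.

Lemma bessel v : \sum_(i < n) nm (ip v (f i)) ^+ 2 <= nm v ^+ 2.
Proof. by rewrite -nm_proj_sqr (pythagoras_proj v) lerDr sqr_ge0. Qed.

End Projection.

Definition eigen_fam T (c d : R) (n : nat) (f : nat -> H) (lam : nat -> R) :=
  orthonormal_fam n f /\ forall i, (i < n)%N ->
    [/\ opdom T (f i), T (f i) = (lam i)%:C *: f i & c <= lam i <= d].

(* Every eigenvector of the family has a component of fixed size along the
   finitely many functionals, while Bessel bounds the total of these. *)
Lemma eigen_fam_bounded T (c d C : R) (l : seq H) : 0 < C ->
  (forall t, c <= t <= d -> bounded_mod ip T l C t%:C) ->
  exists N : nat, forall n f lam, eigen_fam T c d n f lam -> (n <= N)%N.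
Proof.
move=> C0 hl.
pose k : R := (size l)%:R; pose M := k * C ^+ 2 + 1.
have M0 : 0 < M by rewrite ltr_pwDr// mulr_ge0// sqr_ge0.
pose B := 2 * M * \sum_(e <- l) nm e ^+ 2.
exists (Num.truncn B).+1 => n f lam [fo hf].
suff : n%:R <= B.
  move=> h; rewrite -(ler_nat R); apply: (le_trans h); exact/ltW/truncnS_gt.
have one (j : 'I_n) : 1 <= 2 * M * \sum_(e <- l) nm (ip e (f j)) ^+ 2.
  have [Tf Tfe lamj] := hf j (ltn_ord j).
  have := hl _ lamj (f j) Tf; rewrite /opshift Tfe subrr nm0 add0r.
  rewrite (nm_fam fo)//.
  (* Young's inequality; M = k C^2 + 1, with k the number of functionals, keeps the sum of the k
     constant terms below 1/2. *)
  have e2 e : C * nm (ip (f j) e) <= M * nm (ip e (f j)) ^+ 2 + C ^+ 2 / (4 * M).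
    rewrite (ipC ip) nm_conj; move: (nm _) => x.
    rewrite -subr_ge0 (_ : _ - _ = (2 * M * x - C) ^+ 2 / (4 * M)).
      by rewrite divr_ge0 ?sqr_ge0// mulr_ge0// ltW.
    by field; rewrite gt_eqF.
  rewrite big_distrr/= => h.
  have := le_trans h (ler_sum _ (fun e _ => e2 e)).
  rewrite big_split/= -big_distrr/= big_const_seq count_predT iter_addr_0.
  rewrite -mulr_natr -/k.
  suff : C ^+ 2 / (4 * M) * k <= 2^-1 by lra.
  rewrite mulrAC ler_pdivrMr ?mulr_gt0// /M; have := sqr_ge0 C.
  have k0 : 0 <= k by []. move: (C ^+ 2) => q q0.
  have := mulr_ge0 k0 q0; lra.
have : \sum_(j < n) 1 <= \sum_(j < n) (2 * M * \sum_(e <- l) nm (ip e (f j)) ^+ 2).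
  by apply: ler_sum => j _; exact: one.
rewrite sumr_const card_ord => /le_trans; apply.
rewrite -big_distrr/= exchange_big/= ler_pM2l ?mulr_gt0//.
by apply: ler_sum => e _; exact: bessel.
Qed.

(** If no family were maximal, each could be extended by a normalised eigenvector orthogonal to it,
    past the bound N. *)
Lemma eigen_fam_maximal T (c d C : R) (l : seq H) : 0 < C ->
  (forall t, c <= t <= d -> bounded_mod ip T l C t%:C) ->
  exists n f lam, eigen_fam T c d n f lam /\
    forall u t, opdom T u -> c <= t <= d -> T u = t%:C *: u ->
      (forall i, (i < n)%N -> ip u (f i) = 0) -> u = 0.
Proof.
move=> C0 hl; apply: contrapT => no.
have [N hN] := eigen_fam_bounded C0 hl.
suff /(_ N.+1)[f [lam /hN]] : forall n, exists f lam, eigen_fam T c d n f lam.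
  by rewrite ltnn.
elim=> [|n [f [lam fam]]]; first by exists (fun=> 0), (fun=> 0); split.
have [u [t [Tu td Tut uf u0]]] : exists u t, [/\ opdom T u, c <= t <= d,
    T u = t%:C *: u, forall i, (i < n)%N -> ip u (f i) = 0 & u != 0].
  apply: contrapT => h; apply: no; exists n, f, lam; split=> // u t Tu td Tut uf.
  by apply/eqP; apply: contrapT => /negP u0; apply: h; exists u, t.
have [fo hf] := fam.
have nu : nm u != 0 by rewrite nm_eq0.
pose e := (nm u)^-1%:C *: u.
have ee : ip e e = 1.
  rewrite (ipZl ip) (ipZr ip) conjc_real (ipxx ip_norm) -!rmorphM/=.
  by rewrite (_ : _ * _ = 1 :> R)//; field.
have ef i : (i < n)%N -> ip e (f i) = 0.
  by move=> lt; rewrite (ipZl ip) uf// mulr0.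
exists (fun i => if (i < n)%N then f i else e), (fun i => if (i < n)%N then lam i else t).
split.
  move=> i j; rewrite !ltnS => i1 j1; case: ifPn => hi; case: ifPn => hj.
  - exact: fo.
  - have -> : j = n by apply/eqP; rewrite eqn_leq j1 leqNgt.
    by rewrite (ipC ip) ef// conjc0 ltn_eqF.
  - have -> : i = n by apply/eqP; rewrite eqn_leq i1 leqNgt.
    by rewrite ef// gtn_eqF.
  - have -> : j = n by apply/eqP; rewrite eqn_leq j1 leqNgt.
    have -> : i = n by apply/eqP; rewrite eqn_leq i1 leqNgt.
    by rewrite ee eqxx.
move=> i _; case: ifPn => hi; first exact: hf.
split=> //; first exact: opdomZ.
by rewrite opfunZ// Tut !scalerA mulrC.
Qed.

Section FiniteRank.
Variables (n : nat) (f g : nat -> H).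

Definition finite_rank v := \sum_(i < n) ip v (f i) *: g i.

Lemma finite_rankP (c : R[i]) x y :
  finite_rank (c *: x + y) = c *: finite_rank x + finite_rank y.
Proof.
rewrite scaler_sumr -big_split/=; apply: eq_bigr => i _.
by rewrite (ipDl ip) (ipZl ip) scalerDl scalerA.
Qed.

Variable S : linop H.

Lemma add_finite_rankP (c : R[i]) x y : opdom S x -> opdom S y ->
  S (c *: x + y) + finite_rank (c *: x + y) =
  c *: (S x + finite_rank x) + (S y + finite_rank y).
Proof. by move=> Sx Sy; rewrite opfunP// finite_rankP scalerDr addrACA. Qed.

Definition add_finite_rank : linop H :=
  LinOp (opdom0 S) (@opdomP _ _ S) add_finite_rankP.

End FiniteRank.

Lemma finite_rank_orth n f g v : (forall i, (i < n)%N -> ip v (f i) = 0) ->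
  finite_rank n f g v = 0.
Proof. by move=> h; rewrite /finite_rank big1// => i _; rewrite h// scale0r. Qed.

Lemma finite_rank_sym n f (c : nat -> R) x y :
  ip (finite_rank n f (fun i => (c i)%:C *: f i) x) y =
  ip x (finite_rank n f (fun i => (c i)%:C *: f i) y).
Proof.
rewrite (ip_suml ip) (ip_sumr ip); apply: eq_bigr => i _.
rewrite !((ipZl ip), (ipZr ip)) conjc_real (ipC ip (f i) y).
by ring.
Qed.

Lemma self_adjoint_add_finite_rank T n f (c : nat -> R) : self_adjoint ip T ->
  self_adjoint ip (add_finite_rank n f (fun i => (c i)%:C *: f i) T).
Proof.
move=> Tsa; split; first exact: Tsa.1.
set K := finite_rank n f (fun i => (c i)%:C *: f i).
apply/seteqP; split=> -[y w] /=.
  move=> [/= Ty <-] x Tx /=; rewrite (ipDl ip) (ipDr ip) finite_rank_sym.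
  by rewrite (sa_sym Tsa Tx Ty).
move=> h; have [Ty Tye] : opdom T y /\ T y = w - K y.
  apply: (sa_graph Tsa) => x Tx; have := h x Tx => /=.
  rewrite (ipDl ip) finite_rank_sym -/K (ipBr ip) => <-.
  by rewrite addrK.
by split=> //=; rewrite Tye -/K subrK.
Qed.

(* T' moves the eigenvalues of T in [c, d] to c; A' ignores their eigenvectors,
   so T' + A' differs from T + A by a finite-rank operator. *)
Lemma essential_gap_reduction T A (a b c d : R) : self_adjoint ip T ->
  opdom T `<=` opdom A ->
  (forall x, opdom T x ->
    nm (A x) ^+ 2 <= a ^+ 2 * nm x ^+ 2 + b ^+ 2 * nm (T x) ^+ 2) ->
  c <= d ->
  (forall t : R, c <= t <= d -> fredholm T t%:C) ->
  exists n f g (S0 : linop H), [/\ opdom S0 = opdom T,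
    forall x, opdom T x -> T x + A x = S0 x + finite_rank n f g x &
    forall z (k : R), 0 < k -> b ^+ 2 + k < 1 ->
      (forall t : R, t <= c \/ d <= t ->
        a ^+ 2 + b ^+ 2 * t ^+ 2 + k * (1 + t ^+ 2) <=
          (t - complex.Re z) ^+ 2 + complex.Im z ^+ 2) ->
      resolvent_set S0 z].
Proof.
move=> Tsa TA TAab cd fred.
have [l [C [C0 hl]]] := bounded_mod_segment cd (fun t ht =>
  fin_codim_bounded_mod ip_norm (sa_sym Tsa) (fred t ht).2).
have [n [f [lam [[fo hf] fmax]]]] := eigen_fam_maximal C0 hl.
pose K := finite_rank n f (fun i => (c - lam i)%:C *: f i).
pose T' := add_finite_rank n f (fun i => (c - lam i)%:C *: f i) T.
have T'sa : self_adjoint ip T' by exact: self_adjoint_add_finite_rank.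
have T'E x : T' x = T x + K x by [].
have T'f j : (j < n)%N -> T' (f j) = c%:C *: f j.
  move=> jn; have [Tf Tfe _] := hf j jn; rewrite T'E Tfe /K /finite_rank.
  rewrite (bigD1 (Ordinal jn))//= fo// eqxx scale1r big1 ?addr0.
    by rewrite -scalerDl -rmorphD/= addrC subrK.
  move=> i ij; rewrite fo// (_ : (j == nat_of_ord i) = false) ?scale0r//.
  by apply/negP => /eqP e; move/negP: ij; apply; apply/eqP/val_inj.
have ipT' x j : opdom T x -> (j < n)%N -> ip (T' x) (f j) = c%:C * ip x (f j).
  move=> Tx jn; have [Tf _ _] := hf j jn.
  by rewrite (sa_sym T'sa (x := x) (y := f j) Tx Tf) T'f// (ipZr ip) conjc_real.
have T'gap (t : R) : c < t -> t < d -> resolvent_set T' t%:C.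
  move=> ct td; have ctd : c <= t <= d by rewrite !ltW.
  (* With the f i among the functionals, the correction K v is absorbed, since |c - lam i| <= d -
     c. *)
  have bm : bounded_mod ip T' (l ++ [seq f (nat_of_ord i) | i <- enum 'I_n]) (C * (1 + (d - c))) t%:C.
    move=> v Tv; have := hl t ctd v Tv.
    have : nm (opshift T t%:C v) <= nm (opshift T' t%:C v) +
        (d - c) * \sum_(i < n) nm (ip v (f i)).
      have -> : opshift T t%:C v = opshift T' t%:C v - K v.
        by rewrite /opshift T'E [RHS]addrAC addrK.
      rewrite (le_trans (nmB _ _))// lerD2l (le_trans (nm_sum _ _ _))// big_distrr/=.
      apply: ler_sum => i _; have [_ _ li] := hf i (ltn_ord i).
      rewrite !nmZ nmRe (nm_fam fo)// mulr1 mulrC ler_wpM2r ?nm_ge0//.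
      by rewrite ler_norml; lra.
    rewrite big_cat/= big_map big_enum/=.
    have := sum_nm_ge0 ip l v; have : 0 <= \sum_(i < n) nm (ip v (f i)).
      by apply: sumr_ge0 => *; exact: nm_ge0.
    move: (nm_ge0 (opshift T' t%:C v)).
    move: (nm (opshift T _ v)) (nm (opshift T' _ v)) (\sum_(e <- l) _) (\sum_(i < n) _) => p q r s q0 s0 r0 pq.
    move=> /le_trans; apply; rewrite -mulrA ler_pM2l//.
    have dc : 0 <= d - c by lra.
    by have := mulr_ge0 dc q0; have := mulr_ge0 dc r0; nra.
  (* An eigenvector of T' for t > c is orthogonal to the f i, on which T' is c; there T' agrees with
     T, and maximality of the family applies. *)
  have inj v : opdom T' v -> opshift T' t%:C v = 0 -> v = 0.
    move=> Tv /eqP; rewrite subr_eq0 => /eqP e.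
    have vf i : (i < n)%N -> ip v (f i) = 0.
      move=> lt; have := ipT' v i Tv lt; rewrite e (ipZl ip) => /eqP.
      rewrite -subr_eq0 -mulrBl mulf_eq0 -rmorphB/= => /orP[/eqP[h]|/eqP//].
      by exfalso; lra.
    apply: (fmax v t) => //; rewrite -e T'E /K finite_rank_orth ?addr0//.
  have [|C' C'0 hC'] := bounded_mod_injective ip_norm _ (sa_closed ip_norm T'sa) inj bm.
    by rewrite mulr_gt0//; lra.
  apply: (sa_resolvent ip_norm T'sa (m := C'^-1)).
  - by rewrite invr_gt0.
  - by move=> u Tu; rewrite ler_pdivrMl// hC'.
  - by move=> u Tu; rewrite conjc_real ler_pdivrMl// hC'.
(* This choice makes T + A minus the finite-rank part equal to T' + A (1 - P), with P the projection
   onto the f i. *)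
pose g i := A (f i) - (c - lam i)%:C *: f i.
pose TA' := opD T A.
pose S1 := add_finite_rank n f (fun i => - g i) TA'.
have domE : opdom S1 = opdom T.
  by apply/seteqP; split=> [x []//|x Tx]; split=> //; exact: TA.
have Af i : (i < n)%N -> opdom A (f i) by move=> /hf[/TA].
exists n, f, g, S1; split=> // [x Tx|z k k0 bk cond].
  rewrite /= -addrA -[LHS]addr0; congr (_ + _).
  rewrite /finite_rank -big_split/= big1// => i _.
  by rewrite scalerN addNr.
apply: (gap_resolvent ip_norm T'sa k0 bk T'gap cond); first by rewrite domE.
move=> x Tx.
have Tf (i : 'I_n) : opdom T (f i) by have [] := hf i (ltn_ord i).
have Tproj : opdom T (proj n f x) by apply: opdom_sum => i; exact: opdomZ.
have Aproj : A (proj n f x) = \sum_(i < n) ip x (f i) *: A (f i).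
  rewrite opfun_sum => [|i]; last by apply: opdomZ; exact: Af.
  by apply: eq_bigr => i _; rewrite opfunZ//; exact: Af.
have S1E : S1 x - T' x = A (x - proj n f x).
  have -> : S1 x = T x + A x + (K x - A (proj n f x)).
    rewrite /= Aproj /K /finite_rank -sumrB; congr (_ + _).
    by apply: eq_bigr => i _; rewrite /g opprB scalerBr.
  rewrite T'E opfunB; [|exact: TA|exact: TA].
  by rewrite [X in X - _]addrACA [X in X - _]addrC addrK.
have Tsub : opdom T (x - proj n f x) by exact: opdomB.
have orth i : (i < n)%N -> ip (x - proj n f x) (f i) = 0.
  by move=> lt; rewrite ip_sub_proj.
(* T and T' agree on the complement of the f i, and T' commutes with P. As 1 - P is a contraction, A
   (1 - P) is bounded relative to T' with the constants a and b of A. *)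
have TsubE : T (x - proj n f x) = T' x - proj n f (T' x).
  have -> : T (x - proj n f x) = T' (x - proj n f x).
    by rewrite T'E /K finite_rank_orth ?addr0.
  rewrite opfunB//; congr (_ - _).
  rewrite /proj opfun_sum => [|i]; last by apply: opdomZ; exact: Tf.
  apply: eq_bigr => i _; rewrite opfunZ; last exact: Tf.
  by rewrite T'f// ipT'// scalerA mulrC.
rewrite S1E (le_trans (TAab _ Tsub))// TsubE lerD// ler_wpM2l ?sqr_ge0//.
  exact: nm_sub_proj.
exact: nm_sub_proj.
Qed.

End Modification.

(** * Taylor expansions at a point *)

Section Taylor.
Variables (R : realType) (z0 : R[i]).
Implicit Types (f g : R[i] -> R[i]) (c d : nat -> R[i]) (r rho K : R) (z : R[i]).

(* The F n are the iterated difference quotients of f at z0, so that c is the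
   sequence of Taylor coefficients of f; no convergence of series is involved. *)
Definition taylor r rho f c := exists (F : nat -> R[i] -> R[i]) K,
  [/\ forall z, nm (z - z0) <= r -> F 0%N z = f z,
      forall n z, nm (z - z0) <= r -> F n z = F n z0 + (z - z0) * F n.+1 z,
      forall n z, nm (z - z0) <= r -> nm (F n z) <= K * rho ^+ n &
      forall n, F n z0 = c n].

Lemma taylor_sub r r' rho rho' f c : 0 <= r' -> r' <= r -> 1 <= rho -> rho <= rho' ->
  taylor r rho f c -> taylor r' rho' f c.
Proof.
move=> r0 rr rho1 rhorho [F [K [h1 h2 h3 h4]]]; exists F, K; split=> //.
- by move=> z zr; apply: h1; exact: le_trans rr.
- by move=> n z zr; apply: h2; exact: le_trans rr.
move=> n z zr; have zr' := le_trans zr rr.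
have K0 : 0 <= K by have := le_trans (nm_ge0 _) (h3 0%N z zr'); rewrite expr0 mulr1.
rewrite (le_trans (h3 n z zr'))// ler_wpM2l// lerXn2r// nnegrE; lra.
Qed.

Lemma taylor_ext r rho f g c : (forall z, nm (z - z0) <= r -> f z = g z) ->
  taylor r rho f c -> taylor r rho g c.
Proof.
move=> e [F [K [h1 h2 h3 h4]]]; exists F, K; split=> // z zr.
by rewrite h1// e.
Qed.

Lemma taylor_cst r rho (a : R[i]) : 1 <= rho ->
  taylor r rho (fun=> a) (fun n => if n is 0 then a else 0).
Proof.
move=> rho1; exists (fun n _ => if n is 0 then a else 0), (nm a); split=> //.
  by case=> [|n] z _; rewrite mulr0 addr0.
move=> [|n] z _; first by rewrite expr0 mulr1.
by rewrite nm0 mulr_ge0 ?nm_ge0// exprn_ge0//; lra.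
Qed.

Lemma taylor_add r rho f g c d : taylor r rho f c -> taylor r rho g d ->
  taylor r rho (fun z => f z + g z) (fun n => c n + d n).
Proof.
move=> [F [K [h1 h2 h3 h4]]] [G [L [k1 k2 k3 k4]]].
exists (fun n z => F n z + G n z), (K + L); split.
- by move=> z zr; rewrite h1// k1.
- by move=> n z zr; rewrite h2// k2// mulrDr addrACA.
- by move=> n z zr; rewrite mulrDl (le_trans (nmD _ _))// lerD ?h3 ?k3.
- by move=> n; rewrite h4 k4.
Qed.

Lemma taylor_sum r rho n (f : 'I_n -> R[i] -> R[i]) (c : 'I_n -> nat -> R[i]) :
  1 <= rho -> (forall i, taylor r rho (f i) (c i)) ->
  taylor r rho (fun z => \sum_i f i z) (fun k => \sum_i c i k).
Proof.
move=> rho1; elim: n f c => [|n ih] f c h.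
  rewrite (_ : (fun k => _) = (fun n : nat => if n is 0 then 0 else 0)).
    by apply: (taylor_ext _ (taylor_cst r 0 rho1)) => z _; rewrite big_ord0.
  by apply/funext => -[|k]; rewrite big_ord0.
rewrite (_ : (fun k => _) = (fun k => \sum_(i < n) c (widen_ord (leqnSn n) i) k + c ord_max k)).
  apply: (taylor_ext _ (taylor_add (ih _ _ (fun i => h _)) (h ord_max))) => z _.
  by rewrite big_ord_recr.
by apply/funext => k; rewrite big_ord_recr.
Qed.

(** The n-th difference quotient of the product is F n * G 0 plus the sum of c i * G (n - i) over i
    < n. Doubling rho pays for the n + 1 terms, as n + 1 <= 2^n. *)
Lemma taylor_mul r rho f g c d : 0 <= r -> 1 <= rho ->
  taylor r rho f c -> taylor r rho g d ->
  taylor r (2 * rho) (fun z => f z * g z) (fun n => \sum_(i < n.+1) c i * d (n - i)%N).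
Proof.
move=> r0 rho1 [F [K [h1 h2 h3 h4]]] [G [L [k1 k2 k3 k4]]].
have z00 : nm (z0 - z0) <= r by rewrite subrr nm0.
exists (fun n z => F n z * G 0%N z + \sum_(i < n) c i * G (n - i)%N z), (K * L).
have K0 : 0 <= K by have := le_trans (nm_ge0 _) (h3 0%N z0 z00); rewrite expr0 mulr1.
have L0 : 0 <= L by have := le_trans (nm_ge0 _) (k3 0%N z0 z00); rewrite expr0 mulr1.
have rho0 : 0 <= rho by lra.
split.
- by move=> z zr; rewrite big_ord0 addr0 h1// k1.
- move=> n z zr; rewrite big_ord_recr/= subSnn.
  rewrite {1}h2// mulrDl {1}(k2 0%N)//.
  have -> : \sum_(i < n) c i * G (n - i)%N z =
    \sum_(i < n) c i * G (n - i)%N z0 + (z - z0) * \sum_(i < n) c i * G (n.+1 - i)%N z.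
    rewrite big_distrr/= -big_split/=; apply: eq_bigr => i _.
    by rewrite k2// subSn ?(ltnW (ltn_ord i))//; ring.
  by rewrite h4; ring.
- move=> n z zr.
  have bF i j : nm (F i z) * nm (G j z) <= K * L * rho ^+ (i + j).
    by rewrite exprD mulrACA ler_pM ?nm_ge0 ?h3 ?k3.
  have bc i j : nm (c i) * nm (G j z) <= K * L * rho ^+ (i + j).
    by rewrite exprD mulrACA ler_pM ?nm_ge0 ?k3// -h4 h3.
  apply: (le_trans (nmD _ _)); rewrite nmM.
  apply: (@le_trans _ _ (K * L * rho ^+ n + \sum_(i < n) K * L * rho ^+ n)).
    rewrite lerD//; first by have := bF n 0%N; rewrite addn0.
    rewrite (le_trans (nm_sum _ _ _))//; apply: ler_sum => i _; rewrite nmM.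
    by have := bc i (n - i)%N; rewrite subnKC// ltnW.
  rewrite sumr_const card_ord -mulrS exprMn mulrCA [leRHS]mulrC -[leLHS]mulr_natr.
  rewrite ler_wpM2l ?mulr_ge0 ?exprn_ge0//.
  by rewrite -natrX ler_nat ltn_expl.
- move=> n; rewrite big_ord_recr/= subnn h4 -k4; rewrite addrC; congr (_ + _).
  by apply: eq_bigr => i _; rewrite k4.
Qed.

Lemma taylor_mulX r rho f c : 0 <= r -> 1 <= rho -> taylor r rho f c ->
  taylor r rho (fun z => (z - z0) * f z) (fun n => if n is m.+1 then c m else 0).
Proof.
move=> r0 rho1 [F [K [h1 h2 h3 h4]]].
have z00 : nm (z0 - z0) <= r by rewrite subrr nm0.
have K0 : 0 <= K by have := le_trans (nm_ge0 _) (h3 0%N z0 z00); rewrite expr0 mulr1.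
exists (fun n z => if n is m.+1 then F m z else (z - z0) * f z), (K * (1 + r)).
split=> //.
- case=> [|n] z zr; last exact: h2.
  by rewrite subrr mul0r add0r h1.
- case=> [|n] z zr.
    rewrite nmM -h1// expr0 mulr1 mulrC ler_pM ?nm_ge0//; last lra.
    by have := h3 0%N z zr; rewrite expr0 mulr1.
  apply: (le_trans (h3 n z zr)).
  rewrite exprS mulrA ler_wpM2r ?exprn_ge0//; first lra.
  by rewrite -mulrA ler_peMr//; nra.
- by case=> [|n]; rewrite ?subrr ?mul0r.
Qed.

Lemma taylor_mulXn r rho f c m : 0 <= r -> 1 <= rho -> taylor r rho f c ->
  taylor r rho (fun z => (z - z0) ^+ m * f z)
    (fun n => if (m <= n)%N then c (n - m)%N else 0).
Proof.
move=> r0 rho1 tf; elim: m => [|m ih].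
  rewrite (_ : (fun n => _) = c); last by apply/funext => n; rewrite subn0.
  by apply: taylor_ext tf => z _; rewrite mul1r.
rewrite (_ : (fun n => _) =
  (fun n => if n is k.+1 then (if (m <= k)%N then c (k - m)%N else 0) else 0)).
  by apply: (taylor_ext _ (taylor_mulX r0 rho1 ih)) => z _; rewrite mulrA exprS.
by apply/funext => -[|k].
Qed.

Lemma taylor_scale r rho f c (a : R[i]) : taylor r rho f c ->
  taylor r rho (fun z => a * f z) (fun n => a * c n).
Proof.
move=> [F [K [h1 h2 h3 h4]]].
exists (fun n z => a * F n z), (nm a * K); split.
- by move=> z zr; rewrite h1.
- by move=> n z zr; rewrite h2// mulrDr mulrCA.
- by move=> n z zr; rewrite nmM -mulrA ler_wpM2l ?nm_ge0// h3.
- by move=> n; rewrite h4.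
Qed.

(** The growth rate is existential because products and quotients enlarge it, while the radius stays
    fixed. *)
Definition analytic r f := exists rho c, 1 <= rho /\ taylor r rho f c.

Lemma analytic_sub r r' f : 0 <= r' -> r' <= r -> analytic r f -> analytic r' f.
Proof.
move=> r0 rr [rho [c [rho1 h]]]; exists rho, c; split=> //.
exact: taylor_sub h.
Qed.

Lemma analytic_cst r (a : R[i]) : analytic r (fun=> a).
Proof. by exists 1, (fun n => if n is 0 then a else 0); split=> //; exact: taylor_cst. Qed.

Lemma analytic_ext r f g : (forall z, nm (z - z0) <= r -> f z = g z) ->
  analytic r f -> analytic r g.
Proof.
by move=> e [rho [c [rho1 h]]]; exists rho, c; split=> //; exact: taylor_ext h.
Qed.

Lemma analytic_common r f g : 0 <= r -> analytic r f -> analytic r g ->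
  exists rho c d, [/\ 1 <= rho, taylor r rho f c & taylor r rho g d].
Proof.
move=> r0 [rho [c [rho1 h]]] [rho' [d [rho1' h']]].
exists (Num.max rho rho'), c, d; split.
- by rewrite le_max rho1.
- by apply: taylor_sub h => //; rewrite le_max lexx.
- by apply: taylor_sub h' => //; rewrite le_max lexx orbT.
Qed.

Lemma analytic_add r f g : 0 <= r -> analytic r f -> analytic r g ->
  analytic r (fun z => f z + g z).
Proof.
move=> r0 af ag; have [rho [c [d [rho1 tf tg]]]] := analytic_common r0 af ag.
by exists rho, (fun n => c n + d n); split=> //; exact: taylor_add.
Qed.

Lemma analytic_mul r f g : 0 <= r -> analytic r f -> analytic r g ->
  analytic r (fun z => f z * g z).
Proof.
move=> r0 af ag; have [rho [c [d [rho1 tf tg]]]] := analytic_common r0 af ag.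
exists (2 * rho), (fun n => \sum_(i < n.+1) c i * d (n - i)%N); split; first lra.
exact: taylor_mul.
Qed.

Lemma analytic_bigsum r (I : Type) (s : seq I) (F : I -> R[i] -> R[i]) : 0 <= r ->
  (forall i, analytic r (F i)) -> analytic r (fun z => \sum_(i <- s) F i z).
Proof.
move=> r0 h; elim: s => [|i s ih].
  by apply: (analytic_ext _ (analytic_cst r 0)) => z _; rewrite big_nil.
by apply: (analytic_ext _ (analytic_add r0 (h i) ih)) => z _; rewrite big_cons.
Qed.

Lemma analytic_bigprod r (I : Type) (s : seq I) (F : I -> R[i] -> R[i]) : 0 <= r ->
  (forall i, analytic r (F i)) -> analytic r (fun z => \prod_(i <- s) F i z).
Proof.
move=> r0 h; elim: s => [|i s ih].
  by apply: (analytic_ext _ (analytic_cst r 1)) => z _; rewrite big_nil.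
by apply: (analytic_ext _ (analytic_mul r0 (h i) ih)) => z _; rewrite big_cons.
Qed.

Lemma analytic_det r n (M : R[i] -> 'M[R[i]]_n) : 0 <= r ->
  (forall i j, analytic r (fun z => M z i j)) -> analytic r (fun z => \det (M z)).
Proof.
move=> r0 h; rewrite /determinant.
apply: analytic_bigsum => // s; apply: analytic_mul => //; first exact: analytic_cst.
exact: analytic_bigprod.
Qed.

Lemma analytic_adj r n (M : R[i] -> 'M[R[i]]_n) : 0 <= r ->
  (forall i j, analytic r (fun z => M z i j)) ->
  forall i j, analytic r (fun z => \adj (M z) i j).
Proof.
move=> r0 h i j.
apply: (@analytic_ext _ (fun z => (-1) ^+ (j + i) * \det (row' j (col' i (M z))))).
  by move=> z _; rewrite mxE.
apply: analytic_mul => //; first exact: analytic_cst.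
apply: analytic_det => // k l.
by apply: (analytic_ext _ (h (lift j k) (lift i l))) => z _; rewrite !mxE.
Qed.

(* u / f = c + (z - z0) (u_1 - c f_1) / f with c = u(z0) / f(z0): only the
   numerators change from one difference quotient to the next. *)
Lemma analytic_div r u f (dl : R) : 0 <= r -> 0 < dl ->
  (forall z, nm (z - z0) <= r -> dl <= nm (f z)) ->
  analytic r u -> analytic r f -> analytic r (fun z => u z / f z).
Proof.
move=> r0 dl0 fdl au af.
have [rho [c [d [rho1 [U [K [h1 h2 h3 h4]]] [F [L [k1 k2 k3 k4]]]]]]] :=
  analytic_common r0 au af.
have z00 : nm (z0 - z0) <= r by rewrite subrr nm0.
have K0 : 0 <= K by have := le_trans (nm_ge0 _) (h3 0%N z0 z00); rewrite expr0 mulr1.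
have L0 : 0 <= L by have := le_trans (nm_ge0 _) (k3 0%N z0 z00); rewrite expr0 mulr1.
have rho0 : 0 <= rho by lra.
have f0 z : nm (z - z0) <= r -> f z != 0.
  by move=> /fdl h; rewrite -nm_gt0 (lt_le_trans dl0).
(* V N 0 is the numerator after N quotients and V N k its k-th difference quotient, so nothing is
   ever divided by z - z0; each step enlarges the bound by the factor q. *)
pose V := fix V N : nat -> R[i] -> R[i] := if N is N'.+1 then
  (fun k z => V N' k.+1 z - V N' 0%N z0 / f z0 * F k.+1 z) else U.
have VS N k z : V N.+1 k z = V N k.+1 z - V N 0%N z0 / f z0 * F k.+1 z by [].
pose q := rho * (1 + L / nm (f z0)).
have Lf : 0 <= L / nm (f z0) by rewrite divr_ge0 ?nm_ge0.
have q1 : 1 <= q by rewrite /q; nra.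
have V2 N k z : nm (z - z0) <= r -> V N k z = V N k z0 + (z - z0) * V N k.+1 z.
  move=> zr; elim: N k => [|N ih] k; first exact: h2.
  by rewrite !VS ih (k2 k.+1 z zr); ring.
have V3 N k z : nm (z - z0) <= r -> nm (V N k z) <= K * q ^+ N * rho ^+ k.
  elim: N k z => [|N ih] k z zr; first by rewrite expr0 mulr1 h3.
  rewrite VS (le_trans (nmB _ _))// !nmM nmV.
  apply: (@le_trans _ _ (K * q ^+ N * rho ^+ k.+1 +
     K * q ^+ N / nm (f z0) * (L * rho ^+ k.+1))).
    rewrite lerD ?ih// ler_pM ?nm_ge0 ?k3 ?divr_ge0 ?nm_ge0//.
    rewrite ler_wpM2r ?invr_ge0 ?nm_ge0//.
    by have := ih 0%N z0 z00; rewrite expr0 mulr1.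
  rewrite [q ^+ N.+1]exprSr /q !exprS le_eqVlt; apply/orP; left; apply/eqP.
  by ring.
exists q, (fun n => V n 0%N z0 / f z0); split=> //.
exists (fun n z => V n 0%N z / f z), (K / dl); split=> //.
- by move=> z zr; rewrite -h1.
- move=> n z zr; rewrite VS (V2 n 0%N z zr).
  have := k2 0%N z zr; rewrite !k1// => e.
  apply: (mulIf (f0 z zr)); rewrite divfK ?f0// [RHS]mulrDl -[X in _ = _ + X]mulrA divfK ?f0//.
  by rewrite e; field; exact: f0.
- move=> n z zr; rewrite nmM nmV.
  have := V3 n 0%N z zr; rewrite expr0 mulr1 => h.
  rewrite mulrAC ler_pM ?nm_ge0 ?invr_ge0 ?nm_ge0//.
  by rewrite lef_pV2 ?posrE ?fdl// (lt_le_trans dl0)// fdl.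
Qed.

(** If all coefficients vanish, f = (z - z0)^N F N for every N, and the bound K rho^N forces f = 0
    for |z - z0| <= 1 / (2 rho). Otherwise the first nonzero coefficient c m gives h = F m, which
    stays within |c m| / 2 of c m near z0. *)
Lemma analytic_zeros r f : 0 < r -> analytic r f ->
  (exists2 r', 0 < r' & forall z, nm (z - z0) <= r' -> f z = 0) \/
  exists m h r' (dl : R), [/\ 0 < r' <= r, 0 < dl, analytic r' h,
    forall z, nm (z - z0) <= r' -> dl <= nm (h z) &
    forall z, nm (z - z0) <= r' -> f z = (z - z0) ^+ m * h z].
Proof.
move=> r0 [rho [c [rho1 [F [K [h1 h2 h3 h4]]]]]].
have z00 : nm (z0 - z0) <= r by rewrite subrr nm0 ltW.
have K0 : 0 <= K by have := le_trans (nm_ge0 _) (h3 0%N z0 z00); rewrite expr0 mulr1.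
have rho0 : 0 < rho by lra.
have fm m : (forall k, (k < m)%N -> c k = 0) ->
    forall z, nm (z - z0) <= r -> f z = (z - z0) ^+ m * F m z.
  move=> ck z zr; elim: m ck => [|m ih] ck; first by rewrite mul1r h1.
  rewrite ih => [|k km]; last by apply: ck; exact: leqW.
  by rewrite h2// h4 ck// add0r mulrA exprSr.
have [[m cm]|no] := pselect (exists m, c m != 0); last first.
  left; exists (Num.min r (2 * rho)^-1).
    by rewrite lt_min r0 invr_gt0 mulr_gt0.
  move=> z; rewrite le_min => /andP[zr zrho].
  have ck k : c k = 0.
    by apply/eqP; apply: contrapT => /negP h; apply: no; exists k.
  apply: nm_le0; apply/ler_addgt0Pl => e e0; rewrite addr0.
  have [N hN] := @expr_small R 2^-1 (e / (K + 1)) ltac:(lra) ltac:(lra)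
     ltac:(by rewrite divr_gt0// ltr_pwDr).
  rewrite (fm N (fun k _ => ck k) z zr) nmM nmX.
  apply: (@le_trans _ _ ((2 * rho)^-1 ^+ N * (K * rho ^+ N))).
    by rewrite ler_pM ?exprn_ge0 ?nm_ge0 ?h3// lerXn2r ?nnegrE ?nm_ge0// invr_ge0 mulr_ge0// ltW.
  rewrite mulrCA -exprMn invfM mulfVK ?gt_eqF//.
  apply: (le_trans (ler_wpM2l K0 (hN N (leqnn N)))).
  rewrite mulrCA ler_piMr ?(ltW e0)// ler_pdivrMr ?mul1r ?lerDl//.
  by rewrite ltr_pwDr.
right; have exm : exists m, c m != 0 by exists m.
pose m0 := ex_minn exm.
have [cm0 min0] : c m0 != 0 /\ forall k, (k < m0)%N -> c k = 0.
  rewrite /m0; case: ex_minnP => k ck kmin; split=> // j jk.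
  by apply/eqP; apply: contraLR jk; rewrite -leqNgt; exact: kmin.
pose C := K * rho ^+ m0.+1 + 1.
have C0 : 0 < C by rewrite ltr_pwDr// mulr_ge0// exprn_ge0// ltW.
have a0 : 0 < nm (c m0) by rewrite nm_gt0.
exists m0, (F m0), (Num.min r (nm (c m0) / (2 * C))), (nm (c m0) / 2).
have r'0 : 0 < Num.min r (nm (c m0) / (2 * C)).
  by rewrite lt_min r0 divr_gt0// mulr_gt0.
split.
- by rewrite r'0 ge_min lexx.
- by rewrite divr_gt0.
- apply: (analytic_sub (ltW r'0) (r := r)); first by rewrite ge_min lexx.
  exists rho, (fun n => c (m0 + n)%N); split=> //.
  exists (fun n => F (m0 + n)%N), (K * rho ^+ m0); split=> //.
  - by move=> z zr; rewrite addn0.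
  - by move=> n z zr; rewrite addnS; exact: h2.
  - by move=> n z zr; rewrite -mulrA -exprD; exact: h3.
- move=> z; rewrite le_min => /andP[zr zc].
  have := h2 m0 z zr; rewrite h4 => e.
  have : nm (c m0) <= nm (F m0 z) + nm (z - z0) * nm (F m0.+1 z).
    by rewrite -nmM -{1}(addrK ((z - z0) * F m0.+1 z) (c m0)) -e nmB.
  have : nm (z - z0) * nm (F m0.+1 z) <= nm (c m0) / (2 * C) * C.
    by rewrite ler_pM ?nm_ge0// (le_trans (h3 _ _ zr))// lerDl.
  rewrite (_ : nm (c m0) / (2 * C) * C = nm (c m0) / 2); first lra.
  by field; rewrite gt_eqF.
- move=> z; rewrite le_min => /andP[zr _]; exact: fm.
Qed.

End Taylor.

(** * Integration along a circle *)

Section CircleIntegral.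
Variable R : realType.
Implicit Types (g : R -> R[i]) (t k B : R).
Local Notation mu := (@lebesgue_measure R).
Local Notation I02 := (`[0, 2 * pi]%classic : set R).

Definition cint g : R[i] :=
  (\int[mu]_(t in `[0, 2 * pi]) complex.Re (g t)) +i*
  (\int[mu]_(t in `[0, 2 * pi]) complex.Im (g t)).

Definition cintegrable g :=
  mu.-integrable I02 (EFin \o (fun t => complex.Re (g t))) /\
  mu.-integrable I02 (EFin \o (fun t => complex.Im (g t))).

Lemma mI02 : measurable (I02 : set (measurableTypeR R)).
Proof. exact: measurable_itv. Qed.

Lemma pi2_gt0 : 0 < 2 * pi :> R.
Proof. by rewrite mulr_gt0// pi_gt0. Qed.

Lemma mu_I02 : mu I02 = (2 * pi)%:E.
Proof. by rewrite lebesgue_measure_itv/= lte_fin pi2_gt0 -EFinB subr0. Qed.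

Lemma Rintegral_cstI B : \int[mu]_(t in `[0, 2 * pi]) B = 2 * pi * B.
Proof.
have -> : 2 * pi * B = B * fine (mu I02) by rewrite mu_I02 mulrC.
exact: (Rintegral_cst mu mI02).
Qed.

Lemma eq_integrableI (f f' : R -> \bar R) : (forall t, f t = f' t) ->
  mu.-integrable I02 f -> mu.-integrable I02 f'.
Proof. by move=> /funext ->. Qed.

Lemma cint_ext g g' : (forall t, 0 <= t <= 2 * pi -> g t = g' t) -> cint g = cint g'.
Proof.
move=> e; congr (_ +i* _); apply: eq_Rintegral => t; rewrite inE/= in_itv/= => h;
  by rewrite e.
Qed.

Lemma cintegrableD g g' : cintegrable g -> cintegrable g' ->
  cintegrable (fun t => g t + g' t).
Proof.
move=> [h1 h2] [k1 k2]; split.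
  apply: (eq_integrableI _ (integrableD mI02 h1 k1)) => t /=.
  by case: (g t) => a b; case: (g' t).
apply: (eq_integrableI _ (integrableD mI02 h2 k2)) => t /=.
by case: (g t) => a b; case: (g' t).
Qed.

Lemma cintD g g' : cintegrable g -> cintegrable g' ->
  cint (fun t => g t + g' t) = cint g + cint g'.
Proof.
move=> [h1 h2] [k1 k2]; rewrite /cint; apply/eqP; rewrite eq_complex/=.
rewrite -!RintegralD//; try exact: mI02.
by apply/andP; split; apply/eqP; apply: eq_Rintegral => t _;
  case: (g t) => a b; case: (g' t).
Qed.

Lemma cintegrableZ (c : R[i]) g : cintegrable g -> cintegrable (fun t => c * g t).
Proof.
move=> [h1 h2]; split.
  apply: (eq_integrableI _ (integrableB mI02
    (integrableZl mI02 (complex.Re c) h1) (integrableZl mI02 (complex.Im c) h2))) => t /=.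
  by case: (g t) => a b; case: (c).
apply: (eq_integrableI _ (integrableD mI02
    (integrableZl mI02 (complex.Re c) h2) (integrableZl mI02 (complex.Im c) h1))) => t /=.
by case: (g t) => a b; case: (c).
Qed.

Lemma cintZ (c : R[i]) g : cintegrable g -> cint (fun t => c * g t) = c * cint g.
Proof.
move=> [h1 h2]; rewrite /cint; case: c => x y.
have i1 u : mu.-integrable I02 (EFin \o (fun t => u * complex.Re (g t))).
  by apply: (eq_integrableI _ (integrableZl mI02 u h1)).
have i2 u : mu.-integrable I02 (EFin \o (fun t => u * complex.Im (g t))).
  by apply: (eq_integrableI _ (integrableZl mI02 u h2)).
apply/eqP; rewrite eq_complex/= -!RintegralZl//; try exact: mI02.
rewrite -RintegralD// -?RintegralB//; try exact: mI02.
by apply/andP; split; apply/eqP; apply: eq_Rintegral => t _; case: (g t).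
Qed.

(** Real and imaginary parts are estimated separately, hence 4 pi in place of 2 pi. *)
Lemma cint_le g B : cintegrable g -> (forall t, 0 <= t <= 2 * pi -> nm (g t) <= B) ->
  nm (cint g) <= 4 * pi * B.
Proof.
move=> [h1 h2] gB.
have cB : mu.-integrable I02 (EFin \o (fun=> B)).
  apply: continuous_compact_integrable; first exact: segment_compact.
  exact/continuous_subspaceT/cst_continuous.
have bd (h : R -> R) : mu.-integrable I02 (EFin \o h) ->
    (forall t, 0 <= t <= 2 * pi -> `|h t| <= B) ->
    `|\int[mu]_(t in `[0, 2 * pi]) h t| <= 2 * pi * B.
  move=> hi hB; apply: (le_trans (le_normr_Rintegral mI02 hi)).
  apply: (@le_trans _ _ (\int[mu]_(t in `[0, 2 * pi]) B)).
    apply: (le_Rintegral mI02) => //.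
    - by apply: (eq_integrableI _ (integrable_abse hi)).
  by rewrite Rintegral_cstI.
have -> : 4 * pi * B = 2 * pi * B + 2 * pi * B by ring.
have -> : cint g = (complex.Re (cint g))%:C + 'i%C * (complex.Im (cint g))%:C by exact: complexE.
rewrite (le_trans (nmD _ _))// lerD//.
  rewrite nmRe; apply: bd => // t /gB; apply: le_trans; exact: Re_le_nm.
have -> : nm ('i%C * (complex.Im (cint g))%:C) = `|complex.Im (cint g)|.
  apply/eqP; rewrite -(@eqrXn2 _ 2)// ?nm_ge0// nm_sqr/= real_normK ?num_real//.
  by apply/eqP; ring.
by apply: bd => // t /gB; apply: le_trans; exact: Im_le_nm.
Qed.

(** The character e^(ikt); a real k lets negative exponents share the definition. *)
Definition expi k t : R[i] := cos (k * t) +i* sin (k * t).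

Lemma expiD k k' t : expi k t * expi k' t = expi (k + k') t.
Proof.
rewrite /expi mulrDl cosD sinD; apply/eqP; rewrite eq_complex/=.
by rewrite eqxx addrC mulrC eqxx.
Qed.

Lemma expi0 t : expi 0 t = 1.
Proof. by rewrite /expi mul0r cos0 sin0. Qed.

Lemma nm_expi k t : nm (expi k t) = 1.
Proof.
apply/eqP; rewrite -(@eqrXn2 _ 2)// ?nm_ge0// nm_sqr/= cos2Dsin2 expr1n//.
Qed.

Lemma expi_neq0 k t : expi k t != 0.
Proof. by rewrite -nm_gt0 nm_expi. Qed.

Lemma expiV k t : (expi k t)^-1 = expi (- k) t.
Proof.
apply: (mulIf (expi_neq0 k t)); rewrite mulVf ?expi_neq0// expiD addNr.
by rewrite expi0.
Qed.

Lemma expiX n t : expi 1 t ^+ n = expi n%:R t.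
Proof.
elim: n => [|n ih]; first by rewrite expi0.
by rewrite exprS ih expiD -natr1 addrC.
Qed.

Lemma continuous_cosM k : continuous (fun t => cos (k * t) : R).
Proof.
move=> t; apply: continuous_comp; last exact: continuous_cos.
by apply: cvgMr; exact: cvg_id.
Qed.

Lemma continuous_sinM k : continuous (fun t => sin (k * t) : R).
Proof.
move=> t; apply: continuous_comp; last exact: continuous_sin.
by apply: cvgMr; exact: cvg_id.
Qed.

Lemma cintegrable_expi k : cintegrable (expi k).
Proof.
split; apply: continuous_compact_integrable; try exact: segment_compact.
  exact/continuous_subspaceT/continuous_cosM.
exact/continuous_subspaceT/continuous_sinM.
Qed.

Lemma Rintegral_primitive (F f : R -> R) : continuous f ->
  (forall t, is_derive t (1 : R) F (f t)) ->
  \int[mu]_(t in `[0, 2 * pi]) f t = F (2 * pi) - F 0.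
Proof.
move=> cf dF.
have cF : continuous F.
  by move=> t; apply: differentiable_continuous; apply/derivable1_diffP; exact: ex_derive.
rewrite /Rintegral (@continuous_FTC2 _ f F)//.
- exact: pi2_gt0.
- exact/continuous_subspaceT.
- split=> [t _||]; first exact: ex_derive.
  + by apply: cvg_at_right_filter; exact: cF.
  + by apply: cvg_at_left_filter; exact: cF.
- by move=> t _; rewrite derive1E; apply: derive_val.
Qed.

Lemma expi_int_period (n m : nat) : expi (n%:R - m%:R) (2 * pi) = 1.
Proof.
have h p : expi p%:R (2 * pi) = 1.
  rewrite -expiX /expi mul1r mulrC mulr_natr cos2pi sin2pi.
  by rewrite expr1n.
by rewrite -expiD -expiV !h invr1 mulr1.
Qed.

Lemma cint_expi (n m : nat) :
  cint (expi (n%:R - m%:R)) = if n == m then (2 * pi)%:C else 0.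
Proof.
have [->|nm] := eqVneq n m.
  rewrite subrr /cint (_ : expi 0 = fun=> 1); last by apply/funext => t; rewrite expi0.
  by rewrite /= !Rintegral_cstI mulr1 mulr0.
set k := _ - _; have k0 : k != 0 by rewrite subr_eq0 eqr_nat.
have := expi_int_period n m; rewrite -/k => -[ck sk].
have ds t : is_derive t (1 : R) (fun t => k^-1 * sin (k * t)) (cos (k * t)).
  apply: is_derive_eq; rewrite /GRing.scale/= ?derive_val ?mulr0 ?addr0.
  by rewrite mulr1 mulrCA mulVf// mulr1.
have dc t : is_derive t (1 : R) (fun t => - k^-1 * cos (k * t)) (sin (k * t)).
  apply: is_derive_eq; rewrite /GRing.scale/= ?derive_val ?mulr0 ?addr0.
  by field.
rewrite /cint /= (Rintegral_primitive (@continuous_cosM k) ds).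
rewrite (Rintegral_primitive (@continuous_sinM k) dc).
by rewrite sk ck !mulr0 sin0 cos0 !mulr0 mulr1 !subrr.
Qed.

Lemma cintegrable_sum (N : nat) (a : nat -> R[i]) (k : nat -> R) :
  cintegrable (fun t => \sum_(n < N) a n * expi (k n) t) /\
  cint (fun t => \sum_(n < N) a n * expi (k n) t) =
    \sum_(n < N) a n * cint (expi (k n)).
Proof.
elim: N => [|N [ih1 ih2]].
  have e : (fun t => \sum_(n < 0) a n * expi (k n) t) = (fun t => 0 * expi 0 t).
    by apply/funext => t; rewrite big_ord0 mul0r.
  rewrite big_ord0 e; split; first exact/cintegrableZ/cintegrable_expi.
  by rewrite cintZ ?mul0r//; exact: cintegrable_expi.
have e : (fun t => \sum_(n < N.+1) a n * expi (k n) t) =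
    (fun t => \sum_(n < N) a n * expi (k n) t + a N * expi (k N) t).
  by apply/funext => t; rewrite big_ord_recr.
have iN : cintegrable (fun t => a N * expi (k N) t) by exact/cintegrableZ/cintegrable_expi.
rewrite e big_ord_recr/= -ih2; split; first exact: cintegrableD.
rewrite cintD// cintZ//; exact: cintegrable_expi.
Qed.

(** The factor e^(it) of dz shifts the exponent to n + 1 - m, so only n = m - 1 survives
    integration, and nothing does when m = 0. *)
Lemma cint_laurent_sum (c : nat -> R[i]) (s : R) m N : 0 < s -> (m <= N)%N ->
  cint (fun t => \sum_(n < N) (c n * s%:C ^+ n / s%:C ^+ m * (0 +i* s)) *
    expi (n.+1%:R - m%:R) t) =
    (0 +i* (2 * pi)) * (if m is m'.+1 then c m' else 0).
Proof.
move=> s0 mN.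
pose a n : R[i] := c n * s%:C ^+ n / s%:C ^+ m * (0 +i* s).
pose k n : R := n.+1%:R - m%:R.
have [_] := cintegrable_sum N a k; rewrite {1}/a {1}/k => ->.
have isn : (0 +i* s : R[i]) = s%:C * 'i%C.
  by apply/eqP; rewrite eq_complex/=; apply/andP; split; apply/eqP; ring.
have ipi : (0 +i* (2 * pi) : R[i]) = (2 * pi)%:C * 'i%C.
  by apply/eqP; rewrite eq_complex/=; apply/andP; split; apply/eqP; ring.
have sC : s%:C != 0 :> R[i] by rewrite -nm_gt0 nmRe gtr0_norm.
case: m @a @k mN => [|m'] a k mN.
  by rewrite mulr0 big1// => i _; rewrite /k cint_expi/= mulr0.
rewrite (bigD1 (Ordinal mN))//= big1 ?addr0.
  rewrite /k cint_expi eqxx /a isn ipi exprS.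
  by field; rewrite sC expf_neq0.
move=> i ij; rewrite /k cint_expi eqSS ifN ?mulr0//.
Qed.

(** The residue at a pole of order at most m: on the circle f is a Taylor polynomial with N terms
    plus a remainder of order (s rho)^N. *)
Lemma circle_integral_laurent (z0 : R[i]) (r rho s : R) f c m :
  taylor z0 r rho f c -> 0 < s -> s <= r -> 0 < rho -> s * rho < 1 ->
  circle_integral (fun z => ((z - z0) ^+ m)^-1 * f z) z0 s =
    (0 +i* (2 * pi)) * (if m is m'.+1 then c m' else 0).
Proof.
move=> [F [K [h1 h2 h3 h4]]] s0 sr rho0 srho.
pose w t : R[i] := s%:C * expi 1 t.
have wE t : circle_point z0 s t - z0 = w t.
  by rewrite /circle_point addrC addKr /w /expi mul1r.
have nw t : nm (w t) = s by rewrite nmM nmRe nm_expi mulr1 gtr0_norm.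
have wr t : nm (circle_point z0 s t - z0) <= r by rewrite wE nw.
pose g t := (w t ^+ m)^-1 * f (circle_point z0 s t) * (0 +i* s) * expi 1 t.
have gE : circle_integral (fun z => ((z - z0) ^+ m)^-1 * f z) z0 s = cint g.
  rewrite /circle_integral; apply: cint_ext => t _.
  by rewrite wE /g /expi mul1r.
rewrite gE.
pose a n : R[i] := c n * s%:C ^+ n / s%:C ^+ m * (0 +i* s).
pose k n : R := (n.+1)%:R - m%:R.
pose P N t := \sum_(n < N) a n * expi (k n) t.
have fN N t : f (circle_point z0 s t) =
    \sum_(n < N) c n * w t ^+ n + w t ^+ N * F N (circle_point z0 s t).
  elim: N => [|N ih]; first by rewrite big_ord0 add0r mul1r h1.
  rewrite ih big_ord_recr/= h2// h4 wE mulrDr mulrA -exprSr.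
  by rewrite [w t ^+ N * _]mulrC addrA.
have is0 : nm (0 +i* s : R[i]) = s.
  apply/eqP; rewrite -(@eqrXn2 _ 2)// ?nm_ge0 ?ltW// nm_sqr/= expr0n/= add0r//.
have gP N t : g t = P N t + (w t ^+ m)^-1 * (w t ^+ N * F N (circle_point z0 s t)) *
    (0 +i* s) * expi 1 t.
  rewrite /g (fN N) mulrDr !mulrDl; congr (_ + _).
  rewrite /P big_distrr/= !big_distrl/=; apply: eq_bigr => n _.
  rewrite /a /k /w !exprMn !expiX invfM expiV -natr1 addrAC.
  by rewrite -!expiD -[expi 1 t]/(expi 1 t); ring.
pose C := K * s / s ^+ m; pose q := s * rho.
have C0 : 0 <= C.
  have K0 : 0 <= K by have := le_trans (nm_ge0 _) (h3 0%N _ (wr 0)); rewrite expr0 mulr1.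
  by rewrite /C divr_ge0 ?exprn_ge0 ?mulr_ge0// ltW.
have q0 : 0 <= q by rewrite mulr_ge0 ?ltW.
have rem N t : nm (g t - P N t) <= C * q ^+ N.
  rewrite (gP N) addrC addKr !nmM nm_expi mulr1 is0 nmV !nmX nw.
  have := h3 N _ (wr t) => h.
  apply: (@le_trans _ _ ((s ^+ m)^-1 * (s ^+ N * (K * rho ^+ N)) * s)).
    rewrite ler_wpM2r ?(ltW s0)// ler_wpM2l ?invr_ge0 ?exprn_ge0 ?(ltW s0)//.
    by rewrite ler_wpM2l// exprn_ge0// ltW.
  by rewrite /C /q exprMn le_eqVlt; apply/orP; left; apply/eqP; ring.
have lim (u : nat -> R) l : (forall N, `|u N - l| <= C * q ^+ N) -> u @ \oo --> l.
  move=> h; apply/cvgrPdist_le => e e0.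
  have [N hN] := @expr_small R q (e / (C + 1)) q0 srho ltac:(by rewrite divr_gt0// ltr_pwDr).
  exists N => // n /= /hN hn; rewrite distrC (le_trans (h n))//.
  apply: (le_trans (ler_wpM2l C0 hn)).
  by rewrite mulrCA ler_piMr ?(ltW e0)// ler_pdivrMr ?mul1r ?lerDl// ltr_pwDr.
have PI N : cintegrable (P N) by have [] := cintegrable_sum N a k.
have bdg t : nm (g t) <= C.
  by have := rem 0%N t; rewrite /P big_ord0 subr0 expr0 mulr1.
have mu2pi : (mu I02 < +oo)%E.
  by rewrite mu_I02 ltry.
(* Measurability of g comes from the pointwise limit of the trigonometric polynomials P N, and
   boundedness then gives integrability. *)
have gI : cintegrable g.
  split; apply: (measurable_bounded_integrable mI02) => //.
  - apply: (@measurable_realfun.measurable_fun_cvg _ _ _ _ (fun N t => complex.Re (P N t))).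
      move=> N; have [/measurable_int/measurable_realfun.measurable_EFinP h _] := PI N; exact: h.
    move=> t _; apply: lim => N; rewrite distrC.
    have := Re_le_nm (g t - P N t); rewrite raddfB => /le_trans; apply; exact: rem.
  - exists C; split; rewrite ?num_real// => M CM t _ /=.
    by rewrite (le_trans (Re_le_nm _))// (le_trans (bdg t))// ltW.
  - apply: (@measurable_realfun.measurable_fun_cvg _ _ _ _ (fun N t => complex.Im (P N t))).
      move=> N; have [_ /measurable_int/measurable_realfun.measurable_EFinP h] := PI N; exact: h.
    move=> t _; apply: lim => N; rewrite distrC.
    have := Im_le_nm (g t - P N t); rewrite raddfB => /le_trans; apply; exact: rem.
  - exists C; split; rewrite ?num_real// => M CM t _ /=.
    by rewrite (le_trans (Im_le_nm _))// (le_trans (bdg t))// ltW.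
have PN N : (m <= N)%N -> cint (P N) =
    (0 +i* (2 * pi)) * (if m is m'.+1 then c m' else 0).
  by move=> mN; exact: cint_laurent_sum.
apply/eqP; rewrite -subr_eq0; apply/eqP; apply: nm_le0.
apply/ler_addgt0Pl => e e0; rewrite addr0.
have p4 : 0 < 4 * pi * (C + 1) by rewrite !mulr_gt0// ?pi_gt0// ltr_pwDr.
have [N hN] := @expr_small R q (e / (4 * pi * (C + 1))) q0 srho (divr_gt0 e0 p4).
rewrite -(PN (maxn m N) (leq_maxl _ _)).
have -> : cint g - cint (P (maxn m N)) = cint (fun t => g t + (-1) * P (maxn m N) t).
  rewrite cintD ?cintZ ?mulN1r//; exact: cintegrableZ.
apply: (le_trans (cint_le (B := C * q ^+ maxn m N) _ _)).
- by apply: cintegrableD => //; exact: cintegrableZ.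
- by move=> t _; rewrite mulN1r; exact: rem.
apply: (@le_trans _ _ (4 * pi * (C + 1) * q ^+ maxn m N)).
  by rewrite -[leRHS]mulrA ler_wpM2l ?ler_wpM2r ?exprn_ge0 ?lerDl// mulr_ge0// pi_ge0.
by rewrite mulrC -ler_pdivlMr// hN// leq_maxr.
Qed.

End CircleIntegral.

(** * Finite-rank perturbations *)

Section LocalSpectrum.
Variables (R : realType) (H : completeNormedModType R[i]).
Variable ip : {dot H for (@Num.conj R[i])}.
Hypothesis ip_norm : forall x : H, ip x x = `|x| ^+ 2.
Implicit Types (x y u v w : H) (z : R[i]).

Lemma resolvent_identity (S : linop H) z z0 x : resolvent_set S z -> resolvent_set S z0 ->
  resolvent S z x = resolvent S z0 x + (z - z0) *: resolvent S z (resolvent S z0 x).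
Proof.
move=> rz rz0; have [d0 e0] := resolventP x rz0.
have [d1 e1] := resolventP (resolvent S z0 x) rz.
apply: resolvent_unique => //; first by apply: opdomD => //; exact: opdomZ.
rewrite opshiftD//; last exact: opdomZ.
rewrite opshiftZ// e1 -[RHS]e0 /opshift scalerBl.
by rewrite addrA subrK.
Qed.

(** By the resolvent identity the k-th difference quotient of R(z) x at z0 is R(z) R(z0)^k x, of
    norm at most 2 M M^k |x|. *)
Lemma resolvent_taylor (S : linop H) z0 : resolvent_set S z0 ->
  exists r rho : R, [/\ 0 < r, 1 <= rho,
    forall z, nm (z - z0) <= r -> resolvent_set S z &
    forall x y, taylor z0 r rho (fun z => ip (resolvent S z x) y)
      (fun k => ip (iter k.+1 (resolvent S z0) x) y)].
Proof.
move=> rz0; have [_ [M0 M00 hM0]] := (resolvent_setP S z0).1 rz0.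
pose M := M0 + 1.
have M1 : 1 <= M by rewrite /M; lra.
have M0' : 0 < M by lra.
have hM u : opdom S u -> nm u <= M * nm (opshift S z0 u).
  by move=> /hM0 /le_trans; apply; rewrite ler_wpM2r ?nm_ge0// /M lerDl.
have sh z u : nm (z - z0) <= (2 * M)^-1 -> opdom S u ->
    nm (opshift S z u - opshift S z0 u) <= 2^-1 * nm (opshift S z0 u).
  move=> h Su; rewrite /opshift [S u - z *: u]addrC addrKA opprK addrC -scalerBl.
  rewrite nmZ nm_sym (le_trans (ler_wpM2r (nm_ge0 _) h))//.
  by rewrite invfM -mulrA ler_pM2l// ler_pdivrMl//; exact: hM.
have rS z : nm (z - z0) <= (2 * M)^-1 -> resolvent_set S z.
  move=> h; apply: (@resolvent_perturb _ _ S S z0 z 2^-1) => //; first lra.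
  by move=> u Su; exact: sh.
have bR z x : nm (z - z0) <= (2 * M)^-1 -> nm (resolvent S z x) <= 2 * M * nm x.
  move=> h; have [d e] := resolventP x (rS z h).
  have := hM _ d; have := sh z _ h d; rewrite e => h1 h2.
  have h3 := nm_le_sub (opshift S z0 (resolvent S z x)) x; rewrite nm_sym in h3.
  have h4 : nm (opshift S z0 (resolvent S z x)) <= 2 * nm x by lra.
  by rewrite (le_trans h2)// [2 * M]mulrC -mulrA ler_pM2l.
have b0 x : nm (resolvent S z0 x) <= M * nm x.
  by have [d e] := resolventP x rz0; have := hM _ d; rewrite e.
exists (2 * M)^-1, M; split=> //; first by rewrite invr_gt0 mulr_gt0.
move=> x y; exists (fun k z => ip (resolvent S z (iter k (resolvent S z0) x)) y),
  (2 * M * nm x * nm y); split=> //.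
  move=> k z h; rewrite (resolvent_identity _ (rS z h) rz0).
  by rewrite (ipDl ip) (ipZl ip) iterS.
move=> k z h; rewrite (le_trans (ip_le ip_norm _ _))// mulrAC ler_wpM2r ?nm_ge0//.
rewrite (le_trans (bR _ _ h))// -[leRHS]mulrA ler_wpM2l//; first by rewrite mulr_ge0// ltW.
elim: k => [|k ih]; first by rewrite expr0 mulr1.
by rewrite iterS (le_trans (b0 _))// exprS mulrCA ler_wpM2l// ltW.
Qed.

Section FiniteRankPerturbation.
Variables (S S0 : linop H) (n : nat) (f g : nat -> H).
Hypothesis domE : opdom S = opdom S0.
Hypothesis SE : forall x, opdom S0 x -> S x = S0 x + finite_rank ip n f g x.

(** Pairing u + sum_j <u, f j> R0(z) g j = R0(z) x with f k gives [t *m pencil z = moments z x] for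
    the row t of the <u, f k>. The determinant is that of Weinstein and Aronszajn. *)
Definition pencil z : 'M[R[i]]_n :=
  \matrix_(j, k) ((j == k)%:R + ip (resolvent S0 z (g j)) (f k)).

Lemma row_mul_pencil z (t : 'rV[R[i]]_n) k :
  (t *m pencil z) 0 k = t 0 k + \sum_j t 0 j * ip (resolvent S0 z (g j)) (f k).
Proof.
rewrite mxE (eq_bigr (fun j => t 0 j * (j == k)%:R +
  t 0 j * ip (resolvent S0 z (g j)) (f k))); last first.
  by move=> j _; rewrite mxE mulrDr.
rewrite big_split/= (bigD1 k)//= eqxx mulr1 big1 ?addr0// => j jk.
by rewrite (negbTE jk) mulr0.
Qed.

Lemma opshift_perturb z u : opdom S0 u ->
  opshift S z u = opshift S0 z u + finite_rank ip n f g u.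
Proof. by move=> Su; rewrite /opshift SE// addrAC. Qed.

(** This solves (S - z) u = x exactly when t is the row of its own inner products with the f k. *)
Definition candidate z x (t : 'rV[R[i]]_n) : H :=
  resolvent S0 z x - \sum_j t 0 j *: resolvent S0 z (g j).

Lemma candidate_dom z x t : resolvent_set S0 z -> opdom S0 (candidate z x t).
Proof.
move=> rz; apply: opdomB; first by have [] := resolventP x rz.
by apply: opdom_sum => j; apply: opdomZ; have [] := resolventP (g j) rz.
Qed.

Lemma opshift_sum (T : linop H) z (I : Type) (s : seq I) (F : I -> H) :
  (forall i, opdom T (F i)) ->
  opshift T z (\sum_(i <- s) F i) = \sum_(i <- s) opshift T z (F i).
Proof.
move=> h; elim: s => [|i s ih]; first by rewrite !big_nil opshift0.
by rewrite !big_cons opshiftD// ?ih//; exact: opdom_sum.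
Qed.

Lemma opshift0_candidate z x t : resolvent_set S0 z ->
  opshift S0 z (candidate z x t) = x - \sum_(j < n) t 0 j *: g j.
Proof.
move=> rz; have [dx ex] := resolventP x rz.
have dg j : opdom S0 (t 0 j *: resolvent S0 z (g j)).
  by apply: opdomZ; have [] := resolventP (g j) rz.
rewrite opshiftB ?ex ?opshift_sum//; last exact: opdom_sum.
congr (_ - _); apply: eq_bigr => j _; have [d e] := resolventP (g j) rz.
by rewrite opshiftZ// e.
Qed.

Lemma ip_candidate z x t k : ip (candidate z x t) (f k) =
  ip (resolvent S0 z x) (f k) - \sum_(j < n) t 0 j * ip (resolvent S0 z (g j)) (f k).
Proof.
rewrite (ipBl ip) (ip_suml ip); congr (_ - _).
by apply: eq_bigr => j _; rewrite (ipZl ip).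
Qed.

Definition moments z x : 'rV[R[i]]_n := \row_k ip (resolvent S0 z x) (f k).

Lemma opshift_candidate z x t : resolvent_set S0 z -> t *m pencil z = moments z x ->
  opshift S z (candidate z x t) = x /\ forall k : 'I_n, ip (candidate z x t) (f k) = t 0 k.
Proof.
move=> rz tM.
have tk (k : 'I_n) : ip (candidate z x t) (f k) = t 0 k.
  rewrite ip_candidate; move/rowP : tM => /(_ k); rewrite row_mul_pencil mxE => <-.
  by rewrite addrK.
split=> //; rewrite opshift_perturb; last exact: candidate_dom.
rewrite opshift0_candidate// /finite_rank.
have -> : \sum_(k < n) ip (candidate z x t) (f k) *: g k = \sum_(k < n) t 0 k *: g k.
  by apply: eq_bigr => k _; rewrite tk.
by rewrite subrK.
Qed.

Lemma candidate_inv z u : resolvent_set S0 z -> opdom S0 u ->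
  let t := \row_k ip u (f k) in
  u = candidate z (opshift S z u) t /\ t *m pencil z = moments z (opshift S z u).
Proof.
move=> rz Su t.
have uE : u = candidate z (opshift S z u) t.
  apply: (resolvent_inj rz) => //; first exact: candidate_dom.
  rewrite opshift0_candidate// opshift_perturb// /finite_rank.
  have -> : \sum_(k < n) ip u (f k) *: g k = \sum_(k < n) t 0 k *: g k.
    by apply: eq_bigr => k _; rewrite mxE.
  by rewrite addrK.
split=> //; apply/rowP => k; rewrite row_mul_pencil [t 0 k]mxE {1}uE ip_candidate.
by rewrite subrK mxE.
Qed.

Lemma pencil_solution z (t v : 'rV[R[i]]_n) : \det (pencil z) != 0 ->
  t *m pencil z = v <-> t = (\det (pencil z))^-1 *: (v *m \adj (pencil z)).
Proof.
move=> d0; split=> [<-|->].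
  by rewrite -mulmxA mul_mx_adj mul_mx_scalar scalerA mulVf// scale1r.
by rewrite -scalemxAl -mulmxA mul_adj_mx mul_mx_scalar scalerA mulVf// scale1r.
Qed.

Lemma pencil_resolvent z : resolvent_set S0 z -> \det (pencil z) != 0 ->
  resolvent_set S z /\ forall x, resolvent S z x =
    candidate z x ((\det (pencil z))^-1 *: (moments z x *m \adj (pencil z))).
Proof.
move=> rz d0.
have sol x : opshift S z (candidate z x
    ((\det (pencil z))^-1 *: (moments z x *m \adj (pencil z)))) = x.
  apply: (opshift_candidate rz _).1.
  exact: (pencil_solution _ _ d0).2.
have rS : resolvent_set S z.
  apply/resolvent_setP; split=> [y|].
    by exists (candidate z y ((\det (pencil z))^-1 *: (moments z y *m \adj (pencil z)))) => //;
       rewrite domE; exact: candidate_dom.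
  have [_ [M M0 hM]] := (resolvent_setP S0 z).1 rz.
  have bR x : nm (resolvent S0 z x) <= M * nm x.
    by have [d e] := resolventP x rz; have := hM _ d; rewrite e.
  pose B := \sum_(j < n) nm (\det (pencil z))^-1 *
    (\sum_(k < n) M * nm (f k) * nm (\adj (pencil z) k j)) * nm (resolvent S0 z (g j)).
  have B0 : 0 <= B.
    apply: sumr_ge0 => j _; rewrite !mulr_ge0 ?nm_ge0//.
    by apply: sumr_ge0 => k _; rewrite !mulr_ge0 ?nm_ge0// ltW.
  exists (M + B); first by rewrite ltr_pwDl.
  move=> u; rewrite domE => Su; have [uE tM] := candidate_inv rz Su.
  move/(pencil_solution _ _ d0) : tM => tE.
  rewrite {1}uE tE /candidate (le_trans (nmB _ _))// mulrDl lerD//.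
  rewrite /B big_distrl/= (le_trans (nm_sum _ _ _))//; apply: ler_sum => j _.
  rewrite nmZ mulrAC ler_wpM2r ?nm_ge0// !mxE nmM -mulrA ler_wpM2l ?nm_ge0//.
  rewrite big_distrl/= (le_trans (nm_sum _ _ _))//; apply: ler_sum => k _.
  rewrite nmM !mxE mulrAC ler_wpM2r ?nm_ge0// (le_trans (ip_le ip_norm _ _))//.
  by rewrite mulrAC ler_wpM2r ?nm_ge0.
split=> // x; apply: resolvent_unique => //.
by rewrite domE; exact: candidate_dom.
Qed.

(** A null row vector t of the pencil is the row of inner products of [candidate z 0 t] with the f
    k, so this solution of (S - z) u = 0 is nonzero. *)
Lemma pencil_eigen z : resolvent_set S0 z -> \det (pencil z) = 0 -> point_spectrum S z.
Proof.
move=> rz /eqP/det0P[t t0 tM].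
have m0 : t *m pencil z = moments z 0.
  rewrite tM; apply/rowP => k; rewrite !mxE.
  rewrite (resolvent_unique rz (opdom0 S0) (opshift0 S0 z)) (ip0l ip) //.
have [e tk] := opshift_candidate rz m0.
exists (candidate z 0 t); split.
- apply/eqP => c0; move/eqP: t0; apply; apply/rowP => k.
  by rewrite -tk c0 (ip0l ip) mxE.
- by rewrite domE; exact: candidate_dom.
- by apply/eqP; rewrite -subr_eq0 -/(opshift S z _) e.
Qed.

Lemma point_spectrum_sub z : point_spectrum S z -> spectrum S z.
Proof.
move=> [x [x0 Sx Sxe]] rz; move/eqP: x0; apply.
apply: (resolvent_inj rz Sx (opdom0 S)).
by rewrite opshift0 /opshift Sxe subrr.
Qed.

Lemma spectrum_eigen z : resolvent_set S0 z -> spectrum S z -> point_spectrum S z.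
Proof.
move=> rz sz; apply: pencil_eigen => //; apply/eqP; apply: contrapT => /negP d0.
by apply: sz; have [] := pencil_resolvent rz d0.
Qed.

Lemma analytic_bound (z0 : R[i]) (r : R) (F : 'I_n -> 'I_n -> R[i] -> R[i]) : 0 <= r ->
  (forall i j, analytic z0 r (F i j)) ->
  exists (rho : R) (c : 'I_n -> 'I_n -> nat -> R[i]),
    1 <= rho /\ forall i j, taylor z0 r rho (F i j) (c i j).
Proof.
move=> r0 h.
have /choice[rc hrc] : forall p : 'I_n * 'I_n, exists rc : R * (nat -> R[i]),
    1 <= rc.1 /\ taylor z0 r rc.1 (F p.1 p.2) rc.2.
  by move=> [i j]; have [rho [c hc]] := h i j; exists (rho, c).
exists (1 + \sum_p (rc p).1), (fun i j => (rc (i, j)).2).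
have rc0 p : 0 <= (rc p).1 by have [h1 _] := hrc p; lra.
have s0 : 0 <= \sum_p (rc p).1 by exact: sumr_ge0.
split=> [|i j]; first by rewrite lerDl.
have [h1 h2] := hrc (i, j); apply: taylor_sub h2 => //.
rewrite (bigD1 (i, j))//= addrCA lerDl addr_ge0//.
by apply: sumr_ge0.
Qed.

(** The alternative is that for the zeros of the determinant. At an isolated zero of order m, R_S(z)
    x is R0(z) x minus a combination of the R0(z) g j with poles of order at most m in the
    coefficients, so its residue lies in the span of finitely many R0(z0)^i g j. *)
Lemma local_dichotomy z0 : resolvent_set S0 z0 ->
  (exists2 r : R, 0 < r & forall z, nm (z - z0) <= r -> spectrum S z) \/
  (exists2 r : R, 0 < r & forall z, z != z0 -> nm (z - z0) <= r -> resolvent_set S z) /\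
  fin_alg_mult ip S z0.
Proof.
move=> rz0; have [r [rho [r0 rho1 rS0 tay]]] := resolvent_taylor rz0.
have an x y : analytic z0 r (fun z => ip (resolvent S0 z x) y).
  by exists rho, (fun k => ip (iter k.+1 (resolvent S0 z0) x) y).
have anM i j : analytic z0 r (fun z => pencil z i j).
  apply: (@analytic_ext _ _ _ (fun z => (i == j)%:R + ip (resolvent S0 z (g i)) (f j))).
    by move=> z _; rewrite mxE.
  by apply: analytic_add; [exact: ltW|exact: analytic_cst|exact: an].
have [[r' r'0 h]|[m [h [r' [dl [/andP[r'0 r'r] dl0 anh hdl dE]]]]]] :=
    analytic_zeros r0 (analytic_det (ltW r0) anM).
  left; exists (Num.min r r'); first by rewrite lt_min r0.
  move=> z; rewrite le_min => /andP[zr zr'].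
  by apply: point_spectrum_sub; apply: pencil_eigen; [exact: rS0|exact: h].
right.
have h0 z : nm (z - z0) <= r' -> h z != 0.
  by move=> /hdl hz; rewrite -nm_gt0 (lt_le_trans dl0).
have d0 z : z != z0 -> nm (z - z0) <= r' -> \det (pencil z) != 0.
  by move=> zz0 zr; rewrite dE// mulf_neq0 ?h0// expf_neq0// subr_eq0.
have rS z : z != z0 -> nm (z - z0) <= r' -> resolvent_set S z.
  move=> zz0 zr; apply: (pencil_resolvent _ (d0 z zz0 zr)).1.
  by apply: rS0; exact: le_trans r'r.
split; first by exists r'.
have ane k j : analytic z0 r' (fun z => \adj (pencil z) k j / h z).
  apply: (analytic_div (ltW r'0) dl0 hdl) => //.
  apply: (analytic_sub (ltW r'0) r'r); exact: analytic_adj (ltW r0) anM _ _.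
have [rho' [e [rho'1 te]]] := analytic_bound (ltW r'0) ane.
pose p := Num.max rho rho'.
have p1 : 1 <= p by rewrite le_max rho1.
have tay' x y : taylor z0 r' p (fun z => ip (resolvent S0 z x) y)
      (fun k => ip (iter k.+1 (resolvent S0 z0) x) y).
  by apply: taylor_sub (tay x y) => //; [exact: ltW|rewrite le_max lexx].
have te' k j : taylor z0 r' p (fun z => \adj (pencil z) k j / h z) (e k j).
  by apply: taylor_sub (te k j) => //; [exact: ltW|rewrite le_max lexx orbT].
(* The coefficient t_j of Cramer's rule, multiplied by (z - z0)^m; qc lists its Taylor
   coefficients. *)
pose q x (j : 'I_n) (z : R[i]) : R[i] :=
  \sum_(k < n) ip (resolvent S0 z x) (f k) * (\adj (pencil z) k j / h z).
pose qc x (j : 'I_n) (i : nat) : R[i] := \sum_(k < n) \sum_(i' < i.+1)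
  ip (iter i'.+1 (resolvent S0 z0) x) (f k) * e k j (i - i')%N.
have tq x j : taylor z0 r' (2 * p) (q x j) (qc x j).
  apply: taylor_sum => [|k]; first lra.
  exact: (taylor_mul (ltW r'0) p1 (tay' x (f k)) (te' k j)).
(* Minus the coefficient of order m - 1 of (z - z0)^m R_S(z) x. The term (z - z0)^m R0(z) x starts
   at order m and leaves no trace in it. *)
pose P x : H := \sum_(j < n) \sum_(i < m) qc x j i *: iter (m - i)%N (resolvent S0 z0) (g j).
have p20 : 1 <= 2 * p by lra.
have tayq x y : taylor z0 r' (2 * (2 * p))
  (fun z => (z - z0) ^+ m * ip (resolvent S0 z x) y +
     (-1) * \sum_(j < n) q x j z * ip (resolvent S0 z (g j)) y)
  (fun k => (if (m <= k)%N then ip (iter (k - m).+1 (resolvent S0 z0) x) y else 0) +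
     (-1) * \sum_(j < n) \sum_(i < k.+1) qc x j i * ip (iter (k - i).+1 (resolvent S0 z0) (g j)) y).
  have lift2 x' y' : taylor z0 r' (2 * p) (fun z => ip (resolvent S0 z x') y')
      (fun k => ip (iter k.+1 (resolvent S0 z0) x') y').
    by apply: taylor_sub (tay' x' y') => //; [exact: ltW|lra].
  have p41 : 1 <= 2 * (2 * p) by lra.
  apply: taylor_add.
    have pp : p <= 2 * (2 * p) by lra.
    exact: (taylor_mulXn m (ltW r'0) p41 (taylor_sub (ltW r'0) (lexx _) p1 pp (tay' x y))).
  apply: taylor_scale; apply: taylor_sum => // j.
  exact: (taylor_mul (ltW r'0) p20 (tq x j) (lift2 (g j) y)).
(* The growth rate in [tayq] is 4 p, so s times it is at most 1/2. *)
pose s := Num.min r' (8 * p)^-1.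
have s0 : 0 < s by rewrite lt_min r'0 invr_gt0; lra.
have sr' : s <= r' by rewrite ge_min lexx.
have sp : s * (2 * (2 * p)) < 1.
  apply: (@le_lt_trans _ _ ((8 * p)^-1 * (2 * (2 * p)))).
    by rewrite ler_wpM2r ?ge_min ?lexx ?orbT//; lra.
  by rewrite mulrC ltr_pdivrMr; lra.
exists P; last first.
  pose I := ('I_n * 'I_m)%type.
  exists #|{: I}|, (fun a : 'I_#|{: I}| =>
    iter (m - (enum_val a).2)%N (resolvent S0 z0) (g (enum_val a).1)).
  move=> _ [x _ <-].
  exists (fun a : 'I_#|{: I}| => qc x (enum_val a).1 (enum_val a).2).
  by rewrite /P pair_big/= (reindex (@enum_val I {: I}))//; exact/onW_bij/enum_val_bij.
exists s; split=> //.
  by move=> z zz0; rewrite nmE lecR => zs; apply: rS => //; exact: le_trans sr'.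
move=> x y.
have cE : circle_integral (fun z => ip (resolvent S z x) y) z0 s =
  circle_integral (fun z => ((z - z0) ^+ m)^-1 * ((z - z0) ^+ m * ip (resolvent S0 z x) y +
     (-1) * \sum_(j < n) q x j z * ip (resolvent S0 z (g j)) y)) z0 s.
  apply: cint_ext => t _; congr (_ * _ * _).
  set z := circle_point z0 s t.
  have nz : nm (z - z0) = s.
    rewrite /z /circle_point addrC addKr nmM nmRe gtr0_norm//.
    by have := nm_expi (1 : R) t; rewrite /expi mul1r => ->; rewrite mulr1.
  have zz0 : z != z0 by rewrite -subr_eq0 -nm_gt0 nz.
  have zr' : nm (z - z0) <= r' by rewrite nz.
  have w0 : (z - z0) ^+ m != 0 by rewrite expf_neq0// subr_eq0.
  have rz : resolvent_set S0 z by apply: rS0; exact: le_trans r'r.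
  rewrite (pencil_resolvent rz (d0 z zz0 zr')).2 /candidate (ipBl ip) (ip_suml ip).
  rewrite mulrDr mulKf// mulN1r mulrN; congr (_ - _).
  rewrite big_distrr/=; apply: eq_bigr => j _.
  rewrite (ipZl ip) mulrA; congr (_ * _).
  rewrite !mxE dE// /q !big_distrr/=; apply: eq_bigr => k _.
  rewrite !mxE invfM; ring.
rewrite cE (circle_integral_laurent m (tayq x y))//; last lra.
have pi0 : (0 +i* (2 * pi) : R[i]) != 0.
  by rewrite eq_complex/= negb_and orbC gt_eqF ?mulr_gt0 ?pi_gt0.
rewrite mulNr mulrA mulVf// mul1r.
rewrite (ip_suml ip).
case: (m) @P => [|m'] P.
  by rewrite oppr0 big1// => j _; rewrite big_ord0 (ip0l ip).
rewrite ltnn add0r mulN1r opprK; apply: eq_bigr => j _.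
rewrite (ip_suml ip); apply: eq_bigr => i _.
by rewrite (ipZl ip) subSn// -ltnS.
Qed.

End FiniteRankPerturbation.
End LocalSpectrum.

(** * The strip and the hyperbola *)

Section StripEstimates.
Variable R : realType.
Implicit Types a b x y t k : R.

Lemma rel_sqr_ge0 a b x : 0 <= a ^+ 2 + b ^+ 2 * x ^+ 2.
Proof. by rewrite addr_ge0 ?sqr_ge0// mulr_ge0// sqr_ge0. Qed.

Lemma sqrt_rel_sqr a b x : Num.sqrt (a ^+ 2 + b ^+ 2 * x ^+ 2) ^+ 2 = a ^+ 2 + b ^+ 2 * x ^+ 2.
Proof. by rewrite sqr_sqrtr// rel_sqr_ge0. Qed.

Lemma sqrt_rel_ge a b x : 0 <= b -> b * `|x| <= Num.sqrt (a ^+ 2 + b ^+ 2 * x ^+ 2).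
Proof.
move=> b0; rewrite -(@ler_pXn2r _ 2)// ?nnegrE ?sqrtr_ge0 ?mulr_ge0//.
by rewrite sqrt_rel_sqr exprMn real_normK ?num_real// lerDr sqr_ge0.
Qed.

(** With r^2 = a^2 + b^2 alpha^2, the parabola for k = 0 equals m + 2 r dl at t = alpha and has
    slope - 2 L there. L >= 0 because b^2 |alpha| <= b |alpha| <= r, so the value does not drop to
    the left of alpha. *)
Lemma half_line_estimate a b alpha dl y : 0 <= b -> b < 1 -> 0 <= dl ->
  0 < dl ^+ 2 + y ^+ 2 ->
  exists e k, [/\ 0 < e, 0 < k, b ^+ 2 + k < 1 &
    forall t, t <= alpha + e -> a ^+ 2 + b ^+ 2 * t ^+ 2 + k * (1 + t ^+ 2) <=
      (t - (alpha + Num.sqrt (a ^+ 2 + b ^+ 2 * alpha ^+ 2) + dl)) ^+ 2 + y ^+ 2].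
Proof.
move=> b0 b1 dl0; set m := dl ^+ 2 + y ^+ 2 => m0.
have r2 := sqrt_rel_sqr a b alpha.
have r0 := sqrtr_ge0 (a ^+ 2 + b ^+ 2 * alpha ^+ 2).
have rb := sqrt_rel_ge a alpha b0.
move: (Num.sqrt _) r2 r0 rb => r r2 r0 rb.
have b2 : b ^+ 2 < 1 by rewrite expr_lt1.
have bal : 0 <= r + b ^+ 2 * alpha.
  have h1 : b ^+ 2 * `|alpha| <= b * `|alpha|.
    by rewrite ler_wpM2r// expr2 ler_piMr// ltW.
  have h2 : - (b ^+ 2 * `|alpha|) <= b ^+ 2 * alpha.
    by rewrite -mulrN ler_wpM2l ?sqr_ge0// lerNl (le_trans (ler_norm _))// normrN.
  lra.
pose L := r + dl + b ^+ 2 * alpha.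
have L0 : 0 <= L by rewrite /L; lra.
have al2 := sqr_ge0 alpha.
(* Half of m pays for going e beyond alpha, the other half for k (1 + 2 alpha^2); the remaining 2 k
   u^2 is covered by (1 - b^2) u^2, hence the second bound on k. *)
pose e := m / (4 * (L + 1)).
pose k := Num.min (m / 2 / (1 + 2 * alpha ^+ 2)) ((1 - b ^+ 2) / 2).
exists e, k.
have L1 : 0 < 4 * (L + 1) by lra.
have e0 : 0 < e by rewrite divr_gt0.
have eL : 2 * e * L <= m / 2.
  have : e * (4 * (L + 1)) = m by rewrite /e divfK// gt_eqF.
  by nra.
have k0 : 0 < k by rewrite lt_min !divr_gt0//; lra.
have k1 : k * (1 + 2 * alpha ^+ 2) <= m / 2.
  by rewrite -ler_pdivlMr ?ge_min ?lexx//; lra.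
have k2 : k <= (1 - b ^+ 2) / 2 by rewrite ge_min lexx orbT.
split=> //; first lra.
move=> t te; pose u := alpha - t.
have ue : - e <= u by rewrite /u; lra.
have tE : t = alpha - u by rewrite /u; ring.
have main : (t - (alpha + r + dl)) ^+ 2 + y ^+ 2 - (a ^+ 2 + b ^+ 2 * t ^+ 2) =
   m + 2 * r * dl + 2 * u * L + (1 - b ^+ 2) * u ^+ 2.
  by rewrite tE /L /m; ring: r2.
have tsq : 1 + t ^+ 2 <= (1 + 2 * alpha ^+ 2) + 2 * u ^+ 2.
  by rewrite tE; have := sqr_ge0 (alpha + u); rewrite sqrrB sqrrD; lra.
have h1 : k * (1 + t ^+ 2) <= k * ((1 + 2 * alpha ^+ 2) + 2 * u ^+ 2).
  by rewrite ler_pM2l.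
have h2 : 2 * k * u ^+ 2 <= (1 - b ^+ 2) * u ^+ 2.
  by rewrite ler_wpM2r ?sqr_ge0//; lra.
have h3 : - (2 * e * L) <= 2 * u * L by nra.
have h4 : 0 <= 2 * r * dl by rewrite !mulr_ge0.
have h5 : k * ((1 + 2 * alpha ^+ 2) + 2 * u ^+ 2) = k * (1 + 2 * alpha ^+ 2) + 2 * k * u ^+ 2 by ring.
rewrite h5 in h1; move: (k * (1 + t ^+ 2)) h1 => q h1.
by move: (k * (1 + 2 * alpha ^+ 2)) k1 h1 => p k1 h1; lra.
Qed.

(** The half-line on the right is the reflection of the one on the left, with - beta for alpha. The
    quantifier over y' lets one choice of al, be and k serve a vertical half-line. *)
Lemma strip_estimate a b alpha beta x y : 0 <= b -> b < 1 ->
  let ra := Num.sqrt (a ^+ 2 + b ^+ 2 * alpha ^+ 2) in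
  let rb := Num.sqrt (a ^+ 2 + b ^+ 2 * beta ^+ 2) in
  alpha < beta -> alpha + ra <= x -> x <= beta - rb ->
  (x = alpha + ra -> y != 0) -> (x = beta - rb -> y != 0) ->
  exists al be k, [/\ alpha < al, al <= be, be < beta, 0 < k & b ^+ 2 + k < 1 /\
    forall y' t, `|y| <= `|y'| -> t <= al \/ be <= t ->
      a ^+ 2 + b ^+ 2 * t ^+ 2 + k * (1 + t ^+ 2) <= (t - x) ^+ 2 + y' ^+ 2].
Proof.
move=> b0 b1 ra rb ab xa xb ya yb.
have pos d : (d = 0 -> y != 0) -> 0 < d ^+ 2 + y ^+ 2.
  move=> h; have [/eqP d0|d0] := boolP (d == 0).
    by rewrite d0 expr0n add0r exprn_even_gt0//= h.
  by rewrite ltr_pwDl ?sqr_ge0// exprn_even_gt0.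
have [e [k [e0 k0 bk he]]] := @half_line_estimate a b alpha (x - (alpha + ra)) y b0 b1
  ltac:(lra) ltac:(by apply: pos => h; apply: ya; lra).
have [e' [k' [e'0 k'0 bk' he']]] := @half_line_estimate a b (- beta) (beta - rb - x) y b0 b1
  ltac:(lra) ltac:(by apply: pos => h; apply: yb; lra).
(* Moving each end by at most a third keeps al <= be. *)
pose d := (beta - alpha) / 3.
have d0 : 0 < d by rewrite divr_gt0// subr_gt0.
pose f := Num.min d e; pose f' := Num.min d e'.
have f0 : 0 < f by rewrite lt_min d0.
have f'0 : 0 < f' by rewrite lt_min d0.
have fd : f <= d by rewrite ge_min lexx.
have f'd : f' <= d by rewrite ge_min lexx.
have fe : f <= e by rewrite ge_min lexx orbT.
have f'e : f' <= e' by rewrite ge_min lexx orbT.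
exists (alpha + f), (beta - f'), (Num.min k k'); split.
- lra.
- by move: fd f'd; rewrite /d; lra.
- lra.
- by rewrite lt_min k0.
have kk : Num.min k k' <= k by rewrite ge_min lexx.
have kk' : Num.min k k' <= k' by rewrite ge_min lexx orbT.
split; first lra.
move=> y' t yy' ht.
have y2 : y ^+ 2 <= y' ^+ 2.
  by rewrite -(real_normK (num_real y)) -(real_normK (num_real y')) lerXn2r ?nnegrE.
have t0 : 0 <= 1 + t ^+ 2 by rewrite addr_ge0 ?sqr_ge0.
case: ht => ht.
  have h := he t ltac:(lra); rewrite -/ra in h.
  have e1 : alpha + ra + (x - (alpha + ra)) = x by ring.
  by rewrite e1 in h; have := ler_wpM2r t0 kk; lra.
have := he' (- t) ltac:(lra); rewrite !sqrrN -/rb => h.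
have := ler_wpM2r t0 kk'.
have : (- t - (- beta + rb + (beta - rb - x))) ^+ 2 = (t - x) ^+ 2 by ring.
move=> e1; rewrite e1 in h; lra.
Qed.

(** The parabola is (q - k) t^2 - 2 x t + (X - k), nonnegative once (q - k)(X - k) >= x^2. The
    hypothesis yields q X > x^2, which leaves room for a small k. *)
Lemma hyperbola_estimate a b x y : 0 <= b -> b < 1 ->
  (a ^+ 2 + b ^+ 2 * x ^+ 2) / (1 - b ^+ 2) < y ^+ 2 ->
  exists k, [/\ 0 < k, b ^+ 2 + k < 1 & forall t,
    a ^+ 2 + b ^+ 2 * t ^+ 2 + k * (1 + t ^+ 2) <= (t - x) ^+ 2 + y ^+ 2].
Proof.
move=> b0 b1; have b2 : b ^+ 2 < 1 by rewrite expr_lt1.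
pose q := 1 - b ^+ 2; have q0 : 0 < q by rewrite /q; lra.
rewrite -/q ltr_pdivrMr// => hy.
pose X := x ^+ 2 + y ^+ 2 - a ^+ 2.
have ab2 : 0 <= a ^+ 2 * b ^+ 2 by rewrite mulr_ge0 ?sqr_ge0.
have D0 : 0 < q * X - x ^+ 2.
  by move: hy; rewrite /X /q; nra.
have X0 : 0 < X.
  by rewrite -(pmulr_rgt0 _ q0); have := sqr_ge0 x; lra.
have qX : 0 < q + X by lra.
pose k := Num.min (q / 2) ((q * X - x ^+ 2) / (q + X)).
have k0 : 0 < k by rewrite lt_min !divr_gt0.
have kq : k <= q / 2 by rewrite ge_min lexx.
have kD : k * (q + X) <= q * X - x ^+ 2.
  by rewrite -ler_pdivlMr// ge_min lexx orbT.
exists k; split=> //; first by rewrite /q in kq; move: kq q0; rewrite /q; lra.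
move=> t; have p0 : 0 < q - k by lra.
rewrite -subr_ge0 -(pmulr_rge0 _ p0).
have -> : (q - k) * ((t - x) ^+ 2 + y ^+ 2 - (a ^+ 2 + b ^+ 2 * t ^+ 2 + k * (1 + t ^+ 2))) =
  ((q - k) * t - x) ^+ 2 + (q * X - x ^+ 2 - k * (q + X) + k ^+ 2).
  by rewrite /X /q; ring.
by rewrite addr_ge0 ?sqr_ge0//; have := sqr_ge0 k; lra.
Qed.

End StripEstimates.

(** * Spectra of T + A *)

Section MainResults.
Variables (R : realType) (H : completeNormedModType R[i]).
Variable ip : {dot H for (@Num.conj R[i])}.
Hypothesis ip_norm : forall x : H, ip x x = `|x| ^+ 2.
Implicit Types (S T A : linop H) (u v w : H) (z : R[i]).

Lemma rel_bounded_sum T A (a b : R) : opdom T `<=` opdom A -> rel_bounded_by T A a b ->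
  (forall x, opdom (opD T A) x <-> opdom T x) /\
  (forall x, opdom T x -> nm (opD T A x - T x) ^+ 2 <= a ^+ 2 * nm x ^+ 2 + b ^+ 2 * nm (T x) ^+ 2).
Proof.
move=> TA /rel_boundedE h; split=> [x|x Tx].
  by split=> [[]//|Tx]; split=> //; exact: TA.
by rewrite /= addrC addKr; exact: h.
Qed.

Lemma rel_bounded_scale T A (a b s : R) : 0 <= s <= 1 ->
  rel_bounded_by T A a b -> rel_bounded_by T (opZ s%:C A) a b.
Proof.
move=> /andP[s0 s1] /rel_boundedE h; apply/rel_boundedE => x Tx.
apply: le_trans (h x Tx); rewrite /= nmZ nmRe exprMn.
by rewrite ler_piMl ?sqr_ge0// ger0_norm// expr_le1.
Qed.

Lemma hyperbola_resolvent T A (a b : R) z : self_adjoint ip T ->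
  opdom T `<=` opdom A -> rel_bounded_by T A a b -> 0 <= b -> b < 1 ->
  (a ^+ 2 + b ^+ 2 * complex.Re z ^+ 2) / (1 - b ^+ 2) < complex.Im z ^+ 2 ->
  resolvent_set (opD T A) z.
Proof.
move=> Tsa TA TAab b0 b1 hz; have [dS hS] := rel_bounded_sum TA TAab.
have [k [k0 bk hk]] := hyperbola_estimate b0 b1 hz.
(* The interval ]1, 0[ is empty, so the gap condition is void and the estimate is asked of every
   real t. *)
apply: (gap_resolvent ip_norm (al := 1) (be := 0) Tsa k0 bk) dS hS => t.
  by move=> h1 h2; exfalso; lra.
by move=> _; exact: hk.
Qed.

Lemma strip_resolvent T A (a b alpha beta : R) z : self_adjoint ip T ->
  opdom T `<=` opdom A -> rel_bounded_by T A a b -> 0 <= b -> b < 1 ->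
  (forall t : R, alpha < t -> t < beta -> resolvent_set T t%:C) ->
  alpha + Num.sqrt (a ^+ 2 + b ^+ 2 * alpha ^+ 2) < complex.Re z ->
  complex.Re z < beta - Num.sqrt (a ^+ 2 + b ^+ 2 * beta ^+ 2) ->
  resolvent_set (opD T A) z.
Proof.
move=> Tsa TA TAab b0 b1 gap z1 z2; have [dS hS] := rel_bounded_sum TA TAab.
have ra0 := sqrtr_ge0 (a ^+ 2 + b ^+ 2 * alpha ^+ 2).
have rb0 := sqrtr_ge0 (a ^+ 2 + b ^+ 2 * beta ^+ 2).
have [|||||al [be [k [h1 h2 h3 k0 [bk hk]]]]] :=
    @strip_estimate R a b alpha beta (complex.Re z) (complex.Im z) b0 b1.
- lra.
- exact: ltW.
- exact: ltW.
- by move=> e; move: z1; rewrite e ltxx.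
- by move=> e; move: z2; rewrite e ltxx.
apply: (gap_resolvent ip_norm (al := al) (be := be) Tsa k0 bk) dS hS => t.
  by move=> h4 h5; apply: gap; lra.
exact: hk.
Qed.

(** If the disc missed the spectrum, openness of the resolvent set at c - r and c + r would free a
    longer real interval of half-length r + e, and [symmetric_dist] would contradict a vector with
    ratio at most r + e / 2. *)
Lemma symmetric_spectrum_disc S (c r : R) : symmetric_op ip S -> 0 <= r ->
  (forall e : R, 0 < e -> exists u, [/\ opdom S u, 0 < nm u &
    nm (opshift S c%:C u) <= (r + e) * nm u]) ->
  spectrum S `&` [set z | `|z - c%:C| <= r%:C] !=set0.
Proof.
move=> sym r0 app; apply: contrapT => no.
have res z : nm (z - c%:C) <= r -> resolvent_set S z.
  move=> h; apply: contrapT => hz; apply: no; exists z; split=> //=.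
  by rewrite nmE lecR.
have real (t : R) : `|t - c| <= r -> resolvent_set S t%:C.
  by move=> h; apply: res; rewrite -rmorphB/= nmRe.
have [e1 e10 h1] := resolvent_open (real (c + r) ltac:(by rewrite [c + r - c]addrC addKr ger0_norm)).
have [e2 e20 h2] := resolvent_open (real (c - r) ltac:(by rewrite [c - r - c]addrC addKr normrN ger0_norm)).
pose e := Num.min e1 e2.
have e0 : 0 < e by rewrite lt_min e10.
have ee1 : e <= e1 by rewrite ge_min lexx.
have ee2 : e <= e2 by rewrite ge_min lexx orbT.
have near (t : R) : `|t - c| < r + e -> resolvent_set S t%:C.
  move=> h; have [tr|tr] := leP `|t - c| r; first exact: real.
  move: h tr; have [tc|tc] := leP 0 (t - c) => h tr.
    by rewrite ger0_norm// in h tr; apply: h1; rewrite -rmorphB/= nmRe ler_norml; lra.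
  by rewrite ltr0_norm// in h tr; apply: h2; rewrite -rmorphB/= nmRe ler_norml; lra.
have [u [Su u0 hu]] := app (e / 2) (divr_gt0 e0 (ltr0Sn _ 1)).
have := le_trans (symmetric_dist ip_norm sym near Su) hu.
by rewrite ler_pM2r//; lra.
Qed.

(** An approximate eigenvector u of T at c has |T u| at most slightly above |c| |u|, hence |A u| at
    most slightly above r |u|. *)
Lemma spectrum_disc T A (a b c : R) : self_adjoint ip T -> symmetric_op ip A ->
  opdom T `<=` opdom A -> rel_bounded_by T A a b -> 0 <= b -> b < 1 ->
  spectrum T c%:C ->
  let r := Num.sqrt (a ^+ 2 + b ^+ 2 * c ^+ 2) in
  spectrum (opD T A) `&` [set z | `|z - c%:C| <= r%:C] !=set0.
Proof.
move=> Tsa Asym TA TAab b0 b1 sc r.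
have r2 : r ^+ 2 = a ^+ 2 + b ^+ 2 * c ^+ 2 by exact: sqrt_rel_sqr.
have rb : b * `|c| <= r by exact: sqrt_rel_ge.
have r0 : 0 <= r by exact: sqrtr_ge0.
apply: symmetric_spectrum_disc => //.
  move=> x y [Tx Ax] [Ty Ay] /=.
  by rewrite (ipDl ip) (ipDr ip) (sa_sym Tsa Tx Ty) (Asym _ _ Ax Ay).
move=> e e0; pose m := e / 2; have m0 : 0 < m by rewrite divr_gt0.
have [u [Tu hu]] : exists u, opdom T u /\ nm (opshift T c%:C u) < m * nm u.
  apply: contrapT => no; apply: sc.
  have lo u : opdom T u -> m * nm u <= nm (opshift T c%:C u).
    by move=> Tu; rewrite leNgt; apply/negP => h; apply: no; exists u.
  by apply: (sa_resolvent ip_norm Tsa m0) => //; rewrite conjc_real.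
have u0 : 0 < nm u.
  by rewrite -(pmulr_rgt0 _ m0); apply: le_lt_trans hu; exact: nm_ge0.
exists u; split=> //; first by split=> //; exact: TA.
have -> : opshift (opD T A) c%:C u = opshift T c%:C u + A u by rewrite /opshift /= addrAC.
have hT : nm (T u) <= (`|c| + m) * nm u.
  rewrite -[T u](subrK (c%:C *: u)) (le_trans (nmD _ _))// nmZ nmRe.
  by move: hu; rewrite /opshift mulrDl; lra.
have hA : nm (A u) <= (r + m) * nm u.
  have rm : 0 <= r + m by rewrite addr_ge0// ltW.
  rewrite -(@ler_pXn2r _ 2)// ?nnegrE ?nm_ge0 ?mulr_ge0 ?nm_ge0//.
  have /rel_boundedE h := TAab; apply: (le_trans (h u Tu)).
  have hT2 : nm (T u) ^+ 2 <= ((`|c| + m) * nm u) ^+ 2.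
    by rewrite ler_pXn2r// ?nnegrE ?nm_ge0 ?mulr_ge0 ?nm_ge0 ?addr_ge0// ltW.
  have := ler_wpM2l (sqr_ge0 b) hT2; rewrite !exprMn => hb.
  have u2 := sqr_ge0 (nm u).
  have coef : a ^+ 2 + b ^+ 2 * (`|c| + m) ^+ 2 <= (r + m) ^+ 2.
    have b21 : b ^+ 2 <= 1 by rewrite expr_le1// ltW.
    have h1 : b * (b * `|c|) <= 1 * r by rewrite ler_pM ?mulr_ge0// ltW.
    have h2 : b ^+ 2 * m ^+ 2 <= m ^+ 2 by rewrite ler_piMl ?sqr_ge0.
    have h3 : m * (b * (b * `|c|)) <= m * r by rewrite ler_pM2l// -[r]mul1r.
    rewrite !sqrrD r2 real_normK ?num_real//.
    by rewrite expr2 in b21; move: h2 h3; rewrite (expr2 b); lra.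
  by have := ler_wpM2r u2 coef; move: hb; rewrite mulrDl mulrA; lra.
rewrite (le_trans (nmD _ _))//.
by move: hA hu; rewrite /m; lra.
Qed.

Lemma essential_strip T A (a b alpha beta : R) z : self_adjoint ip T ->
  opdom T `<=` opdom A -> rel_bounded_by T A a b -> 0 <= b -> b < 1 ->
  (forall t : R, alpha < t -> t < beta -> fredholm T t%:C) ->
  let ra := Num.sqrt (a ^+ 2 + b ^+ 2 * alpha ^+ 2) in
  let rb := Num.sqrt (a ^+ 2 + b ^+ 2 * beta ^+ 2) in
  ra + rb < beta - alpha ->
  alpha + ra <= complex.Re z -> complex.Re z <= beta - rb ->
  z != (alpha + ra)%:C -> z != (beta - rb)%:C ->
  [/\ exists2 r : R, 0 < r & forall z', z' != z -> nm (z' - z) <= r ->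
        resolvent_set (opD T A) z',
      fin_alg_mult ip (opD T A) z &
      spectrum (opD T A) z -> point_spectrum (opD T A) z].
Proof.
move=> Tsa TA TAab b0 b1 fred ra rb rab za zb nza nzb.
case: z za zb nza nzb => x y /= za zb nza nzb.
have ra0 : 0 <= ra by exact: sqrtr_ge0.
have rb0 : 0 <= rb by exact: sqrtr_ge0.
have [|||||al [be [k [h1 h2 h3 k0 [bk hk]]]]] :=
    @strip_estimate R a b alpha beta x y b0 b1.
- lra.
- exact: za.
- exact: zb.
- by move=> e; apply: contraNneq nza => ->; rewrite e.
- by move=> e; apply: contraNneq nzb => ->; rewrite e.
have /rel_boundedE TAab' := TAab.
have [n [f [g [S0 [dS0 SE hS0]]]]] := essential_gap_reduction ip_norm Tsa TA TAab' h2
  (fun t ht => fred t (lt_le_trans h1 (andP ht).1) (le_lt_trans (andP ht).2 h3)).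
set S := opD T A.
have domE : opdom S = opdom S0.
  rewrite dS0; apply/seteqP; split=> [u []//|u Tu]; split=> //; exact: TA.
have SE' u : opdom S0 u -> S u = S0 u + finite_rank ip n f g u.
  by rewrite dS0 => /SE.
(* The path zt leaves z vertically, away from the real axis, so that the estimate for S0 persists
   along it. *)
pose s : R := if 0 <= y then 1 else -1.
have nys t : 0 <= t -> `|y| <= `|y + s * t|.
  rewrite /s; case: ifP => [y0 t0|/negbT]; first by rewrite mul1r !ger0_norm//; lra.
  by rewrite -ltNge => y0 t0; rewrite mulN1r !ltr0_norm//; lra.
pose zt t : R[i] := x +i* (y + s * t).
have rS0 t : 0 <= t -> resolvent_set S0 (zt t).
  by move=> t0; apply: (hS0 _ k k0 bk) => u hu; apply: hk => //; exact: nys.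
have ztB t t' : nm (zt t - zt t') = `|t - t'|.
  have -> : zt t - zt t' = 'i%C * (s * (t - t'))%:C.
    by apply/eqP; rewrite eq_complex/=; apply/andP; split; apply/eqP; ring.
  rewrite nmM nmRe (_ : nm 'i%C = 1) ?mul1r ?normrM.
    by rewrite /s; case: ifP => _; rewrite ?normrN normr1 mul1r.
  by apply/eqP; rewrite -(@eqrXn2 _ 2)// ?nm_ge0// nm_sqr/= expr0n/= add0r expr1n.
pose B t := exists2 r : R, 0 < r & forall z, nm (z - zt t) <= r -> spectrum S z.
have nB : ~ B 0.
  pose Mx := (a ^+ 2 + b ^+ 2 * x ^+ 2) / (1 - b ^+ 2).
  have Mx0 : 0 <= Mx.
    by rewrite divr_ge0 ?rel_sqr_ge0// subr_ge0 expr_le1// ltW.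
  (* At this height the square of the imaginary part is at least (Mx + 1)^2 > Mx. *)
  have top : resolvent_set S (zt (Mx + 1)).
    apply: (hyperbola_resolvent Tsa TA TAab b0 b1) => /=; rewrite -/Mx.
    have : (Mx + 1) ^+ 2 <= (y + s * (Mx + 1)) ^+ 2.
      by rewrite /s; case: ifP => [|/negbT]; rewrite -?ltNge => y0; nra.
    by nra.
  have : B 0 -> B (Mx + 1).
    apply: (cousin (Q := fun c d => B c -> B d)) => [|t /andP[t0 _]|c d e _ _ h h' /h//]; first lra.
    have [[r r0 hr]|[[r r0 hr] _]] := local_dichotomy ip_norm domE SE' (rS0 t t0).
      exists (r / 2); first by rewrite divr_gt0.
      move=> c d h4 h5 h6 _ _ _; exists (r / 2); first by rewrite divr_gt0.
      move=> z hz; apply: hr; rewrite (le_trans (nm_tri (zt d) _ _))//.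
      have : nm (zt d - zt t) <= r / 2 by rewrite ztB ler_norml; lra.
      by lra.
    (* The punctured disc about zt t is free of spectrum, so B c fails for every nearby c: zt c
       itself is a witness if c differs from t, and zt (t + q) if c = t. *)
    exists r => // c d h4 h5 h6 _ _ [r' r'0 hr'].
    have [ct|ct] := eqVneq c t; last first.
      exfalso; apply: (hr' (zt c)); first by rewrite subrr nm0 ltW.
      apply: hr; last by rewrite ztB ler_norml; lra.
      by rewrite -subr_eq0 -nm_gt0 ztB normr_gt0 subr_eq0.
    pose q := Num.min r r'.
    have q0 : 0 < q by rewrite lt_min r0.
    have dq : nm (zt (t + q) - zt t) = q by rewrite ztB [t + q - t]addrC addKr gtr0_norm.
    exfalso; apply: (hr' (zt (t + q))).
      by rewrite ct dq ge_min lexx orbT.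
    apply: hr; last by rewrite dq ge_min lexx.
    by rewrite -subr_eq0 -nm_gt0 dq.
  move=> h /h[r r0 /(_ (zt (Mx + 1)))]; apply=> //.
  by rewrite subrr nm0 ltW.
have z0E : zt 0 = x +i* y by rewrite /zt mulr0 addr0.
have [hB|[hr hm]] := local_dichotomy ip_norm domE SE' (rS0 0 (lexx _)).
  by exfalso; apply: nB.
rewrite z0E in hr hm; split=> //.
by move=> sz; apply: (spectrum_eigen ip_norm domE SE') => //; rewrite -z0E; exact: rS0.
Qed.

Lemma approx_by_rat (z : R[i]) (e : R) : 0 < e ->
  exists p q : rat, nm (z - (ratr p +i* ratr q)) < e.
Proof.
move=> e0; case: z => x y.
have [p] := @rat_in_itvoo R (x - e / 2) (x + e / 2) ltac:(lra).
have [q] := @rat_in_itvoo R (y - e / 2) (y + e / 2) ltac:(lra).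
rewrite !in_itv/= => /andP[q1 q2] /andP[p1 p2]; exists p, q.
rewrite -(@ltr_pXn2r _ 2)// ?nnegrE ?nm_ge0 ?ltW// nm_sqr/=.
set u := x - _; set v := y - _.
have u2 : u ^+ 2 < (e / 2) ^+ 2.
  by rewrite -(real_normK (num_real u)) ltr_pXn2r// ?nnegrE ?divr_ge0 ?ltW// ltr_norml /u; lra.
have v2 : v ^+ 2 < (e / 2) ^+ 2.
  by rewrite -(real_normK (num_real v)) ltr_pXn2r// ?nnegrE ?divr_ge0 ?ltW// ltr_norml /v; lra.
by move: u2 v2; rewrite !expr_div_n; have := exprn_gt0 2 e0; lra.
Qed.

(** Each point is coded by a rational point within 1 / (n + 1) of it and by n, where radius 2 / (n +
    1) isolates it; two points with the same code are closer than that. *)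
Lemma countable_isolated (E : set R[i]) :
  (forall z, E z -> exists2 r : R, 0 < r &
     forall z', z' != z -> nm (z' - z) <= r -> ~ E z') ->
  countable E.
Proof.
move=> iso.
have : forall z, exists c : rat * rat * nat, E z ->
    nm (z - (ratr c.1.1 +i* ratr c.1.2)) < c.2.+1%:R^-1 /\
    forall z', z' != z -> nm (z' - z) <= 2 * c.2.+1%:R^-1 -> ~ E z'.
  move=> z; have [Ez|nEz] := pselect (E z); last by exists (0, 0, 0%N).
  have [r r0 hr] := iso z Ez.
  pose n := Num.truncn (2 / r).
  have nr : 2 * n.+1%:R^-1 <= r.
    by rewrite ler_pdivrMr// mulrC -ler_pdivrMr// ltW// truncnS_gt.
  have [p [q hpq]] := @approx_by_rat z n.+1%:R^-1 ltac:(by rewrite invr_gt0).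
  exists (p, q, n) => _; split=> // z' zz' hz'; apply: hr => //.
  exact: le_trans hz' nr.
move=> /choice[c hc]; apply/countable_injP; exists (pickle \o c) => z z'.
rewrite !inE => Ez Ez' /= /(pcan_inj pickleK) e.
have [h1 h2] := hc z Ez; have [h3 _] := hc z' Ez'.
apply/eqP; apply: contrapT => /negP zz'; apply: (h2 z') => //; first by rewrite eq_sym.
rewrite -e in h3; rewrite nm_sym.
apply: (le_trans (nm_tri (ratr (c z).1.1 +i* ratr (c z).1.2) _ _)).
move: h1 h3; rewrite [X in _ -> X < _ -> _]nm_sym => h1 h3.
by move: (c z).2.+1%:R^-1 h1 h3 => q h1 h3; lra.
Qed.

End MainResults.

Theorem theorem2p1 (R : realType) (H : completeNormedModType R[i])
    (ip : {dot H for (@Num.conj R[i])})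
    (ip_norm : forall x : H, ip x x = `|x| ^+ 2)
    (T A : linop H) (Tsa : self_adjoint ip T)
    (TA : rel_bounded T A) (TA1 : rel_bound T A < 1)
    (a b : R) (a0 : 0 <= a) (b0 : 0 <= b) (b1 : b < 1)
    (TAab : rel_bounded_by T A a b) :
  [/\
    spectrum (opD T A) `&`
      [set z | `|complex.Im z| ^+ 2 > (a ^+ 2 + b ^+ 2 * `|complex.Re z| ^+ 2) / (1 - b ^+ 2)]
      = set0,
    forall alpha beta : R,
      let ra := Num.sqrt (a ^+ 2 + b ^+ 2 * alpha ^+ 2) in
      let rb := Num.sqrt (a ^+ 2 + b ^+ 2 * beta ^+ 2) in
      spectrum T `&` [set t%:C | t in `]alpha, beta[ ] = set0 ->
      spectrum T alpha%:C -> spectrum T beta%:C ->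
      ra + rb < beta - alpha ->
      (forall s : R, 0 <= s <= 1 ->
        spectrum (opD T (opZ s%:C A)) `&`
          [set z | alpha + ra < complex.Re z < beta - rb] = set0) /\
      (symmetric_op ip A ->
        spectrum (opD T A) `&` [set z | `|z - alpha%:C| <= ra%:C] !=set0 /\
        spectrum (opD T A) `&` [set z | `|z - beta%:C| <= rb%:C] !=set0) &
    forall alpha beta : R,
      let ra := Num.sqrt (a ^+ 2 + b ^+ 2 * alpha ^+ 2) in
      let rb := Num.sqrt (a ^+ 2 + b ^+ 2 * beta ^+ 2) in
      ess_spectrum T `&` [set t%:C | t in `]alpha, beta[ ] = set0 ->
      ess_spectrum T alpha%:C -> ess_spectrum T beta%:C ->
      ra + rb < beta - alpha ->
      let E := spectrum (opD T A) `&`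
        [set z | alpha + ra < complex.Re z < beta - rb] in
      [/\ countable E,
        forall z, E z ->
          [/\ @isolated R[i]^o (spectrum (opD T A)) z,
              point_spectrum (opD T A) z & fin_alg_mult ip (opD T A) z] &
        @limit_point R[i]^o E `<=`
          [set (alpha + ra)%:C; (beta - rb)%:C] ] ].
Proof.
have dTA := TA.1; split.
- rewrite -subset0 => z [sz /=]; rewrite !real_normK ?num_real// => hz.
  exact: sz (hyperbola_resolvent ip_norm Tsa dTA TAab b0 b1 hz).
- move=> alpha beta ra rb gap sa sb rab; split=> [s s01|Asym]; last first.
    by split; apply: spectrum_disc.
  rewrite -subset0 => z [sz /= /andP[z1 z2]]; apply: sz.
  apply: (@strip_resolvent _ _ ip ip_norm T (opZ s%:C A) a b alpha beta) => //.
    exact: rel_bounded_scale.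
  move=> t t1 t2; apply: contrapT => st.
  by rewrite -[False]/(set0 t%:C) -gap; split=> //; exists t => //; rewrite /= in_itv/= t1.
move=> alpha beta ra rb gap _ _ rab E.
have fred (t : R) : alpha < t -> t < beta -> fredholm T t%:C.
  move=> t1 t2; apply: contrapT => st.
  by rewrite -[False]/(set0 t%:C) -gap; split=> //; exists t => //; rewrite /= in_itv/= t1.
have loc := essential_strip ip_norm Tsa dTA TAab b0 b1 fred rab.
have E_strip z : E z -> [/\ alpha + ra <= complex.Re z, complex.Re z <= beta - rb,
    z != (alpha + ra)%:C & z != (beta - rb)%:C].
  move=> [_ /= /andP[z1 z2]]; rewrite !ltW//; split=> //.
    by apply: contraTneq z1 => ->; rewrite ltxx.
  by apply: contraTneq z2 => ->; rewrite ltxx.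
have nbhs_ball (z : R[i]) (r : R) : 0 < r ->
    nbhs (z : R[i]^o) [set z' | nm (z' - z) <= r].
  move=> r0; apply/nbhs_ballP; exists r%:C => /=; first by rewrite ltcR.
  by move=> z'; rewrite /ball/= nmE ltcR nm_sym => /ltW.
split.
- apply: countable_isolated => z Ez; have [h1 h2 h3 h4] := E_strip z Ez.
  have [[r r0 hr] _ _] := loc z h1 h2 h3 h4.
  by exists r => // z' zz' hz' [sz' _]; exact: sz' (hr z' zz' hz').
- move=> z Ez; have [h1 h2 h3 h4] := E_strip z Ez.
  have [[r r0 hr] hm hp] := loc z h1 h2 h3 h4.
  split=> //; last by apply: hp; exact: Ez.1.
  split; first by rewrite inE; exact: Ez.1.
  exists [set z' | nm (z' - z) <= r]; first exact: nbhs_ball.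
  apply/seteqP; split=> [z' /= [hz' sz']|_ ->]; last first.
    by split; [rewrite /= subrr nm0 ltW|exact: Ez.1].
  by apply/eqP; apply: contrapT => /negP zz'; exact: sz' (hr z' zz' hz').
move=> z zlim; apply: contrapT => /not_orP[nza nzb].
have close (e : R) : 0 < e -> exists z', [/\ z' != z, E z' & nm (z' - z) <= e].
  by move=> e0; have [z' [zz' Ez' hz']] := zlim _ (nbhs_ball z e e0); exists z'.
(* A limit point lies in the closed strip; off the two corners [essential_strip] gives a punctured
   disc free of spectrum, so E cannot accumulate there. *)
have h1 : alpha + ra <= complex.Re z.
  rewrite leNgt; apply/negP => lt.
  have [z' [_ [_ /= /andP[z1 _]] hz']] := close (alpha + ra - complex.Re z) ltac:(lra).
  have := le_trans (Re_le_nm _) hz'; rewrite raddfB/= ler_norml; lra.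
have h2 : complex.Re z <= beta - rb.
  rewrite leNgt; apply/negP => lt.
  have [z' [_ [_ /= /andP[_ z2]] hz']] := close (complex.Re z - (beta - rb)) ltac:(lra).
  have := le_trans (Re_le_nm _) hz'; rewrite raddfB/= ler_norml; lra.
have [[r r0 hr] _ _] := loc z h1 h2 ltac:(exact/eqP) ltac:(exact/eqP).
have [z' [zz' [sz' _] hz']] := close r r0.
exact: sz' (hr z' zz' hz').
Qed.
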